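(* For every positive integer $k$ there exist a bounded pseudoconvex domain $D\subset\mathbb C^3$ with $C^k$-smooth boundary, a point $P\in\partial D$, a number $\varepsilon>0$, and a decreasing sequence $(\delta_\nu)_{\nu}$ of positive numbers with $\delta_\nu\to0$ and $P_{\delta_\nu}:=P-\delta_\nu n\in D$ for all $\nu$, such that $$\kappa_D(P_{\delta_\nu};n)\le \frac{1}{\delta_\nu^{1-\varepsilon}}\quad\text{for all }\nu,$$ where $n$ denotes the unit outward normal vector to $\partial D$ at $P$.
   Context: For a domain $D\subset\mathbb C^m$, $z\in D$ and $X\in\mathbb C^m$, the Kobayashi–Royden (pseudo)metric is $\kappa_D(z;X):=\inf\{\alpha>0:\ \text{there is } f\in\mathcal O(\mathbb D,D)\text{ with } f(0)=z,\ \alpha f'(0)=X\}$, where $\mathbb D$ is the open unit disc in $\mathbb C$ and $\mathcal O(\mathbb D,D)$ is the set of holomorphic maps $\mathbb D\to D$. *)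

(* Defs.v *)
From Stdlib Require Import Reals List.
Open Scope R_scope.

Definition C := (R * R)%type.
Definition C0 : C := (0, 0).
Definition Ci : C := (0, 1).
Definition C1 : C := (1, 0).
Definition Cadd (a b : C) : C := (fst a + fst b, snd a + snd b).
Definition Copp (a : C) : C := (- fst a, - snd a).
Definition Cmul (a b : C) : C :=
  (fst a * fst b - snd a * snd b, fst a * snd b + snd a * fst b).
Definition Crscal (t : R) (a : C) : C := (t * fst a, t * snd a).
Definition Cnorm (a : C) : R := sqrt (fst a ^ 2 + snd a ^ 2).
Definition Cdist (a b : C) : R := Cnorm (Cadd a (Copp b)).
Definition basisC : list C := C1 :: Ci :: nil.

Definition C3 := (C * C * C)%type.
Definition V3 (a b c : C) : C3 := (a, b, c).
Definition c1 (z : C3) : C := fst (fst z).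
Definition c2 (z : C3) : C := snd (fst z).
Definition c3 (z : C3) : C := snd z.
Definition V3add (z w : C3) : C3 :=
  V3 (Cadd (c1 z) (c1 w)) (Cadd (c2 z) (c2 w)) (Cadd (c3 z) (c3 w)).
Definition V3opp (z : C3) : C3 := V3 (Copp (c1 z)) (Copp (c2 z)) (Copp (c3 z)).
Definition V3sub (z w : C3) : C3 := V3add z (V3opp w).
Definition V3rscal (t : R) (z : C3) : C3 :=
  V3 (Crscal t (c1 z)) (Crscal t (c2 z)) (Crscal t (c3 z)).
Definition V3cscal (l : C) (z : C3) : C3 :=
  V3 (Cmul l (c1 z)) (Cmul l (c2 z)) (Cmul l (c3 z)).
Definition Cdot (a b : C) : R := fst a * fst b + snd a * snd b.
Definition V3dot (z w : C3) : R :=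
  Cdot (c1 z) (c1 w) + Cdot (c2 z) (c2 w) + Cdot (c3 z) (c3 w).
Definition V3norm (z : C3) : R := sqrt (V3dot z z).
Definition V3dist (z w : C3) : R := V3norm (V3sub z w).
Definition V3zero : C3 := V3 C0 C0 C0.
Definition basis6 : list C3 :=
  V3 C1 C0 C0 :: V3 Ci C0 C0 :: V3 C0 C1 C0 :: V3 C0 Ci C0 ::
  V3 C0 C0 C1 :: V3 C0 C0 Ci :: nil.

Definition is_open {V} (dist : V -> V -> R) (U : V -> Prop) : Prop :=
  forall x, U x -> exists r, r > 0 /\ forall y, dist x y < r -> U y.
Definition is_closed {V} (dist : V -> V -> R) (K : V -> Prop) : Prop :=
  forall x, (forall eps, eps > 0 -> exists y, K y /\ dist x y < eps) -> K x.
Definition is_bounded {V} (dist : V -> V -> R) (x0 : V) (K : V -> Prop) : Prop :=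
  exists M, forall x, K x -> dist x x0 <= M.
(* in C and C^3 (finite-dimensional): compact = closed and bounded *)
Definition is_compact {V} (dist : V -> V -> R) (x0 : V) (K : V -> Prop) : Prop :=
  is_closed dist K /\ is_bounded dist x0 K.
Definition closure {V} (dist : V -> V -> R) (D : V -> Prop) (x : V) : Prop :=
  forall eps, eps > 0 -> exists y, D y /\ dist x y < eps.
Definition interior {V} (dist : V -> V -> R) (K : V -> Prop) (x : V) : Prop :=
  exists r, r > 0 /\ forall y, dist x y < r -> K y.
Definition bdry {V} (dist : V -> V -> R) (D : V -> Prop) (x : V) : Prop :=
  closure dist D x /\ ~ interior dist D x.
Definition is_connected {V} (dist : V -> V -> R) (D : V -> Prop) : Prop :=
  forall A B : V -> Prop, is_open dist A -> is_open dist B ->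
    (forall x, D x -> A x \/ B x) ->
    (forall x, D x -> A x -> B x -> False) ->
    (forall x, D x -> A x) \/ (forall x, D x -> B x).
Definition is_domain {V} (dist : V -> V -> R) (D : V -> Prop) : Prop :=
  is_open dist D /\ is_connected dist D /\ exists x, D x.
Definition cont_on {V} (dist : V -> V -> R) (U : V -> Prop) (f : V -> R) : Prop :=
  forall x, U x -> forall eps, eps > 0 -> exists del, del > 0 /\
    forall y, U y -> dist x y < del -> Rabs (f y - f x) < eps.

Fixpoint Ck {V} (dist : V -> V -> R) (add : V -> V -> V) (scal : R -> V -> V)
  (basis : list V) (k : nat) (U : V -> Prop) (f : V -> R) : Prop :=
  match k with
  | O => cont_on dist U f
  | S k' => cont_on dist U f /\
      forall e, In e basis -> exists g : V -> R,
        (forall x, U x -> derivable_pt_lim (fun t => f (add x (scal t e))) 0 (g x))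
        /\ Ck dist add scal basis k' U g
  end.

(* ---------- subharmonic / plurisubharmonic (Hörmander, Def. 1.6.1, 2.6.1) ---------- *)
Definition harmonic (W : C -> Prop) (h : C -> R) : Prop :=
  Ck Cdist Cadd Crscal basisC 2 W h /\
  exists hx hy : C -> R,
    (forall z, W z ->
       derivable_pt_lim (fun t => h (Cadd z (Crscal t C1))) 0 (hx z) /\
       derivable_pt_lim (fun t => h (Cadd z (Crscal t Ci))) 0 (hy z)) /\
    (forall z, W z -> exists a b,
       derivable_pt_lim (fun t => hx (Cadd z (Crscal t C1))) 0 a /\
       derivable_pt_lim (fun t => hy (Cadd z (Crscal t Ci))) 0 b /\
       a + b = 0).

Definition subharmonic (Om : C -> Prop) (u : C -> R) : Prop :=
  cont_on Cdist Om u /\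
  forall (K : C -> Prop) (h : C -> R),
    is_compact Cdist C0 K -> (forall z, K z -> Om z) ->
    cont_on Cdist K h -> harmonic (interior Cdist K) h ->
    (forall z, K z -> ~ interior Cdist K z -> u z <= h z) ->
    forall z, K z -> u z <= h z.

Definition plurisubharmonic (Om : C3 -> Prop) (u : C3 -> R) : Prop :=
  cont_on V3dist Om u /\
  forall z w : C3,
    subharmonic (fun l => Om (V3add z (V3cscal l w)))
                (fun l => u (V3add z (V3cscal l w))).

(* Hörmander Def. 2.6.8: continuous psh exhaustion function *)
Definition pseudoconvex (Om : C3 -> Prop) : Prop :=
  exists u : C3 -> R, plurisubharmonic Om u /\
    forall c : R, exists K : C3 -> Prop,
      is_compact V3dist V3zero K /\ (forall z, K z -> Om z) /\
      (forall z, Om z -> u z < c -> K z).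

Definition defining_function (k : nat) (D : C3 -> Prop) (U : C3 -> Prop)
  (r : C3 -> R) : Prop :=
  is_open V3dist U /\ (forall z, bdry V3dist D z -> U z) /\
  Ck V3dist V3add V3rscal basis6 k U r /\
  (forall z, U z -> (D z <-> r z < 0)) /\
  (forall z, bdry V3dist D z -> exists e l, In e basis6 /\
     derivable_pt_lim (fun t => r (V3add z (V3rscal t e))) 0 l /\ l <> 0).

Definition Ck_boundary (k : nat) (D : C3 -> Prop) : Prop :=
  exists U r, defining_function k D U r.

(* n is the unit outward normal to bD at P: n = grad r(P) / |grad r(P)| for a
   C^1 defining function r, i.e. d r(P) v = c <v, n>_R with c > 0, |n| = 1 *)
Definition outward_unit_normal (D : C3 -> Prop) (P n : C3) : Prop :=
  exists U r, defining_function 1 D U r /\ U P /\ V3norm n = 1 /\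
    exists c, c > 0 /\ forall v : C3,
      derivable_pt_lim (fun t => r (V3add P (V3rscal t v))) 0 (c * V3dot v n).

Definition unit_disc (l : C) : Prop := Cnorm l < 1.

Definition Cderiv3 (f : C -> C3) (l : C) (L : C3) : Prop :=
  forall eps, eps > 0 -> exists del, del > 0 /\ forall h : C,
    0 < Cnorm h < del -> unit_disc (Cadd l h) ->
    V3norm (V3sub (V3sub (f (Cadd l h)) (f l)) (V3cscal h L)) <= eps * Cnorm h.

Definition holo_disc_into (f : C -> C3) (D : C3 -> Prop) : Prop :=
  (forall l, unit_disc l -> exists L, Cderiv3 f l L) /\
  (forall l, unit_disc l -> D (f l)).

Definition kob_admissible (D : C3 -> Prop) (z X : C3) (alpha : R) : Prop :=
  alpha > 0 /\ exists (f : C -> C3) (L : C3),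
    holo_disc_into f D /\ f C0 = z /\ Cderiv3 f C0 L /\ V3rscal alpha L = X.

Definition is_inf (E : R -> Prop) (m : R) : Prop :=
  (forall x, E x -> m <= x) /\
  (forall m', (forall x, E x -> m' <= x) -> m' <= m).

Definition kobayashi (D : C3 -> Prop) (z X : C3) (m : R) : Prop :=
  is_inf (kob_admissible D z X) m.

(* Main.v *)
From Stdlib Require Import Reals List Lra Lia Psatz Classical.
From Coquelicot Require Import Rcomplements Rbar Hierarchy Lim_seq Series Derive AutoDerive Continuity.
Require Import Defs.
Open Scope R_scope.

(** On the cusp [z1 = mu^2, z2 = mu^3] the parameter [mu = z2 / z1] has nonzero derivative
    although the cusp map itself has none.  The domain is [Re w + |w|^2 + phi(z1, z2) < 0] with
    [phi = |z1|^(2m) + |F|^2 (1 + |z1|^2 + |z2|^2) + l(|z1|^2) - Re (z2 conj(z1)) b(|z1|^2)],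
    where [F = z2^2 - z1^3] vanishes on the cusp and [t b(t)] is almost equal to a constant
    [rho^m] for [rho^16 << t <= rho^4], for each [rho] in a rapidly decreasing sequence.  On
    the cusp the last term of [phi] is then about [- rho^m Re mu] for [rho^4 << |mu| <= rho], so
    that it balances [Re w] along the disc [(mu^2, mu^3, -delta + rho^m mu)], [mu = rho la], up to
    an error below [delta = rho^(m+2)].  The derivative of this disc at [0] is [rho^(m+1)] times
    the normal, a power of [delta] with exponent less than one.  Plurisubharmonicity needs
    compensation only where [t b(t)] varies: near the cusp by the logarithmic function [l], away
    from it by the terms in [F].  The powers of [rho] make the sums over all scales smooth to
    finite order. *)

(** The derivative of the disc at its centre must be purely normal, so its first two components must
    have zero derivative there; this is what the cusp provides. The function [Re mu] extends off the
    cusp as [Re (z2 / z1) = Re (z2 conj(z1)) / |z1|^2], which is pluriharmonic but singular at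
    [z1 = 0]. Replacing [rho^m / |z1|^2] by a regular [b] leaves in the Levi form only the
    derivatives [(t b)'] and [(t b)''].

    The cutoff lies at [|mu|] about [rho^4] for two reasons. Inside it [Re w] is unbalanced, but
    there [rho^m |mu|] is at most about [rho^(m+4)]. On its edge, tangent vectors of the cusp
    satisfy [|v2| = 3/2 |mu| |v1|], so the mixed term of the Levi form gains a factor [|mu|]; the
    compensating logarithm therefore needs only a coefficient of order [rho^(m+4)], and even after
    multiplication by [log (1/rho)] it stays below [delta = rho^(m+2)]. Away from the cusp
    [|F|^2 (1 + |z1|^2 + |z2|^2)] is the sum of [|F|^2], [|z1 F|^2] and [|z2 F|^2], whose Levi form
    is positive definite wherever [F] is nonzero. *)

(** * Elementary bounds for powers and series *)

Lemma pow_even_nonneg (h : nat) (x : R) : 0 <= x ^ (2 * h).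
Proof. rewrite pow_mult. apply pow_le. nra. Qed.

Lemma pow_antitone (r : R) (m n : nat) : 0 <= r <= 1 -> (m <= n)%nat -> r ^ n <= r ^ m.
Proof.
  intros Hr Hmn. replace n with (m + (n - m))%nat by lia. rewrite pow_add.
  assert (0 <= r ^ m) by (apply pow_le; lra).
  assert (r ^ (n - m) <= 1 ^ (n - m)) by (apply pow_incr; lra).
  rewrite pow1 in *. nra.
Qed.

Lemma series_dominated (a w : nat -> R) (M : R) :
  ex_series w -> (forall n, Rabs (a n) <= M * w n) ->
  ex_series a /\ Rabs (Series a) <= M * Series w.
Proof.
  intros Hw H.
  assert (Hb : ex_series (fun n => M * w n)) by (apply (ex_series_scal_l M w Hw)).
  assert (Ha : ex_series (fun n => Rabs (a n))).
  { apply (ex_series_le (fun n => Rabs (a n)) (fun n => M * w n)); [|exact Hb].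
    intros n. unfold norm; simpl. unfold abs; simpl. rewrite Rabs_Rabsolu. apply H. }
  split; [apply ex_series_Rabs, Ha|].
  eapply Rle_trans; [apply Series_Rabs, Ha|].
  rewrite <- Series_scal_l. apply Series_le; [|exact Hb].
  intros n; split; [apply Rabs_pos|apply H].
Qed.

Lemma series_le_gen (a b : nat -> R) :
  ex_series a -> ex_series b -> (forall n, a n <= b n) -> Series a <= Series b.
Proof.
  intros Ha Hb H.
  assert (0 <= Series (fun n => b n - a n)).
  { replace 0 with (Series (fun n => 0 * a n)) by (rewrite Series_scal_l; ring).
    apply Series_le; [intros n; specialize (H n); lra|].
    apply (ex_series_minus b a Hb Ha). }
  rewrite Series_minus in H0 by assumption. lra.
Qed.

Lemma series_nonneg (a : nat -> R) : ex_series a -> (forall n, 0 <= a n) -> 0 <= Series a.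
Proof.
  intros Ha H. replace 0 with (Series (fun n => 0 * a n)) by (rewrite Series_scal_l; ring).
  apply Series_le; [intros n; specialize (H n); lra|exact Ha].
Qed.

Lemma series_single (v : R) (k : nat) :
  ex_series (fun n => if Nat.eq_dec n k then v else 0) /\
  Series (fun n => if Nat.eq_dec n k then v else 0) = v.
Proof.
  assert (H : is_series (fun n => if Nat.eq_dec n k then v else 0) v).
  { assert (Z : is_series (fun _ : nat => 0) 0).
    { apply (is_series_Reals _ 0). intros e He. exists 0%nat. intros n _.
      assert (E : sum_f_R0 (fun _ => 0) n = 0) by (induction n; simpl; lra).
      rewrite E. unfold Rdist. rewrite Rminus_0_r, Rabs_R0. exact He. }
    revert v. induction k as [|k IH]; intros v;
      match goal with |- is_series ?a ?l => apply (is_series_decr_1 a l) end; simpl.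
    - match goal with |- is_series _ ?l => replace l with 0 by (unfold plus, opp; simpl; ring) end.
      exact Z.
    - match goal with |- is_series _ ?l => replace l with v by (unfold plus, opp; simpl; ring) end.
      eapply is_series_ext; [|apply (IH v)]. intros n; simpl.
      destruct (Nat.eq_dec n k), (Nat.eq_dec (S n) (S k)); lia || reflexivity. }
  split; [exists v; exact H|apply is_series_unique, H].
Qed.

(** This is how one scale is separated from all others: below, [w] is the sequence [rho r0] itself,
    whose series is at most 1. *)
Lemma series_single_term (a w : nat -> R) (M : R) (k : nat) :
  0 <= M -> ex_series w -> (forall n, 0 <= w n) -> ex_series a ->
  (forall n, n <> k -> Rabs (a n) <= M * w n) ->
  Rabs (Series a - a k) <= M * Series w.
Proof.
  intros HM Hw Hw0 Ha H.
  destruct (series_single (a k) k) as [E1 E2].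
  rewrite <- E2 at 1. rewrite <- Series_minus by assumption.
  apply series_dominated; [exact Hw|]. intros n.
  destruct (Nat.eq_dec n k) as [->|Hn].
  - rewrite Rminus_diag, Rabs_R0. specialize (Hw0 k). nra.
  - rewrite Rminus_0_r. auto.
Qed.

(** * Rational functions with bounded derivatives of all orders *)

(* A triple [(c, i, j)] stands for the term [c x^i / (1 + x^a)^j]. *)
Definition ratpow (a : nat) (l : list (R * nat * nat)) (x : R) : R :=
  fold_right (fun (m : R * nat * nat) (s : R) => fst (fst m) * x ^ (snd (fst m)) / (1 + x ^ a) ^ (snd m) + s) 0 l.

(** The quotient rule on triples. For [i = 0] the truncated [pred i] is harmless, since the
    coefficient [c * INR 0] vanishes. *)
Definition ratpow_step (a : nat) (l : list (R * nat * nat)) : list (R * nat * nat) :=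
  flat_map (fun m : R * nat * nat => match m with (c, i, j) =>
    (c * INR i, pred i, j) :: (- (c * INR j * INR a), (i + pred a)%nat, S j) :: nil end) l.

(** The degree of each numerator does not exceed that of its denominator. Differentiation preserves
    this, which is why all derivatives are bounded. *)
Definition ratpow_proper (a : nat) (l : list (R * nat * nat)) : Prop :=
  List.Forall (fun m => (snd (fst m) <= a * snd m)%nat) l.

Lemma ratpow_step_proper (a : nat) (l : list (R * nat * nat)) :
  ratpow_proper a l -> ratpow_proper a (ratpow_step a l).
Proof.
  induction 1 as [|[[c i] j] l H Hl IH]; simpl; [constructor|].
  simpl in H. repeat constructor; simpl; try lia. exact IH.
Qed.

(** The exponent is even so that [1 + x^(2h)] is at least 1 on the whole line. For [|x| <= 1] the
    numerator is at most 1; for [|x| > 1] it is at most [|x|^(2hj)], hence at most the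
    denominator. *)
Lemma ratpow_bounded (h : nat) (l : list (R * nat * nat)) :
  ratpow_proper (2 * h) l -> exists M, 0 <= M /\ forall x, Rabs (ratpow (2 * h) l x) <= M.
Proof.
  induction 1 as [|[[c i] j] l H Hl IH].
  - exists 0. split; [lra|]. intros x; simpl. rewrite Rabs_R0. lra.
  - destruct IH as [M [HM IH]]. exists (Rabs c + M). pose proof (Rabs_pos c).
    split; [lra|]. intros x. change (ratpow (2 * h) ((c, i, j) :: l) x) with
      (c * x ^ i / (1 + x ^ (2 * h)) ^ j + ratpow (2 * h) l x). cbn [fst snd] in H.
    eapply Rle_trans; [apply Rabs_triang|]. apply Rplus_le_compat; [|apply IH].
    pose proof (pow_even_nonneg h x) as Hx.
    set (a := (2 * h)%nat) in *.
    remember (x ^ a) as y eqn:Ey in *.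
    assert (Hd : 0 < (1 + y) ^ j) by (apply pow_lt; lra).
    unfold Rdiv. rewrite !Rabs_mult, (Rabs_inv ((1 + y) ^ j)), (Rabs_right ((1 + y) ^ j)) by lra.
    assert (K : Rabs (x ^ i) <= (1 + y) ^ j).
    { rewrite <- RPow_abs. destruct (Rle_dec (Rabs x) 1) as [L|L].
      - apply Rle_trans with 1.
        + rewrite <- (pow1 i). apply pow_incr. split; [apply Rabs_pos|exact L].
        + apply pow_R1_Rle. lra.
      - apply Rle_trans with (Rabs x ^ (a * j)); [apply Rle_pow; [lra|exact H]|].
        rewrite pow_mult, RPow_abs, <- Ey, (Rabs_right y) by lra.
        apply pow_incr. lra. }
    apply Rmult_le_reg_r with ((1 + y) ^ j); [exact Hd|].
    rewrite !Rmult_assoc, Rinv_l, Rmult_1_r by lra.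
    apply Rmult_le_compat_l; assumption.
Qed.

Lemma ratpow_app (a : nat) (l l' : list (R * nat * nat)) (x : R) :
  ratpow a (l ++ l') x = ratpow a l x + ratpow a l' x.
Proof. induction l as [|m l IH]; simpl; [ring|rewrite IH; ring]. Qed.

Lemma ratpow_derive (h : nat) (l : list (R * nat * nat)) (x : R) :
  is_derive (ratpow (2 * h) l) x (ratpow (2 * h) (ratpow_step (2 * h) l) x).
Proof.
  induction l as [|[[c i] j] l IH].
  - apply (is_derive_const 0 x).
  - change (ratpow_step (2 * h) ((c, i, j) :: l)) with
      (((c * INR i, pred i, j) :: (- (c * INR j * INR (2 * h)), (i + pred (2 * h))%nat, S j) :: nil)
        ++ ratpow_step (2 * h) l).
    rewrite ratpow_app.
    apply (is_derive_plus (fun x => c * x ^ i / (1 + x ^ (2*h)) ^ j) (ratpow (2 * h) l)); [|exact IH].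
    pose proof (pow_even_nonneg h x) as Hx.
    unfold ratpow; cbn [fold_right fst snd].
    set (a := (2 * h)%nat) in *.
    assert (0 < (1 + x ^ a) ^ j) by (apply pow_lt; lra).
    auto_derive; [lra|]. rewrite pow_add.
    destruct j as [|j]; simpl pred; simpl pow.
    + simpl INR. field. lra.
    + assert (0 < (1 + x ^ a) ^ j) by (apply pow_lt; lra).
      field. lra.
Qed.

Lemma ratpow_iter_bounded (h n : nat) (l : list (R * nat * nat)) :
  ratpow_proper (2 * h) l -> exists M, 0 <= M /\ forall i x, (i <= n)%nat ->
    Rabs (ratpow (2 * h) (Nat.iter i (ratpow_step (2 * h)) l) x) <= M.
Proof.
  intros Hl.
  assert (Hp : forall i, ratpow_proper (2 * h) (Nat.iter i (ratpow_step (2 * h)) l)).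
  { induction i; simpl; [exact Hl|apply ratpow_step_proper, IHi]. }
  induction n as [|n [M [HM IH]]].
  - destruct (ratpow_bounded h _ (Hp 0%nat)) as [M [HM H]]. exists M. split; [exact HM|].
    intros i x Hi. replace i with 0%nat by lia. apply H.
  - destruct (ratpow_bounded h _ (Hp (S n))) as [M' [HM' H]]. exists (M + M'). split; [lra|].
    intros i x Hi. destruct (Nat.eq_dec i (S n)) as [->|].
    + specialize (H x). lra.
    + assert (Hi' : (i <= n)%nat) by lia. specialize (IH i x Hi'). lra.
Qed.

(** * Series of dilated functions and their termwise derivatives *)

(** When [d i] is the [i]-th derivative of [d 0], this is the [i]-th termwise derivative of the sum
    of [c nu * d 0 (t / tau nu)]. *)
Definition dil_series (c tau : nat -> R) (d : nat -> R -> R) (i : nat) (t : R) : R :=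
  Series (fun nu => c nu / tau nu ^ i * d i (t / tau nu)).

(** Linear growth of [d i] is allowed for the sake of the logarithm. It costs one more power of
    [tau nu], whence the exponent [S n]. *)
Lemma dil_series_ex (c tau w : nat -> R) (d : nat -> R -> R) (kap M : R) (n i : nat) (t : R) :
  (forall nu, 0 <= c nu) -> (forall nu, 0 < tau nu <= 1) -> ex_series w ->
  (forall nu, c nu / tau nu ^ (S n) <= kap * w nu) ->
  0 <= M -> (i <= n)%nat -> (forall x, Rabs (d i x) <= M * (1 + Rabs x)) ->
  ex_series (fun nu => c nu / tau nu ^ i * d i (t / tau nu)) /\
  Rabs (dil_series c tau d i t) <= M * (1 + Rabs t) * kap * Series w.
Proof.
  intros Hc Ht Hw Hk HM Hi Hd. apply series_dominated; [exact Hw|].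
  intros nu. specialize (Hc nu). specialize (Ht nu). specialize (Hk nu).
  assert (0 < tau nu ^ i) by (apply pow_lt; lra).
  rewrite Rabs_mult, (Rabs_right (c nu / tau nu ^ i)).
  2: { apply Rle_ge, Rdiv_le_0_compat; lra. }
  assert (E : Rabs (d i (t / tau nu)) <= M * ((1 + Rabs t) / tau nu)).
  { eapply Rle_trans; [apply Hd|]. apply Rmult_le_compat_l; [exact HM|].
    unfold Rdiv. rewrite Rabs_mult, Rabs_inv, (Rabs_right (tau nu)) by lra.
    assert (1 <= / tau nu) by (rewrite <- Rinv_1; apply Rinv_le_contravar; lra).
    pose proof (Rabs_pos t). nra. }
  eapply Rle_trans; [apply Rmult_le_compat_l; [|exact E]|].
  { apply Rdiv_le_0_compat; lra. }
  replace (c nu / tau nu ^ i * (M * ((1 + Rabs t) / tau nu))) with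
    (M * (1 + Rabs t) * (c nu / tau nu ^ S i)) by (simpl; field; lra).
  replace (M * (1 + Rabs t) * kap * w nu) with (M * (1 + Rabs t) * (kap * w nu)) by ring.
  pose proof (Rabs_pos t).
  apply Rmult_le_compat_l; [nra|].
  eapply Rle_trans; [|exact Hk]. apply Rmult_le_compat_l; [exact Hc|].
  apply Rinv_le_contravar; [apply pow_lt; lra|].
  apply pow_antitone; [lra|lia].
Qed.

Lemma taylor2 (f g : R -> R) (g' : R -> R) (M t s : R) :
  (forall x, is_derive f x (g x)) -> (forall x, is_derive g x (g' x)) ->
  (forall x, Rabs (g' x) <= M) ->
  Rabs (f (t + s) - f t - s * g t) <= M * s ^ 2.
Proof.
  intros Hf Hg HM.
  destruct (MVT_gen f t (t + s) g) as [c [Hc E]].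
  { intros; apply Hf. }
  { intros x _. apply derivable_continuous_pt. exists (g x). apply is_derive_Reals, Hf. }
  destruct (MVT_gen g t c g') as [d [Hd E']].
  { intros; apply Hg. }
  { intros x _. apply derivable_continuous_pt. exists (g' x). apply is_derive_Reals, Hg. }
  rewrite E. replace (g c * (t + s - t) - s * g t) with (s * (g c - g t)) by ring.
  rewrite E'. rewrite !Rabs_mult. specialize (HM d).
  assert (Rabs (c - t) <= Rabs s).
  { destruct Hc as [Hc1 Hc2]. unfold Rmin, Rmax in *.
    destruct (Rle_dec t (t + s)); unfold Rabs; repeat destruct Rcase_abs; lra. }
  rewrite <- (pow2_abs s).
  pose proof (Rabs_pos s). pose proof (Rabs_pos (c - t)). pose proof (Rabs_pos (g' d)).
  assert (Rabs (g' d) * Rabs (c - t) <= M * Rabs s) by (apply Rmult_le_compat; lra).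
  nra.
Qed.

Lemma is_derive_of_quadratic (f : R -> R) (t l M : R) :
  (forall s, Rabs (f (t + s) - f t - s * l) <= M * s ^ 2) -> is_derive f t l.
Proof.
  intros H. apply is_derive_Reals. intros e He.
  assert (HM : 0 <= M).
  { specialize (H 1). pose proof (Rabs_pos (f (t + 1) - f t - 1 * l)). lra. }
  assert (Hd : 0 < e / (M + 1)) by (apply Rdiv_lt_0_compat; lra).
  exists (mkposreal _ Hd). intros s Hs Hsd. simpl in Hsd.
  replace ((f (t + s) - f t) / s - l) with ((f (t + s) - f t - s * l) / s) by (field; exact Hs).
  unfold Rdiv. rewrite Rabs_mult, Rabs_inv.
  pose proof (Rabs_pos_lt s Hs) as Hs0.
  apply Rmult_lt_reg_r with (Rabs s); [exact Hs0|].
  rewrite Rmult_assoc, Rinv_l, Rmult_1_r by lra.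
  eapply Rle_lt_trans; [apply H|]. rewrite <- pow2_abs.
  assert (Rabs s * (M + 1) < e).
  { apply (Rmult_lt_compat_r (M + 1)) in Hsd; [|lra].
    unfold Rdiv in Hsd. rewrite Rmult_assoc, Rinv_l, Rmult_1_r in Hsd by lra. exact Hsd. }
  nra.
Qed.

(** Instead of uniform convergence, a quadratic Taylor remainder is summed: the term of index [nu]
    has remainder at most [M * s^2 * c nu / tau nu ^ (i + 2)]. This is why order [i + 2] must be
    available and bounded. *)
Lemma dil_series_derive (c tau w : nat -> R) (d : nat -> R -> R) (kap M : R) (n i : nat) (t : R) :
  (forall nu, 0 <= c nu) -> (forall nu, 0 < tau nu <= 1) -> ex_series w ->
  (forall nu, c nu / tau nu ^ (S n) <= kap * w nu) ->
  0 <= M -> (i + 2 <= n)%nat ->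
  (forall j x, (j <= n)%nat -> Rabs (d j x) <= M * (1 + Rabs x)) ->
  (forall x, Rabs (d (S (S i)) x) <= M) ->
  (forall j x, is_derive (d j) x (d (S j) x)) ->
  is_derive (dil_series c tau d i) t (dil_series c tau d (S i) t).
Proof.
  intros Hc Ht Hw Hk HM Hi Hd Hd2 Hder.
  apply is_derive_of_quadratic with (M * kap * Series w). intros s.
  assert (E : forall j u, (j <= n)%nat ->
    ex_series (fun nu => c nu / tau nu ^ j * d j (u / tau nu))).
  { intros j u Hj. apply (dil_series_ex c tau w d kap M n j u); auto. }
  unfold dil_series. rewrite <- Series_minus by (apply E; lia).
  rewrite <- Series_scal_l. rewrite <- Series_minus.
  2: { apply (ex_series_minus (fun nu => c nu / tau nu ^ i * d i ((t + s) / tau nu))); apply E; lia. }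
  2: { apply (ex_series_scal_l s (fun nu => c nu / tau nu ^ S i * d (S i) (t / tau nu))). apply E. lia. }
  replace (M * kap * Series w * s ^ 2) with (M * kap * s ^ 2 * Series w) by ring.
  apply series_dominated; [exact Hw|]. intros nu.
  specialize (Hc nu). specialize (Ht nu). specialize (Hk nu).
  assert (0 < tau nu ^ i) by (apply pow_lt; lra).
  replace (c nu / tau nu ^ i * d i ((t + s) / tau nu) - c nu / tau nu ^ i * d i (t / tau nu) -
    s * (c nu / tau nu ^ S i * d (S i) (t / tau nu))) with
    (c nu / tau nu ^ i * (d i (t / tau nu + s / tau nu) - d i (t / tau nu) - s / tau nu * d (S i) (t / tau nu))).
  2: { replace ((t + s) / tau nu) with (t / tau nu + s / tau nu) by (field; lra). simpl. field. lra. }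
  rewrite Rabs_mult, (Rabs_right (c nu / tau nu ^ i)).
  2: { apply Rle_ge, Rdiv_le_0_compat; lra. }
  eapply Rle_trans.
  { apply Rmult_le_compat_l; [apply Rdiv_le_0_compat; lra|].
    apply (taylor2 (d i) (d (S i)) (d (S (S i))) M); auto. }
  replace (c nu / tau nu ^ i * (M * (s / tau nu) ^ 2)) with
    (M * s ^ 2 * (c nu / tau nu ^ (S (S i)))) by (simpl; field; lra).
  replace (M * kap * s ^ 2 * w nu) with (M * s ^ 2 * (kap * w nu)) by ring.
  apply Rmult_le_compat_l; [nra|].
  eapply Rle_trans; [|exact Hk]. apply Rmult_le_compat_l; [exact Hc|].
  apply Rinv_le_contravar; [apply pow_lt; lra|].
  apply pow_antitone; [lra|lia].
Qed.

(** * The rapidly decreasing sequence of scales *)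

Lemma pow_div_pow (r : R) (m n : nat) : r <> 0 -> (m <= n)%nat -> r ^ n / r ^ m = r ^ (n - m).
Proof.
  intros Hr H. replace n with (m + (n - m))%nat at 1 by lia. rewrite pow_add. field.
  apply pow_nonzero, Hr.
Qed.

(** The sixth power separates the scales. On the disc of index [nu] one has [t <= rho nu ^ 4], and
    for [j < nu] the quotient [t / rho j ^ 16] is to be at most [rho nu]; this asks for
    [rho nu ^ 3 <= rho j ^ 16], which [rho nu <= rho j ^ 6] implies. *)
Fixpoint rho (r0 : R) (nu : nat) : R :=
  match nu with O => r0 | S k => rho r0 k ^ 6 end.

Lemma rho_bounds (r0 : R) (nu : nat) : 0 < r0 <= 1 / 2 ->
  0 < rho r0 nu /\ rho r0 nu <= r0 * (1 / 2) ^ nu.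
Proof.
  intros [Hr1 Hr2]. induction nu as [|k [IH1 IH2]]; [simpl; lra|].
  change (rho r0 (S k)) with (rho r0 k ^ 6).
  split; [apply pow_lt, IH1|].
  assert (K : (1/2) ^ k <= 1) by (apply (pow_antitone (1/2) 0); [lra|lia]).
  assert (K0 : 0 < (1/2) ^ k) by (apply pow_lt; lra).
  assert (L : rho r0 k <= 1 / 2) by (apply Rle_trans with (1 := IH2); nra).
  assert (L2 : rho r0 k ^ 6 <= rho r0 k ^ 2) by (apply pow_antitone; [lra|lia]).
  change ((1 / 2) ^ S k) with (1 / 2 * (1 / 2) ^ k). nra.
Qed.

Lemma rho_le_r0 (r0 : R) (nu : nat) : 0 < r0 <= 1 / 2 -> 0 < rho r0 nu <= r0.
Proof.
  intros H. destruct (rho_bounds r0 nu H) as [H1 H2]. split; [exact H1|].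
  assert (K : (1/2) ^ nu <= 1) by (apply (pow_antitone (1/2) 0); [lra|lia]).
  nra.
Qed.

Lemma rho_gap (r0 : R) (i j : nat) : 0 < r0 <= 1 / 2 -> (i < j)%nat ->
  rho r0 j <= rho r0 i ^ 6.
Proof.
  intros H. induction 1 as [|j Hj IH]; [simpl; lra|].
  apply Rle_trans with (rho r0 j); [|exact IH].
  destruct (rho_le_r0 r0 j H). change (rho r0 (S j)) with (rho r0 j ^ 6).
  rewrite <- (pow_1 (rho r0 j)) at 2. apply pow_antitone; [lra|lia].
Qed.

Lemma rho_series (r0 : R) : 0 < r0 <= 1 / 2 ->
  ex_series (rho r0) /\ 0 <= Series (rho r0) <= 1.
Proof.
  intros H.
  assert (G : ex_series (fun n => (1/2) ^ n)) by (apply ex_series_geom; rewrite Rabs_right; lra).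
  destruct (series_dominated (rho r0) (fun n => (1/2) ^ n) r0 G) as [E1 E2].
  { intros n. destruct (rho_bounds r0 n H). rewrite Rabs_right; lra. }
  rewrite Series_geom in E2 by (rewrite Rabs_right; lra).
  replace (/ (1 - 1 / 2)) with 2 in E2 by field.
  split; [exact E1|]. split.
  - apply series_nonneg; [exact E1|]. intros n. destruct (rho_bounds r0 n H); lra.
  - pose proof (Rle_abs (Series (rho r0))). lra.
Qed.

Lemma rho_pow_le (r0 : R) (nu e : nat) : 0 < r0 <= 1 / 2 -> (2 <= e)%nat ->
  rho r0 nu ^ e <= r0 * rho r0 nu.
Proof.
  intros H He. destruct (rho_le_r0 r0 nu H).
  apply Rle_trans with (rho r0 nu ^ 2); [apply pow_antitone; [lra|lia]|]. nra.
Qed.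

(** * The smooth step and its logarithmic compensator *)

(* The [i]-th derivative of [x^(a-1) / (1 + x^a)]. *)
Definition qder (a i : nat) : R -> R :=
  ratpow a (Nat.iter i (ratpow_step a) ((1, pred a, 1%nat) :: nil)).

Lemma qder_derive (h i : nat) (x : R) : is_derive (qder (2 * h) i) x (qder (2 * h) (S i) x).
Proof. unfold qder. apply ratpow_derive. Qed.

Lemma qder_bounded (h n : nat) : exists M, 0 <= M /\
  forall i x, (i <= n)%nat -> Rabs (qder (2 * h) i x) <= M.
Proof.
  apply ratpow_iter_bounded. constructor; [simpl; lia|constructor].
Qed.

(** With [q x = x^(a-1) / (1 + x^a)], the product [x q] is the step [x^a / (1 + x^a)]; the last two
    formulas are [(x q)'] and [x (x q)''], the combinations that occur in the Levi form. Writing [a]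
    as a triple successor lets every [pred] compute. *)
Lemma qder_formulas (p : nat) (x : R) : let a := S (S (S p)) in 1 + x ^ a <> 0 ->
  qder a 0 x = x ^ pred a / (1 + x ^ a) /\
  qder a 0 x + x * qder a 1 x = INR a * x ^ pred a / (1 + x ^ a) ^ 2 /\
  x * (2 * qder a 1 x + x * qder a 2 x) =
    INR a * x ^ pred a * ((INR a - 1) - (INR a + 1) * x ^ a) / (1 + x ^ a) ^ 3.
Proof.
  intros a Ha.
  assert (Ha2 : pred (pred a) = S p) by reflexivity.
  unfold qder. cbn [Nat.iter ratpow_step flat_map app ratpow fold_right fst snd nat_rect].
  rewrite !pow_add.
  change (x ^ pred (pred (pred a))) with (x ^ p).
  replace (pred (pred a + pred a)) with (S (p + pred a)) by reflexivity.
  cbn [Nat.add].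
  replace (x ^ a) with (x * (x * (x * x ^ p))) in * by reflexivity.
  change (x ^ pred a) with (x * (x * x ^ p)).
  change (x ^ pred (pred a)) with (x * x ^ p).
  rewrite ?plus_INR.
  replace (INR (pred a)) with (INR a - 1) by (unfold a; rewrite !S_INR; simpl pred; rewrite !S_INR; ring).
  replace (INR (pred (pred a))) with (INR a - 2) by (unfold a; simpl pred; rewrite !S_INR; ring).
  cbn [pow INR]. rewrite ?pow_add. cbn [pow].
  change (x ^ pred a) with (x * (x * x ^ p)).
  repeat split; field; exact Ha.
Qed.

(** A common majorant for [(x q)'] and [x (x q)''], shaped like the first so that it can be compared
    with the Levi form of the logarithm. *)
Definition qmaj (a : nat) (x : R) : R :=
  INR a * (INR a + 2) * x ^ pred a / (1 + x ^ a) ^ 2.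

Lemma qmaj_dominates (a : nat) (x : R) : (4 <= a)%nat -> 0 <= x ->
  Rabs (qder a 0 x + x * qder a 1 x) <= qmaj a x /\
  Rabs (x * (2 * qder a 1 x + x * qder a 2 x)) <= qmaj a x /\
  0 <= qmaj a x <= INR a * (INR a + 2) * x ^ 3.
Proof.
  intros Ha Hx.
  assert (Hn : 0 <= x ^ a) by (apply pow_le, Hx).
  assert (Hm : 0 <= x ^ pred a) by (apply pow_le, Hx).
  assert (Ha1 : 4 <= INR a) by (apply (le_INR 4) in Ha; simpl in Ha; lra).
  destruct a as [|[|[|p]]]; try lia.
  destruct (qder_formulas p x) as [_ [E1 E2]]; [lra|].
  rewrite E1, E2. unfold qmaj.
  set (a := S (S (S p))) in *. set (y := x ^ a) in *. set (v := x ^ pred a) in *.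
  assert (Hd : 0 < (1 + y) ^ 2) by (apply pow_lt; lra).
  assert (Hi : 0 < / (1 + y) ^ 2) by (apply Rinv_0_lt_compat, Hd).
  repeat split.
  - rewrite Rabs_right; [|apply Rle_ge, Rdiv_le_0_compat; nra].
    apply Rmult_le_compat_r; [lra|]. nra.
  - replace (INR a * v * (INR a - 1 - (INR a + 1) * y) / (1 + y) ^ 3) with
      (INR a * v / (1 + y) ^ 2 * ((INR a - 1 - (INR a + 1) * y) / (1 + y))) by (field; lra).
    rewrite Rabs_mult, Rabs_right; [|apply Rle_ge, Rdiv_le_0_compat; nra].
    replace (INR a * (INR a + 2) * v / (1 + y) ^ 2) with (INR a * v / (1 + y) ^ 2 * (INR a + 2)) by (field; lra).
    apply Rmult_le_compat_l; [apply Rdiv_le_0_compat; nra|].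
    unfold Rdiv. rewrite Rabs_mult, (Rabs_right (/ (1 + y))).
    2: { apply Rle_ge, Rlt_le, Rinv_0_lt_compat. lra. }
    apply Rmult_le_reg_r with (1 + y); [lra|]. rewrite Rmult_assoc, Rinv_l, Rmult_1_r by lra.
    apply Rabs_le. split; nra.
  - apply Rdiv_le_0_compat; [|exact Hd]. apply Rmult_le_pos; [nra|exact Hm].
  - unfold Rdiv. rewrite Rmult_assoc. apply Rmult_le_compat_l; [nra|].
    apply Rmult_le_reg_r with ((1 + y) ^ 2); [exact Hd|].
    rewrite Rmult_assoc, Rinv_l, Rmult_1_r by lra.
    assert (H3 : 0 <= x ^ 3) by (apply pow_le, Hx).
    destruct (Rle_dec x 1).
    + assert (v <= x ^ 3) by (apply pow_antitone; [lra|simpl; lia]). nra.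
    + assert (v <= y) by (apply Rle_pow; [lra|simpl; lia]).
      assert (1 <= x ^ 3) by (apply pow_R1_Rle; lra). nra.
Qed.

(** Up to the factor [b^2], the last quotient is [(x L')'] for [L = ln (1 + x^b)]. The factor
    [1 + x] on the left pays for [s <= rho^4 (1 + x)] in [series_levi]; an exponent two higher in
    the step leaves room for it at infinity and keeps both exponents even. The regions [x <= 1] and
    [x >= 1] are treated separately. *)
Lemma qmaj_compare (b : nat) (x : R) : (1 <= b)%nat -> 0 <= x ->
  (1 + x) * qmaj (b + 2) x <=
  8 * (INR (b + 2) * (INR (b + 2) + 2)) * (x ^ pred b / (1 + x ^ b) ^ 2).
Proof.
  intros Hb Hx. unfold qmaj.
  set (c := INR (b + 2) * (INR (b + 2) + 2)).
  assert (Hc : 0 <= c) by (pose proof (pos_INR (b + 2)); unfold c; nra).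
  replace (pred (b + 2)) with (pred b + 2)%nat by lia.
  rewrite !pow_add.
  assert (Hv : 0 <= x ^ pred b) by (apply pow_le, Hx).
  assert (HX : 0 <= x ^ b) by (apply pow_le, Hx).
  assert (K : x <= 1 /\ x ^ b <= 1 \/ 1 <= x /\ 1 <= x ^ b).
  { destruct (Rle_dec x 1).
    - left. split; [assumption|]. apply (pow_antitone x 0); [lra|lia].
    - right. split; [lra|]. apply pow_R1_Rle. lra. }
  set (X := x ^ b) in *. set (v := x ^ pred b) in *.
  assert (M : (1 + x) * x ^ 2 * (1 + X) ^ 2 <= 8 * (1 + X * x ^ 2) ^ 2).
  { destruct K as [[K1 K2]|[K1 K2]].
    - assert (0 <= x ^ 2 <= 1) by nra. assert (0 <= (1 + x) * x ^ 2 <= 2) by nra.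
      assert (0 <= (1 + X) ^ 2 <= 4) by nra. assert (0 <= X * x ^ 2) by nra. nra.
    - assert (H1 : 1 + x <= 2 * x ^ 2) by nra.
      assert (H2 : 0 <= (1 + X) ^ 2 <= 4 * X ^ 2) by nra.
      assert (H3 : 0 <= x ^ 2) by nra.
      apply Rle_trans with ((2 * x ^ 2 * x ^ 2) * (4 * X ^ 2)).
      + apply Rmult_le_compat; [nra|lra| |lra].
        apply Rmult_le_compat_r; lra.
      + replace ((2 * x ^ 2 * x ^ 2) * (4 * X ^ 2)) with (8 * (X * x ^ 2) ^ 2) by ring. nra. }
  assert (D1 : 0 < (1 + X) ^ 2) by nra.
  assert (D2 : 0 < (1 + X * x ^ 2) ^ 2) by (apply pow_lt; nra).
  apply Rmult_le_reg_r with ((1 + X) ^ 2 * (1 + X * x ^ 2) ^ 2); [nra|].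
  replace ((1 + x) * (c * (v * x ^ 2) / (1 + X * x ^ 2) ^ 2) * ((1 + X) ^ 2 * (1 + X * x ^ 2) ^ 2))
    with (c * v * ((1 + x) * x ^ 2 * (1 + X) ^ 2)) by (field; nra).
  replace (8 * c * (v / (1 + X) ^ 2) * ((1 + X) ^ 2 * (1 + X * x ^ 2) ^ 2))
    with (c * v * (8 * (1 + X * x ^ 2) ^ 2)) by (field; nra).
  apply Rmult_le_compat_l; [nra|exact M].
Qed.

Definition lder (b i : nat) (x : R) : R :=
  match i with O => ln (1 + x ^ b) | S j => INR b * qder b j x end.

Lemma lder_derive (h i : nat) (x : R) :
  is_derive (lder (2 * h) i) x (lder (2 * h) (S i) x).
Proof.
  destruct i as [|i].
  - unfold lder, qder. cbn [Nat.iter nat_rect ratpow fold_right fst snd].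
    pose proof (pow_even_nonneg h x).
    set (a := (2 * h)%nat) in *. auto_derive; [lra|]. field. lra.
  - unfold lder. apply (is_derive_scal (qder (2 * h) i)). apply qder_derive.
Qed.

Lemma lder_bounded (h n : nat) : exists M, 0 <= M /\
  (forall i x, (i <= n)%nat -> Rabs (lder (2 * h) (S i) x) <= M) /\
  (forall i x, (i <= n)%nat -> Rabs (lder (2 * h) i x) <= M * (1 + Rabs x)).
Proof.
  destruct (qder_bounded h n) as [M [HM H]].
  set (b := (2 * h)%nat). pose proof (pos_INR b).
  exists (INR b * M + ln 2).
  assert (L2 : 0 <= ln 2) by (pose proof ln_lt_2; lra).
  assert (A : forall i x, (i <= n)%nat -> Rabs (lder b (S i) x) <= INR b * M + ln 2).
  { intros i x Hi. unfold lder. rewrite Rabs_mult, (Rabs_right (INR b)) by lra.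
    specialize (H i x Hi). fold b in H. nra. }
  assert (0 <= INR b * M) by nra.
  split; [lra|]. split; [exact A|].
  intros [|i] x Hi.
  - destruct (MVT_gen (lder b 0) 0 x (lder b 1)) as [c [_ E]].
    { intros; apply lder_derive. }
    { intros y _. apply derivable_continuous_pt. exists (lder b 1 y).
      apply is_derive_Reals, lder_derive. }
    assert (E0 : 0 <= lder b 0 0 <= ln 2).
    { unfold lder. pose proof (pow_even_nonneg h 0) as P0. fold b in P0.
      assert (P1 : 0 ^ b <= 1) by (destruct b; [simpl; lra|rewrite pow_i by lia; lra]).
      split; [apply Rle_trans with (ln 1); [rewrite ln_1; lra|]|]; apply ln_le; lra. }
    replace (lder b 0 x) with (lder b 0 0 + lder b 1 c * (x - 0)) by lra.
    eapply Rle_trans; [apply Rabs_triang|]. rewrite Rabs_mult, Rminus_0_r.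
    rewrite (Rabs_right (lder b 0 0)) by lra.
    specialize (A 0%nat c Hi). pose proof (Rabs_pos x).
    assert (Rabs (lder b 1 c) * Rabs x <= (INR b * M + ln 2) * Rabs x)
      by (apply Rmult_le_compat_r; lra).
    lra.
  - assert (Hi' : (i <= n)%nat) by lia. specialize (A i x Hi'). pose proof (Rabs_pos x). nra.
Qed.

(** Used with [y = 1 / rho] and [e = 16]: a logarithm costs at most one power of [rho], because
    [ln y <= y]. *)
Lemma ln_pow_bound (y x : R) (b e : nat) : 2 <= y -> 0 <= x <= y ^ e ->
  0 <= ln (1 + x ^ b) <= INR (e * b + 1) * y.
Proof.
  intros Hy [Hx0 Hx].
  assert (P : 0 <= x ^ b) by (apply pow_le, Hx0).
  split; [rewrite <- ln_1; apply ln_le; lra|].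
  assert (Q : x ^ b <= y ^ (e * b)) by (rewrite pow_mult; apply pow_incr; lra).
  assert (Q1 : 1 <= y ^ (e * b)) by (apply pow_R1_Rle; lra).
  apply Rle_trans with (ln (y ^ (e * b + 1))).
  - apply ln_le; [lra|]. rewrite pow_add, pow_1. nra.
  - rewrite ln_pow by lra. apply Rmult_le_compat_l; [apply pos_INR|].
    pose proof (exp_ineq1_le (ln y)) as E. rewrite exp_ln in E by lra. lra.
Qed.

(** * The radial functions *)

(** On the cusp [t = |z1|^2 = |mu|^4], so [t = tau] means [|mu| = rho^4]. *)
Definition tau (r0 : R) (nu : nat) : R := rho r0 nu ^ 16.

(** Put [P = 16 (N + 3)] and [x = t / tau nu]. Multiplied by [t], the term of index [nu] of
    [bser r0 N 0] is the step [rho^P x^a / (1 + x^a)] with [a = 2 (P + 1)]. The large exponent makes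
    the steps of smaller index negligible on the disc of index [nu]. *)
Definition bser (r0 : R) (N : nat) : nat -> R -> R :=
  dil_series (fun nu => rho r0 nu ^ (16 * (N + 2))) (tau r0) (qder (2 * (16 * (N + 3) + 1))).

(** The exponent is [P + 4]: the height [rho^P] of the step times the value [rho^4] of [|mu|] where
    the step rises. *)
Definition lser (r0 K : R) (N : nat) : nat -> R -> R :=
  dil_series (fun nu => K * rho r0 nu ^ (16 * (N + 3) + 4)) (tau r0) (lder (2 * (16 * (N + 3)))).

Lemma tau_bounds (r0 : R) (nu : nat) : 0 < r0 <= 1 / 2 -> 0 < tau r0 nu <= 1.
Proof.
  intros H. destruct (rho_le_r0 r0 nu H). unfold tau. split; [apply pow_lt; assumption|].
  apply (pow_antitone _ 0); [lra|lia].
Qed.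

(** Of the two spare powers of [rho], one becomes the small factor [r0] and the other the summable
    weight. *)
Lemma rho_weight (r0 K : R) (nu m e : nat) : 0 < r0 <= 1 / 2 -> 0 <= K -> (16 * m + 2 <= e)%nat ->
  K * rho r0 nu ^ e / tau r0 nu ^ m <= K * r0 * rho r0 nu.
Proof.
  intros H HK He. destruct (rho_le_r0 r0 nu H). unfold tau.
  rewrite <- pow_mult. unfold Rdiv. rewrite !Rmult_assoc. apply Rmult_le_compat_l; [exact HK|].
  change (rho r0 nu ^ e * / rho r0 nu ^ (16 * m)) with (rho r0 nu ^ e / rho r0 nu ^ (16 * m)).
  rewrite pow_div_pow by (lra || lia). apply rho_pow_le; [exact H|lia].
Qed.

Lemma bser_ex (r0 : R) (N i : nat) (t : R) : 0 < r0 <= 1 / 2 -> (i <= N)%nat ->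
  ex_series (fun nu => rho r0 nu ^ (16 * (N + 2)) / tau r0 nu ^ i *
    qder (2 * (16 * (N + 3) + 1)) i (t / tau r0 nu)).
Proof.
  intros H Hi. destruct (qder_bounded (16 * (N + 3) + 1) N) as [M [HM HB]].
  apply (dil_series_ex _ (tau r0) (rho r0) _ (1 * r0) M N i t); auto.
  - intros nu. apply pow_le. destruct (rho_le_r0 r0 nu H). lra.
  - intros nu. apply tau_bounds, H.
  - apply rho_series, H.
  - intros nu. rewrite <- (Rmult_1_l (rho r0 nu ^ _)). apply rho_weight; [exact H|lra|lia].
  - intros x. specialize (HB i x Hi). pose proof (Rabs_pos x). nra.
Qed.

Lemma lser_ex (r0 K : R) (N i : nat) (t : R) : 0 < r0 <= 1 / 2 -> 0 <= K -> (i <= N)%nat ->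
  ex_series (fun nu => K * rho r0 nu ^ (16 * (N + 3) + 4) / tau r0 nu ^ i *
    lder (2 * (16 * (N + 3))) i (t / tau r0 nu)).
Proof.
  intros H HK Hi. destruct (lder_bounded (16 * (N + 3)) N) as [M [HM [HB HB']]].
  apply (dil_series_ex _ (tau r0) (rho r0) _ (K * r0) M N i t); auto.
  - intros nu. apply Rmult_le_pos; [exact HK|]. apply pow_le. destruct (rho_le_r0 r0 nu H). lra.
  - intros nu. apply tau_bounds, H.
  - apply rho_series, H.
  - intros nu. apply rho_weight; [exact H|lra|lia].
Qed.

Lemma bser_derive (r0 : R) (N i : nat) (t : R) : 0 < r0 <= 1 / 2 -> (i + 2 <= N)%nat ->
  is_derive (bser r0 N i) t (bser r0 N (S i) t).
Proof.
  intros H Hi. destruct (qder_bounded (16 * (N + 3) + 1) N) as [M [HM HB]].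
  apply (dil_series_derive _ (tau r0) (rho r0) _ (1 * r0) M N i t); auto.
  - intros nu. apply pow_le. destruct (rho_le_r0 r0 nu H). lra.
  - intros nu. apply tau_bounds, H.
  - apply rho_series, H.
  - intros nu. rewrite <- (Rmult_1_l (rho r0 nu ^ _)). apply rho_weight; [exact H|lra|lia].
  - intros j x Hj. specialize (HB j x Hj). pose proof (Rabs_pos x). nra.
  - intros x. apply HB. lia.
  - intros j x. apply qder_derive.
Qed.

Lemma lser_derive (r0 K : R) (N i : nat) (t : R) : 0 < r0 <= 1 / 2 -> 0 <= K -> (i + 2 <= N)%nat ->
  is_derive (lser r0 K N i) t (lser r0 K N (S i) t).
Proof.
  intros H HK Hi. destruct (lder_bounded (16 * (N + 3)) N) as [M [HM [HB HB']]].
  apply (dil_series_derive _ (tau r0) (rho r0) _ (K * r0) M N i t); auto.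
  - intros nu. apply Rmult_le_pos; [exact HK|]. apply pow_le. destruct (rho_le_r0 r0 nu H). lra.
  - intros nu. apply tau_bounds, H.
  - apply rho_series, H.
  - intros nu. apply rho_weight; [exact H|lra|lia].
  - intros x. apply HB. lia.
  - intros j x. apply lder_derive.
Qed.

Lemma bser_small (r0 M : R) (N i : nat) (t : R) : 0 < r0 <= 1 / 2 -> 0 <= M -> (i <= N)%nat ->
  (forall x, Rabs (qder (2 * (16 * (N + 3) + 1)) i x) <= M) ->
  Rabs (bser r0 N i t) <= M * r0.
Proof.
  intros H HM Hi HB. destruct (rho_series r0 H) as [S1 S2].
  assert (E : Rabs (bser r0 N i t) <= (M * r0) * Series (rho r0)).
  { apply series_dominated; [exact S1|]. intros nu. destruct (rho_le_r0 r0 nu H).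
    pose proof (tau_bounds r0 nu H).
    assert (W : 0 <= rho r0 nu ^ (16 * (N + 2)) / tau r0 nu ^ i).
    { apply Rdiv_le_0_compat; [apply pow_le; lra|apply pow_lt; lra]. }
    rewrite Rabs_mult, Rabs_right by (apply Rle_ge, W).
    replace (M * r0 * rho r0 nu) with (1 * r0 * rho r0 nu * M) by ring.
    apply Rmult_le_compat; [exact W|apply Rabs_pos| |apply HB].
    rewrite <- (Rmult_1_l (rho r0 nu ^ _)). apply rho_weight; [exact H|lra|lia]. }
  assert (0 <= M * r0) by nra. nra.
Qed.

Lemma lser_small (r0 K M : R) (N : nat) (t : R) : 0 < r0 <= 1 / 2 -> 0 <= K -> 0 <= M ->
  (forall x, Rabs (lder (2 * (16 * (N + 3))) 0 x) <= M * (1 + Rabs x)) -> 0 <= t <= 1 ->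
  lser r0 K N 0 t <= 2 * (K * M) * r0.
Proof.
  intros H HK HM HB Ht. destruct (rho_series r0 H) as [S1 S2].
  destruct (dil_series_ex (fun nu => K * rho r0 nu ^ (16 * (N + 3) + 4)) (tau r0) (rho r0)
    (lder (2 * (16 * (N + 3)))) (K * r0) M 0 0 t) as [_ E]; auto.
  - intros nu. apply Rmult_le_pos; [exact HK|]. apply pow_le. destruct (rho_le_r0 r0 nu H). lra.
  - intros nu. apply tau_bounds, H.
  - intros nu. apply rho_weight; [exact H|lra|lia].
  - rewrite (Rabs_right t) in E by lra.
    pose proof (Rle_abs (lser r0 K N 0 t)) as A. unfold lser in A at 2.
    assert (0 <= M * (K * r0)) by (apply Rmult_le_pos; nra).
    assert (M * (1 + t) * (K * r0) * Series (rho r0) <= M * (K * r0) * 2 * 1).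
    { replace (M * (1 + t) * (K * r0)) with (M * (K * r0) * (1 + t)) by ring.
      apply Rmult_le_compat; [nra|lra| |lra]. nra. }
    lra.
Qed.

Lemma lser_mono (r0 K : R) (N : nat) (x y : R) : 0 < r0 <= 1 / 2 -> 0 <= K -> 0 <= x <= y ->
  lser r0 K N 0 x <= lser r0 K N 0 y.
Proof.
  intros H HK Hxy. apply series_le_gen; [apply lser_ex; auto; lia..|].
  intros nu. destruct (rho_le_r0 r0 nu H). pose proof (tau_bounds r0 nu H).
  apply Rmult_le_compat_l.
  { apply Rdiv_le_0_compat; [apply Rmult_le_pos; [exact HK|apply pow_le; lra]|apply pow_lt; lra]. }
  unfold lder.
  assert (A : 0 <= x / tau r0 nu) by (apply Rdiv_le_0_compat; lra).
  assert (B : x / tau r0 nu <= y / tau r0 nu).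
  { apply Rmult_le_compat_r; [apply Rlt_le, Rinv_0_lt_compat; lra|lra]. }
  assert (0 <= (x / tau r0 nu) ^ (2 * (16 * (N + 3)))) by (apply pow_le, A).
  apply ln_le; [lra|]. apply Rplus_le_compat_l, pow_incr. lra.
Qed.

Lemma lser_zero (r0 K : R) (N : nat) : lser r0 K N 0 0 = 0.
Proof.
  unfold lser, dil_series.
  transitivity (Series (fun _ : nat => 0 * 0)); [|rewrite Series_scal_l; ring].
  apply Series_ext. intros nu. unfold lder, Rdiv at 2. rewrite Rmult_0_l, pow_i by lia.
  rewrite Rplus_0_r, ln_1. ring.
Qed.

Lemma lser_slope (r0 K : R) (N : nat) (x : R) : 0 < r0 <= 1 / 2 -> 0 <= K -> (1 <= N)%nat -> 0 <= x ->
  0 <= lser r0 K N 1 x.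
Proof.
  intros H HK HN Hx. apply series_nonneg; [apply lser_ex; auto; lia|].
  intros nu. destruct (rho_le_r0 r0 nu H). pose proof (tau_bounds r0 nu H).
  assert (A : 0 <= x / tau r0 nu) by (apply Rdiv_le_0_compat; lra).
  apply Rmult_le_pos.
  { apply Rdiv_le_0_compat; [apply Rmult_le_pos; [exact HK|apply pow_le; lra]|apply pow_lt; lra]. }
  unfold lder. set (b := (2 * (16 * (N + 3)))%nat).
  apply Rmult_le_pos; [apply pos_INR|].
  assert (0 <= (x / tau r0 nu) ^ b) by (apply pow_le, A).
  assert (0 <= (x / tau r0 nu) ^ pred b) by (apply pow_le, A).
  unfold qder. cbn [Nat.iter nat_rect ratpow fold_right fst snd]. rewrite pow_1.
  apply Rplus_le_le_0_compat; [|lra]. apply Rdiv_le_0_compat; lra.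
Qed.

Lemma Series_lin2 (a b : nat -> R) (x y : R) : ex_series a -> ex_series b ->
  ex_series (fun n => x * a n + y * b n) /\
  Series (fun n => x * a n + y * b n) = x * Series a + y * Series b.
Proof.
  intros Ha Hb.
  assert (Ha' : ex_series (fun n => x * a n)) by apply (ex_series_scal_l x a Ha).
  assert (Hb' : ex_series (fun n => y * b n)) by apply (ex_series_scal_l y b Hb).
  split; [apply (ex_series_plus _ _ Ha' Hb')|].
  rewrite Series_plus by assumption. rewrite !Series_scal_l. reflexivity.
Qed.

(** The two quantities bounded by [e] are [(t b)'] and [t (t b)'']. The last two bounds on [e] serve
    the two regions of [levi_inequality]: [s^12] is compared with [|F|^2] away from the cusp, and
    [4 s e] is what the logarithm must supply near it. *)
Lemma series_levi (r0 : R) (N : nat) (s : R) : let a := (2 * (16 * (N + 3) + 1))%nat in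
  let ea := INR a * (INR a + 2) in
  0 < r0 <= 1 / 2 -> ea * r0 <= 1 / 100 -> (2 <= N)%nat -> 0 <= s <= 1 ->
  exists e, let t := s ^ 4 in 0 <= e /\
    Rabs (bser r0 N 0 t + t * bser r0 N 1 t) <= e /\
    t * Rabs (2 * bser r0 N 1 t + t * bser r0 N 2 t) <= e /\
    e <= s ^ 12 / 100 /\
    4 * s * e <= lser r0 (32 * ea) N 1 t + t * lser r0 (32 * ea) N 2 t.
Proof.
  intros a ea H Hr HN Hs.
  assert (Hea : 0 <= ea) by (pose proof (pos_INR a); unfold ea; nra).
  set (t := s ^ 4). assert (Ht : 0 <= t) by (apply pow_le; lra).
  destruct (rho_series r0 H) as [S1 S2].
  set (c := fun nu => rho r0 nu ^ (16 * (N + 2))).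
  set (x := fun nu => t / tau r0 nu).
  assert (Hx : forall nu, 0 <= x nu).
  { intros nu. apply Rdiv_le_0_compat; [exact Ht|]. apply tau_bounds, H. }
  assert (Hc : forall nu, 0 <= c nu).
  { intros nu. apply pow_le. destruct (rho_le_r0 r0 nu H). lra. }
  (* The majorant is at most cubic, and [2 <= N] keeps [c nu / tau nu ^ 3] summable; with
     [t^3 = s^12] and [ea * r0 <= 1/100] this gives the bound by [s^12 / 100]. *)
  assert (Hmaj : forall nu, 0 <= c nu * qmaj a (x nu) <= ea * r0 * t ^ 3 * rho r0 nu).
  { intros nu. specialize (Hc nu). specialize (Hx nu).
    destruct (qmaj_dominates a (x nu)) as [_ [_ [Q1 Q2]]]; [unfold a; lia|exact Hx|].
    split; [nra|].
    apply Rle_trans with (c nu * (ea * x nu ^ 3)); [apply Rmult_le_compat_l; [exact Hc|exact Q2]|].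
    pose proof (tau_bounds r0 nu H).
    replace (c nu * (ea * x nu ^ 3)) with (ea * t ^ 3 * (1 * c nu / tau r0 nu ^ 3)) by (unfold x; field; lra).
    replace (ea * r0 * t ^ 3 * rho r0 nu) with (ea * t ^ 3 * (1 * r0 * rho r0 nu)) by ring.
    apply Rmult_le_compat_l; [apply Rmult_le_pos; [exact Hea|apply pow_le, Ht]|].
    apply rho_weight; [exact H|lra|lia]. }
  assert (Hex : ex_series (fun nu => c nu * qmaj a (x nu))).
  { apply (series_dominated _ (rho r0) (ea * r0 * t ^ 3)); [exact S1|].
    intros nu. destruct (Hmaj nu). rewrite Rabs_right; lra. }
  exists (Series (fun nu => c nu * qmaj a (x nu))). cbv zeta.
  assert (Ebs : forall i, (i <= 2)%nat -> ex_series (fun nu => c nu / tau r0 nu ^ i * qder a i (x nu))).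
  { intros i Hi. apply bser_ex; [exact H|lia]. }
  split; [apply series_nonneg; [exact Hex|intros nu; apply Hmaj]|].
  split; [|split; [|split]].
  - destruct (Series_lin2 _ _ 1 t (Ebs 0%nat ltac:(lia)) (Ebs 1%nat ltac:(lia))) as [_ E].
    rewrite <- (Rmult_1_l (bser r0 N 0 t)). unfold bser, dil_series. fold a.
    change (Series (fun nu => rho r0 nu ^ (16 * (N + 2)) / tau r0 nu ^ 0 * qder a 0 (t / tau r0 nu)))
      with (Series (fun nu => c nu / tau r0 nu ^ 0 * qder a 0 (x nu))).
    change (Series (fun nu => rho r0 nu ^ (16 * (N + 2)) / tau r0 nu ^ 1 * qder a 1 (t / tau r0 nu)))
      with (Series (fun nu => c nu / tau r0 nu ^ 1 * qder a 1 (x nu))).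
    rewrite <- E, <- (Rmult_1_l (Series (fun nu => c nu * qmaj a (x nu)))).
    assert (D : forall nu, Rabs (1 * (c nu / tau r0 nu ^ 0 * qder a 0 (x nu)) +
      t * (c nu / tau r0 nu ^ 1 * qder a 1 (x nu))) <= 1 * (c nu * qmaj a (x nu))).
    { intros nu. pose proof (tau_bounds r0 nu H).
      replace (1 * (c nu / tau r0 nu ^ 0 * qder a 0 (x nu)) +
        t * (c nu / tau r0 nu ^ 1 * qder a 1 (x nu))) with
        (c nu * (qder a 0 (x nu) + x nu * qder a 1 (x nu))).
      2: { replace t with (x nu * tau r0 nu) by (unfold x; field; lra). field. lra. }
      rewrite Rabs_mult, (Rabs_right (c nu)) by (apply Rle_ge, Hc). rewrite Rmult_1_l.
      apply Rmult_le_compat_l; [apply Hc|]. apply qmaj_dominates; [unfold a; lia|apply Hx]. }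
    apply (series_dominated _ _ 1 Hex D).
  - destruct (Series_lin2 _ _ (t * 2) (t * t) (Ebs 1%nat ltac:(lia)) (Ebs 2%nat ltac:(lia))) as [_ E].
    rewrite <- (Rabs_right t) at 1 by lra. rewrite <- Rabs_mult.
    replace (t * (2 * bser r0 N 1 t + t * bser r0 N 2 t)) with
      (t * 2 * bser r0 N 1 t + t * t * bser r0 N 2 t) by ring.
    unfold bser, dil_series. fold a.
    change (Series (fun nu => rho r0 nu ^ (16 * (N + 2)) / tau r0 nu ^ 1 * qder a 1 (t / tau r0 nu)))
      with (Series (fun nu => c nu / tau r0 nu ^ 1 * qder a 1 (x nu))).
    change (Series (fun nu => rho r0 nu ^ (16 * (N + 2)) / tau r0 nu ^ 2 * qder a 2 (t / tau r0 nu)))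
      with (Series (fun nu => c nu / tau r0 nu ^ 2 * qder a 2 (x nu))).
    rewrite <- E, <- (Rmult_1_l (Series (fun nu => c nu * qmaj a (x nu)))).
    assert (D : forall nu, Rabs (t * 2 * (c nu / tau r0 nu ^ 1 * qder a 1 (x nu)) +
      t * t * (c nu / tau r0 nu ^ 2 * qder a 2 (x nu))) <= 1 * (c nu * qmaj a (x nu))).
    { intros nu. pose proof (tau_bounds r0 nu H).
      replace (t * 2 * (c nu / tau r0 nu ^ 1 * qder a 1 (x nu)) +
        t * t * (c nu / tau r0 nu ^ 2 * qder a 2 (x nu))) with
        (c nu * (x nu * (2 * qder a 1 (x nu) + x nu * qder a 2 (x nu)))).
      2: { replace t with (x nu * tau r0 nu) by (unfold x; field; lra). field. lra. }
      rewrite Rabs_mult, (Rabs_right (c nu)) by (apply Rle_ge, Hc). rewrite Rmult_1_l.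
      apply Rmult_le_compat_l; [apply Hc|]. apply qmaj_dominates; [unfold a; lia|apply Hx]. }
    apply (series_dominated _ _ 1 Hex D).
  - assert (E : Series (fun nu => c nu * qmaj a (x nu)) <= ea * r0 * t ^ 3 * Series (rho r0)).
    { rewrite <- Series_scal_l. apply Series_le; [apply Hmaj|].
      apply (ex_series_scal_l (ea * r0 * t ^ 3) (rho r0) S1). }
    replace (s ^ 12) with (t ^ 3) by (unfold t; ring).
    assert (0 <= t ^ 3) by (apply pow_le, Ht).
    assert (0 <= ea * r0 * t ^ 3) by (apply Rmult_le_pos; [apply Rmult_le_pos; lra|assumption]).
    assert (ea * r0 * t ^ 3 <= 1 / 100 * t ^ 3) by (apply Rmult_le_compat_r; lra).
    nra.
  - set (b := (2 * (16 * (N + 3)))%nat).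
    assert (Hab : a = (b + 2)%nat) by (unfold a, b; lia).
    assert (Els : forall i, (i <= 2)%nat -> ex_series (fun nu =>
      32 * ea * rho r0 nu ^ (16 * (N + 3) + 4) / tau r0 nu ^ i * lder b i (x nu))).
    { intros i Hi. apply lser_ex; [exact H|lra|lia]. }
    destruct (Series_lin2 _ _ 1 t (Els 1%nat ltac:(lia)) (Els 2%nat ltac:(lia))) as [E0 E].
    rewrite <- (Rmult_1_l (lser r0 (32 * ea) N 1 t)). unfold lser, dil_series. fold b.
    change (Series (fun nu => 32 * ea * rho r0 nu ^ (16 * (N + 3) + 4) / tau r0 nu ^ 1 * lder b 1 (t / tau r0 nu)))
      with (Series (fun nu => 32 * ea * rho r0 nu ^ (16 * (N + 3) + 4) / tau r0 nu ^ 1 * lder b 1 (x nu))).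
    change (Series (fun nu => 32 * ea * rho r0 nu ^ (16 * (N + 3) + 4) / tau r0 nu ^ 2 * lder b 2 (t / tau r0 nu)))
      with (Series (fun nu => 32 * ea * rho r0 nu ^ (16 * (N + 3) + 4) / tau r0 nu ^ 2 * lder b 2 (x nu))).
    rewrite <- E, <- Series_scal_l.
    apply series_le_gen; [apply (ex_series_scal_l (4 * s) _ Hex)|exact E0|].
    intros nu. specialize (Hx nu). pose proof (tau_bounds r0 nu H) as Htau.
    destruct (rho_le_r0 r0 nu H) as [Hr1 Hr2].
    set (r := rho r0 nu) in *.
    assert (Hcr : r ^ (16 * (N + 3) + 4) = c nu * r ^ 20).
    { unfold c. fold r. rewrite <- pow_add. f_equal. lia. }
    rewrite Hcr.
    assert (Hb1 : 1 <= INR b) by (apply (le_INR 1); unfold b; lia).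
    destruct b as [|[|[|p]]] eqn:Eb; try (exfalso; unfold b in Eb; lia). rewrite <- Eb in *.
    destruct (qder_formulas p (x nu)) as [_ [E1 _]].
    { assert (0 <= x nu ^ S (S (S p))) by (apply pow_le, Hx). lra. }
    rewrite <- Eb in E1.
    replace (1 * (32 * ea * (c nu * r ^ 20) / tau r0 nu ^ 1 * lder b 1 (x nu)) +
      t * (32 * ea * (c nu * r ^ 20) / tau r0 nu ^ 2 * lder b 2 (x nu))) with
      (32 * ea * (c nu * r ^ 4) * (INR b * (qder b 0 (x nu) + x nu * qder b 1 (x nu)))).
    2: { replace t with (x nu * tau r0 nu) by (unfold x; field; lra). unfold lder.
         replace (tau r0 nu) with (r ^ 16) by reflexivity. field. lra. }
    rewrite E1.
    pose proof (qmaj_compare b (x nu) ltac:(lia) Hx) as QC. rewrite <- Hab in QC. fold ea in QC.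
    set (v := x nu ^ pred b / (1 + x nu ^ b) ^ 2) in *.
    assert (Hv : 0 <= v).
    { apply Rdiv_le_0_compat; [apply pow_le, Hx|]. apply pow_lt.
      assert (0 <= x nu ^ b) by (apply pow_le, Hx). lra. }
    replace (INR b * (INR b * x nu ^ pred b / (1 + x nu ^ b) ^ 2)) with (INR b * INR b * v) by (unfold v, Rdiv; ring).
    (* In the unit [r^4], [s] becomes [u] with [x = u^4], and [u <= 1 + u^4]. *)
    assert (Hsx : s <= r ^ 4 * (1 + x nu)).
    { assert (0 < r ^ 4) by (apply pow_lt; lra).
      set (u := s / r ^ 4). assert (Hu : s = r ^ 4 * u) by (unfold u; field; lra).
      assert (Hu0 : 0 <= u) by (apply Rdiv_le_0_compat; lra).
      assert (Hxu : x nu = u ^ 4).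
      { unfold x, t, tau. fold r. rewrite Hu. field. lra. }
      rewrite Hu, Hxu. apply Rmult_le_compat_l; [lra|].
      destruct (Rle_dec u 1); [assert (0 <= u ^ 4) by (apply pow_le, Hu0); lra|].
      assert (u ^ 1 <= u ^ 4) by (apply Rle_pow; [lra|lia]). lra. }
    assert (Hq : 0 <= qmaj a (x nu)) by (apply qmaj_dominates; [unfold a; lia|exact Hx]).
    specialize (Hc nu). assert (Hr4 : 0 < r ^ 4) by (apply pow_lt; lra).
    apply Rle_trans with (4 * (c nu * r ^ 4) * ((1 + x nu) * qmaj a (x nu))).
    + replace (4 * s * (c nu * qmaj a (x nu))) with (4 * (c nu * qmaj a (x nu)) * s) by ring.
      replace (4 * (c nu * r ^ 4) * ((1 + x nu) * qmaj a (x nu))) with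
        (4 * (c nu * qmaj a (x nu)) * (r ^ 4 * (1 + x nu))) by ring.
      apply Rmult_le_compat_l; [nra|exact Hsx].
    (* The coefficient [32 * ea] of the logarithm is the 4 of the claim times the [8 * ea] of
       [qmaj_compare]. *)
    + apply Rle_trans with (4 * (c nu * r ^ 4) * (8 * ea * v)).
      * apply Rmult_le_compat_l; [nra|exact QC].
      * assert (0 <= ea * (c nu * r ^ 4) * v) 
          by (apply Rmult_le_pos; [apply Rmult_le_pos; [exact Hea|nra]|exact Hv]).
        assert (1 <= INR b * INR b) by nra. nra.
Qed.

(** * The balance along the discs *)

(* For [j < nu] the disc of index [nu] lies deep inside the core of the [j]-th dilation. *)
Lemma rho_core (r0 t : R) (j nu : nat) : 0 < r0 <= 1 / 2 -> (j < nu)%nat ->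
  0 <= t <= rho r0 nu ^ 4 -> 0 <= t / tau r0 j <= rho r0 nu.
Proof.
  intros H Hj Ht. pose proof (tau_bounds r0 j H) as Htau.
  destruct (rho_le_r0 r0 nu H) as [R1 R2]. destruct (rho_le_r0 r0 j H) as [J1 J2].
  pose proof (rho_gap r0 j nu H Hj) as G.
  split; [apply Rdiv_le_0_compat; lra|].
  apply Rmult_le_reg_r with (tau r0 j); [lra|].
  unfold Rdiv. rewrite Rmult_assoc, Rinv_l, Rmult_1_r by lra.
  apply Rle_trans with (1 := proj2 Ht).
  replace (rho r0 nu ^ 4) with (rho r0 nu * rho r0 nu ^ 3) by ring.
  apply Rmult_le_compat_l; [lra|].
  apply Rle_trans with ((rho r0 j ^ 6) ^ 3); [apply pow_incr; lra|].
  rewrite <- pow_mult. unfold tau. apply pow_antitone; [lra|lia].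
Qed.

Lemma rho_tail (r0 : R) (j nu m e : nat) : 0 < r0 <= 1 / 2 -> (nu < j)%nat ->
  (1 <= m)%nat -> (e <= 6 * (m - 1))%nat -> rho r0 j ^ m <= rho r0 nu ^ e * rho r0 j.
Proof.
  intros H Hj Hm He.
  destruct (rho_le_r0 r0 nu H) as [R1 R2]. destruct (rho_le_r0 r0 j H) as [J1 J2].
  pose proof (rho_gap r0 nu j H Hj) as G.
  replace m with (m - 1 + 1)%nat by lia. rewrite pow_add, pow_1.
  apply Rmult_le_compat_r; [lra|].
  apply Rle_trans with ((rho r0 nu ^ 6) ^ (m - 1)); [apply pow_incr; lra|].
  rewrite <- pow_mult. apply pow_antitone; [lra|lia].
Qed.

(** On the disc of index [nu] only the step of that index counts. For [j < nu] the step is still in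
    its flat initial part, where [x^a <= rho nu ^ a]; for [j > nu] its height [rho j ^ P] is already
    tiny. *)
Lemma bser_plateau (r0 t : R) (N nu : nat) : let P := (16 * (N + 3))%nat in
  let a := (2 * (P + 1))%nat in
  0 < r0 <= 1 / 2 -> 0 <= t <= rho r0 nu ^ 4 ->
  Rabs (t * bser r0 N 0 t -
    rho r0 nu ^ P * ((t / tau r0 nu) ^ a / (1 + (t / tau r0 nu) ^ a))) <= rho r0 nu ^ (P + 3).
Proof.
  intros P a H Ht. destruct (rho_series r0 H) as [S1 S2].
  destruct (rho_le_r0 r0 nu H) as [R1 R2].
  set (T := fun j => rho r0 j ^ P * ((t / tau r0 j) ^ a / (1 + (t / tau r0 j) ^ a))).
  assert (ET : forall j, t * (rho r0 j ^ (16 * (N + 2)) / tau r0 j ^ 0 * qder a 0 (t / tau r0 j)) = T j).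
  { intros j. pose proof (tau_bounds r0 j H) as Htau. unfold T.
    assert (Hx : 0 <= t / tau r0 j) by (apply Rdiv_le_0_compat; lra).
    assert (0 <= (t / tau r0 j) ^ a) by (apply pow_le, Hx).
    replace (rho r0 j ^ P) with (rho r0 j ^ (16 * (N + 2)) * tau r0 j).
    2: { unfold tau. rewrite <- pow_add. f_equal. unfold P. lia. }
    unfold qder. cbn [Nat.iter nat_rect ratpow fold_right fst snd].
    assert (Ea : (t / tau r0 j) ^ a = t / tau r0 j * (t / tau r0 j) ^ pred a).
    { replace a with (S (pred a)) at 1 by (unfold a; lia). reflexivity. }
    assert (0 <= t * (t / tau r0 j) ^ pred a) by (apply Rmult_le_pos; [lra|apply pow_le, Hx]).
    rewrite Ea in H0 |- *. field. split; lra. }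
  assert (ES : t * bser r0 N 0 t = Series T).
  { unfold bser, dil_series. rewrite <- Series_scal_l. apply Series_ext, ET. }
  assert (Hex : ex_series T).
  { apply (ex_series_ext _ _ ET). 
    apply (ex_series_scal_l t (fun j => rho r0 j ^ (16 * (N + 2)) / tau r0 j ^ 0 * qder a 0 (t / tau r0 j))).
    apply (bser_ex r0 N 0); [exact H|lia]. }
  rewrite ES. change (rho r0 nu ^ P * _) with (T nu).
  apply Rle_trans with (rho r0 nu ^ (P + 3) * Series (rho r0)).
  2: { assert (0 < rho r0 nu ^ (P + 3)) by (apply pow_lt; lra). nra. }
  apply series_single_term; [apply pow_le; lra|exact S1| |exact Hex|].
  { intros j. destruct (rho_le_r0 r0 j H). lra. }
  intros j Hj. destruct (rho_le_r0 r0 j H) as [J1 J2].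
  pose proof (tau_bounds r0 j H) as Htau.
  assert (Hx : 0 <= t / tau r0 j) by (apply Rdiv_le_0_compat; lra).
  assert (Hp : 0 < rho r0 j ^ P) by (apply pow_lt; lra).
  assert (Hxa : 0 <= (t / tau r0 j) ^ a) by (apply pow_le, Hx).
  unfold T. set (y := (t / tau r0 j) ^ a) in *.
  assert (Hy : 0 <= y / (1 + y)) by (apply Rdiv_le_0_compat; lra).
  rewrite Rabs_right by (apply Rle_ge, Rmult_le_pos; lra).
  destruct (Nat.lt_ge_cases j nu) as [L|L].
  - destruct (rho_core r0 t j nu H L Ht) as [_ C].
    assert (y <= rho r0 nu ^ (P + 3)).
    { apply Rle_trans with (rho r0 nu ^ a); [apply pow_incr; lra|].
      apply pow_antitone; [lra|]. unfold a, P. lia. }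
    assert (y / (1 + y) <= y).
    { apply Rmult_le_reg_r with (1 + y); [lra|]. unfold Rdiv.
      rewrite Rmult_assoc, Rinv_l, Rmult_1_r by lra. nra. }
    assert (rho r0 j ^ P <= rho r0 j).
    { rewrite <- (pow_1 (rho r0 j)) at 2. apply pow_antitone; [lra|]. unfold P. lia. }
    rewrite (Rmult_comm (rho r0 nu ^ _)). apply Rmult_le_compat; lra.
  - assert (rho r0 j ^ P <= rho r0 nu ^ (P + 3) * rho r0 j).
    { apply rho_tail; [exact H|lia|unfold P; lia|unfold P; lia]. }
    assert (y / (1 + y) <= 1).
    { apply Rmult_le_reg_r with (1 + y); [lra|]. unfold Rdiv.
      rewrite Rmult_assoc, Rinv_l, Rmult_1_r by lra. lra. }
    nra.
Qed.

(** The term of index [nu] loses one power of [rho] to the logarithm, from [P + 4] to [P + 3]. For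
    [j < nu] the inequality [ln (1 + y) <= y] suffices, and for [j > nu] the coefficient is tiny. *)
Lemma lser_disc (r0 K t : R) (N nu : nat) : let P := (16 * (N + 3))%nat in
  0 < r0 <= 1 / 2 -> 0 <= K -> 0 <= t <= rho r0 nu ^ 4 ->
  lser r0 K N 0 t <= 2 * (K * INR (16 * (2 * P) + 1)) * rho r0 nu ^ (P + 3).
Proof.
  intros P H HK Ht. destruct (rho_series r0 H) as [S1 S2].
  destruct (rho_le_r0 r0 nu H) as [R1 R2].
  set (b := (2 * P)%nat). set (Z := INR (16 * b + 1)).
  assert (HZ : 1 <= Z) by (apply (le_INR 1); lia).
  assert (HKZ : 0 <= K * Z) by nra.
  assert (Ht1 : t <= 1).
  { apply Rle_trans with (1 := proj2 Ht). apply (pow_antitone _ 0); [lra|lia]. }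
  set (T := fun j => K * rho r0 j ^ (P + 4) / tau r0 j ^ 0 * lder b 0 (t / tau r0 j)).
  assert (Hex : ex_series T) by (apply lser_ex; [exact H|exact HK|lia]).
  assert (Hlog : forall j, 0 <= T j <= K * Z * rho r0 j ^ (P + 3)).
  { intros j. destruct (rho_le_r0 r0 j H) as [J1 J2]. pose proof (tau_bounds r0 j H) as Htau.
    destruct (ln_pow_bound (/ rho r0 j) (t / tau r0 j) b 16) as [L1 L2].
    - rewrite <- (Rinv_inv 2). apply Rinv_le_contravar; lra.
    - split; [apply Rdiv_le_0_compat; lra|]. unfold tau. rewrite pow_inv.
      unfold tau in Htau. assert (0 < / rho r0 j ^ 16) by (apply Rinv_0_lt_compat; lra).
      unfold Rdiv. nra.
    - assert (0 < rho r0 j ^ (P + 3)) by (apply pow_lt; lra).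
      unfold T, lder. fold Z in L2. rewrite pow_O.
      replace (P + 4)%nat with (P + 3 + 1)%nat by lia. rewrite (pow_add _ (P + 3) 1), pow_1.
      replace (K * (rho r0 j ^ (P + 3) * rho r0 j) / 1 * ln (1 + (t / tau r0 j) ^ b)) with
        (K * rho r0 j ^ (P + 3) * (rho r0 j * ln (1 + (t / tau r0 j) ^ b))) by field.
      assert (Hl : rho r0 j * ln (1 + (t / tau r0 j) ^ b) <= Z).
      { apply Rle_trans with (rho r0 j * (Z * / rho r0 j)); [apply Rmult_le_compat_l; lra|].
        right. field. lra. }
      assert (0 <= K * rho r0 j ^ (P + 3)) by nra.
      split; [apply Rmult_le_pos; [assumption|nra]|]. nra. }
  assert (E : Rabs (Series T - T nu) <= K * Z * rho r0 nu ^ (P + 3) * Series (rho r0)).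
  { apply series_single_term; [|exact S1| |exact Hex|].
    - apply Rmult_le_pos; [exact HKZ|apply pow_le; lra].
    - intros j. destruct (rho_le_r0 r0 j H). lra.
    - intros j Hj. destruct (rho_le_r0 r0 j H) as [J1 J2]. pose proof (tau_bounds r0 j H) as Htau.
      destruct (Hlog j) as [T1 T2]. rewrite Rabs_right by lra.
      destruct (Nat.lt_ge_cases j nu) as [L|L].
      + destruct (rho_core r0 t j nu H L Ht) as [C0' C].
        assert (Hy0 : 0 <= (t / tau r0 j) ^ b) by (apply pow_le, C0').
        assert (Hy : (t / tau r0 j) ^ b <= rho r0 nu ^ (P + 3)).
        { apply Rle_trans with (rho r0 nu ^ b); [apply pow_incr; lra|].
          apply pow_antitone; [lra|]. unfold b, P. lia. }
        assert (Hl : 0 <= ln (1 + (t / tau r0 j) ^ b) <= rho r0 nu ^ (P + 3)).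
        { split; [rewrite <- ln_1; apply ln_le; lra|].
          pose proof (exp_ineq1_le ((t / tau r0 j) ^ b)) as EI.
          apply ln_le in EI; [|lra]. rewrite ln_exp in EI. lra. }
        assert (rho r0 j ^ (P + 4) <= rho r0 j).
        { rewrite <- (pow_1 (rho r0 j)) at 2. apply pow_antitone; [lra|]. lia. }
        assert (0 < rho r0 j ^ (P + 4)) by (apply pow_lt; lra).
        unfold T, lder. rewrite pow_O.
        replace (K * rho r0 j ^ (P + 4) / 1 * ln (1 + (t / tau r0 j) ^ b)) with
          (K * (rho r0 j ^ (P + 4) * ln (1 + (t / tau r0 j) ^ b))) by field.
        replace (K * Z * rho r0 nu ^ (P + 3) * rho r0 j) with
          (K * (Z * (rho r0 j * rho r0 nu ^ (P + 3)))) by ring.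
        apply Rmult_le_compat_l; [exact HK|].
        assert (rho r0 j ^ (P + 4) * ln (1 + (t / tau r0 j) ^ b) <= rho r0 j * rho r0 nu ^ (P + 3))
          by (apply Rmult_le_compat; lra).
        assert (0 <= rho r0 j * rho r0 nu ^ (P + 3)) by nra. nra.
      + apply Rle_trans with (1 := T2). rewrite (Rmult_assoc (K * Z)).
        apply Rmult_le_compat_l; [exact HKZ|].
        apply rho_tail; [exact H|lia|lia|lia]. }
  change (lser r0 K N 0 t) with (Series T).
  destruct (Hlog nu) as [_ T2]. apply Rabs_le_between in E.
  assert (0 < rho r0 nu ^ (P + 3)) by (apply pow_lt; lra).
  assert (0 <= K * Z * rho r0 nu ^ (P + 3)) by nra. nra.
Qed.

(** Here [s = |mu|], and the terms are [- delta], the defect of the balance, [|w|^2], [|z1|^(2P)]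
    and the logarithm. All but the first are [O(rho^(P+3))]; the constant 8 is [3 + 4 + 1] for the
    defect, [|w|^2] and [|z1|^(2P)]. *)
Lemma disc_estimate (r0 K s : R) (N nu : nat) : let P := (16 * (N + 3))%nat in
  0 < r0 <= 1 / 2 -> 0 <= K -> (8 + 2 * (K * INR (16 * (2 * P) + 1))) * r0 < 1 ->
  0 <= s <= rho r0 nu ->
  - rho r0 nu ^ (P + 2) + Rabs (rho r0 nu ^ P - s ^ 4 * bser r0 N 0 (s ^ 4)) * s +
    4 * rho r0 nu ^ (2 * P + 2) + (s ^ 4) ^ P + lser r0 K N 0 (s ^ 4) < 0.
Proof.
  intros P H HK Hr Hs.
  destruct (rho_le_r0 r0 nu H) as [R1 R2].
  set (t := s ^ 4).
  assert (Ht : 0 <= t <= rho r0 nu ^ 4) by (split; [apply pow_le|apply pow_incr]; lra).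
  pose proof (bser_plateau r0 t N nu H Ht) as HB. cbv zeta in HB. fold P in HB.
  pose proof (lser_disc r0 K t N nu H HK Ht) as HL. cbv zeta in HL. fold P in HL.
  set (C := K * INR (16 * (2 * P) + 1)) in *.
  set (a := (2 * (P + 1))%nat) in *.
  set (r := rho r0 nu) in *.
  pose proof (tau_bounds r0 nu H) as Htau.
  assert (Hx : 0 <= t / tau r0 nu) by (apply Rdiv_le_0_compat; lra).
  set (x := t / tau r0 nu) in *.
  assert (Hy : 0 <= x ^ a) by (apply pow_le, Hx).
  assert (Hr4 : 0 < r ^ 4) by (apply pow_lt; lra).
  (* The step falls short of its height by [r^P / (1 + x^a)]; this bound turns the shortfall times
     [s] into [2 r^(P+4)], both before and after the step has risen. *)
  assert (Hsx : s <= 2 * r ^ 4 * (1 + x ^ a)).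
  { set (u := s / r ^ 4). assert (Hu : s = r ^ 4 * u) by (unfold u; field; lra).
    assert (Hu0 : 0 <= u) by (apply Rdiv_le_0_compat; lra).
    assert (Hxu : x = u ^ 4) by (unfold x, t, tau; fold r; rewrite Hu; field; lra).
    assert (u <= 1 + x ^ a).
    { destruct (Rle_dec u 1); [lra|]. rewrite Hxu, <- pow_mult.
      assert (u ^ 1 <= u ^ (4 * a)) by (apply Rle_pow; [lra|unfold a; lia]). lra. }
    rewrite Hu. nra. }
  assert (HP : 0 < r ^ P) by (apply pow_lt; lra).
  assert (H1 : r ^ P / (1 + x ^ a) * s <= 2 * r ^ (P + 4)).
  { rewrite pow_add. apply Rle_trans with (r ^ P / (1 + x ^ a) * (2 * r ^ 4 * (1 + x ^ a))).
    - apply Rmult_le_compat_l; [apply Rdiv_le_0_compat; lra|exact Hsx].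
    - right. field. lra. }
  assert (H2 : Rabs (r ^ P - t * bser r0 N 0 t) <= r ^ P / (1 + x ^ a) + r ^ (P + 3)).
  { replace (r ^ P - t * bser r0 N 0 t) with (r ^ P / (1 + x ^ a) -
      (t * bser r0 N 0 t - r ^ P * (x ^ a / (1 + x ^ a)))) by (field; lra).
    eapply Rle_trans; [apply Rabs_triang|]. rewrite Rabs_Ropp.
    apply Rplus_le_compat; [|exact HB].
    rewrite Rabs_right; [lra|apply Rle_ge, Rdiv_le_0_compat; lra]. }
  assert (H3 : Rabs (r ^ P - t * bser r0 N 0 t) * s <= 3 * r ^ (P + 4)).
  { assert (r ^ (P + 3) * s <= r ^ (P + 4)).
    { replace (P + 4)%nat with (P + 3 + 1)%nat by lia. rewrite (pow_add _ (P + 3) 1), pow_1.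
      apply Rmult_le_compat_l; [apply pow_le|]; lra. }
    assert (Rabs (r ^ P - t * bser r0 N 0 t) * s <= (r ^ P / (1 + x ^ a) + r ^ (P + 3)) * s)
      by (apply Rmult_le_compat_r; lra).
    lra. }
  assert (H4 : t ^ P <= r ^ (P + 3)).
  { apply Rle_trans with ((r ^ 4) ^ P); [apply pow_incr; exact Ht|].
    rewrite <- pow_mult. apply pow_antitone; [lra|unfold P; lia]. }
  assert (H5 : r ^ (2 * P + 2) <= r ^ (P + 3)) by (apply pow_antitone; [lra|unfold P; lia]).
  assert (H6 : r ^ (P + 4) <= r ^ (P + 3)) by (apply pow_antitone; [lra|lia]).
  assert (H7 : r ^ (P + 3) = r ^ (P + 2) * r).
  { replace (P + 3)%nat with (P + 2 + 1)%nat by lia. rewrite (pow_add _ (P + 2) 1), pow_1. reflexivity. }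
  assert (H8 : 0 < r ^ (P + 2)) by (apply pow_lt; lra).
  assert (HC : 0 <= C) by (unfold C; apply Rmult_le_pos; [exact HK|apply pos_INR]).
  assert (H9 : (8 + 2 * C) * r < 1) by nra.
  assert (H10 : (8 + 2 * C) * r ^ (P + 3) < r ^ (P + 2)) by (rewrite H7; nra).
  lra.
Qed.

(** * The properties of the radial functions on which the domain rests *)

(* The [i]-th derivatives of [l] and [b] are [l i] and [b i]; in the last field [s^2 = |z1|] and
   [e] bounds the contribution of [b] to the Levi form. *)
Record profile (n : nat) (l b : nat -> R -> R) : Prop := {
  profile_l_derive : forall i x, (i < n)%nat -> is_derive (l i) x (l (S i) x);
  profile_b_derive : forall i x, (i < n)%nat -> is_derive (b i) x (b (S i) x);
  profile_l_zero : l 0%nat 0 = 0;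
  profile_l_mono : forall x y, 0 <= x <= y -> l 0%nat x <= l 0%nat y;
  profile_l_small : forall x, 0 <= x <= 1 -> l 0%nat x <= 1 / 100;
  profile_l_slope : forall x, 0 <= x -> 0 <= l 1%nat x;
  profile_b_small : forall x, Rabs (b 0%nat x) <= 1 / 100;
  profile_b_slope : forall x, Rabs (b 1%nat x) <= 1 / 100;
  profile_levi : forall s, 0 <= s <= 1 -> exists e, let t := s ^ 4 in
    0 <= e /\ Rabs (b 0%nat t + t * b 1%nat t) <= e /\
    t * Rabs (2 * b 1%nat t + t * b 2%nat t) <= e /\ e <= s ^ 12 / 100 /\
    4 * s * e <= l 1%nat t + t * l 2%nat t }.

Lemma profile_exists (n : nat) : exists (P : nat) (l b : nat -> R -> R) (r : nat -> R),
  (4 <= P)%nat /\ profile n l b /\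
  (forall nu, 0 < r nu <= 1 / 2) /\ (forall nu, r (S nu) < r nu) /\ Un_cv r 0 /\
  forall nu s, 0 <= s <= r nu ->
    - r nu ^ (P + 2) + Rabs (r nu ^ P - s ^ 4 * b 0%nat (s ^ 4)) * s +
      4 * r nu ^ (2 * P + 2) + (s ^ 4) ^ P + l 0%nat (s ^ 4) < 0.
Proof.
  (* Termwise differentiation at order [i] uses order [i + 2], and [series_levi] asks for
     [2 <= N]. *)
  set (N := (n + 2)%nat). set (P := (16 * (N + 3))%nat).
  destruct (qder_bounded (P + 1) N) as [Mq [HMq Bq]].
  destruct (lder_bounded P N) as [Ml [HMl [_ Bl]]].
  set (a := (2 * (P + 1))%nat). set (ea := INR a * (INR a + 2)).
  assert (Hea : 0 <= ea) by (pose proof (pos_INR a); unfold ea; nra).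
  set (K := 32 * ea). set (W := K * INR (16 * (2 * P) + 1)).
  assert (HW : 0 <= W) by (apply Rmult_le_pos; [unfold K; lra|apply pos_INR]).
  assert (HKM : 0 <= K * Ml) by (apply Rmult_le_pos; [unfold K; lra|exact HMl]).
  (* [Z] dominates every constant that has to be beaten, so the single choice [Z * r0 = 1/200] meets
     all smallness conditions. *)
  set (Z := 10 + Mq + 2 * (K * Ml) + ea + 2 * W).
  set (r0 := / (200 * Z)).
  assert (HZ : 10 <= Z) by (unfold Z; lra).
  assert (Hr0 : 0 < r0) by (apply Rinv_0_lt_compat; lra).
  assert (HrZ : Z * r0 = 1 / 200) by (unfold r0; field; lra).
  assert (H : 0 < r0 <= 1 / 2) by (split; [exact Hr0|nra]).
  exists P, (lser r0 K N), (bser r0 N), (rho r0).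
  assert (HK : 0 <= K) by (unfold K; lra).
  assert (S1 : Mq * r0 <= 1 / 100) by (unfold Z in HrZ; nra).
  assert (S2 : 2 * (K * Ml) * r0 <= 1 / 100) by (unfold Z in HrZ; nra).
  assert (S3 : ea * r0 <= 1 / 100) by (unfold Z in HrZ; nra).
  assert (S4 : (8 + 2 * W) * r0 < 1) by (unfold Z in HrZ; nra).
  split; [unfold P; lia|]. split; [|split; [|split; [|split]]].
  - constructor.
    + intros i x Hi. apply lser_derive; [exact H|exact HK|unfold N; lia].
    + intros i x Hi. apply bser_derive; [exact H|unfold N; lia].
    + apply lser_zero.
    + intros x y. apply lser_mono; assumption.
    + intros x Hx. eapply Rle_trans; [|exact S2].
      apply lser_small; try assumption. intros y. apply Bl. lia.
    + intros x Hx. apply lser_slope; try assumption. unfold N; lia.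
    + intros x. eapply Rle_trans; [|exact S1]. apply bser_small; try assumption; [lia|].
      intros y. apply Bq. lia.
    + intros x. eapply Rle_trans; [|exact S1]. apply bser_small; try assumption; [unfold N; lia|].
      intros y. apply Bq. unfold N; lia.
    + intros s Hs. apply series_levi; try assumption. unfold N; lia.
  - intros nu. destruct (rho_le_r0 r0 nu H). lra.
  - intros nu. destruct (rho_le_r0 r0 nu H). simpl.
    assert (rho r0 nu ^ 6 <= rho r0 nu ^ 2) by (apply pow_antitone; [lra|lia]).
    simpl in H2. nra.
  - intros e He. destruct (pow_lt_1_zero (1/2) ltac:(rewrite Rabs_right; lra) e He) as [M HM].
    exists M. intros m Hm. specialize (HM m Hm).
    destruct (rho_bounds r0 m H) as [Q1 Q2].
    unfold Rdist. rewrite Rminus_0_r, Rabs_right by lra.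
    assert (0 < (1/2) ^ m) by (apply pow_lt; lra).
    rewrite Rabs_right in HM by lra. nra.
  - intros nu s Hs. apply disc_estimate; assumption.
Qed.

(** * Functions of class C^k on C^3 *)

Lemma Cnorm_nonneg (a : C) : 0 <= Cnorm a.
Proof. apply sqrt_pos. Qed.

Lemma Cnorm_sq (a : C) : Cnorm a ^ 2 = fst a ^ 2 + snd a ^ 2.
Proof. unfold Cnorm. apply pow2_sqrt. nra. Qed.

Lemma V3dot_nonneg (z : C3) : 0 <= V3dot z z.
Proof. unfold V3dot, Cdot. nra. Qed.

Lemma V3norm_nonneg (z : C3) : 0 <= V3norm z.
Proof. apply sqrt_pos. Qed.

Lemma V3norm_sq (z : C3) : V3norm z ^ 2 = V3dot z z.
Proof. unfold V3norm. apply pow2_sqrt, V3dot_nonneg. Qed.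

Lemma le_of_sq_le (x y : R) : 0 <= y -> x ^ 2 <= y ^ 2 -> x <= y.
Proof. intros. nra. Qed.

Lemma Cnorm_mul (a b : C) : Cnorm (Cmul a b) = Cnorm a * Cnorm b.
Proof.
  unfold Cnorm. rewrite <- sqrt_mult by nra. f_equal. destruct a, b; simpl; ring.
Qed.

Lemma Cnorm_triang (a b : C) : Cnorm (Cadd a b) <= Cnorm a + Cnorm b.
Proof.
  pose proof (Cnorm_nonneg a). pose proof (Cnorm_nonneg b).
  apply le_of_sq_le; [lra|].
  pose proof (Cnorm_sq a) as Ha. pose proof (Cnorm_sq b) as Hb. rewrite Cnorm_sq.
  destruct a as [a1 a2], b as [b1 b2]; simpl fst in *; simpl snd in *.
  set (u := Cnorm (a1, a2)) in *. set (v := Cnorm (b1, b2)) in *.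
  assert (a1 * b1 + a2 * b2 <= u * v).
  { apply le_of_sq_le; [nra|].
    replace ((u * v) ^ 2) with (u ^ 2 * v ^ 2) by ring. rewrite Ha, Hb.
    pose proof (pow2_ge_0 (a1 * b2 - a2 * b1)). nra. }
  nra.
Qed.

Lemma Cnorm_opp (a : C) : Cnorm (Copp a) = Cnorm a.
Proof. unfold Cnorm. f_equal. destruct a; simpl; ring. Qed.

Definition coords (z : C3) : list R :=
  fst (c1 z) :: snd (c1 z) :: fst (c2 z) :: snd (c2 z) :: fst (c3 z) :: snd (c3 z) :: nil.

Lemma V3dist_sq (z w : C3) : V3dist z w ^ 2 =
  (fst (c1 z) - fst (c1 w)) ^ 2 + (snd (c1 z) - snd (c1 w)) ^ 2 +
  (fst (c2 z) - fst (c2 w)) ^ 2 + (snd (c2 z) - snd (c2 w)) ^ 2 +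
  (fst (c3 z) - fst (c3 w)) ^ 2 + (snd (c3 z) - snd (c3 w)) ^ 2.
Proof.
  unfold V3dist. rewrite V3norm_sq. unfold V3dot, Cdot.
  destruct z as [[[x1 y1] [x2 y2]] [x3 y3]], w as [[[a1 b1] [a2 b2]] [a3 b3]]. simpl. ring.
Qed.

(** The factor 3 is a convenient bound for [sqrt 6]. *)
Lemma V3dist_le (z w : C3) (e : R) : 0 <= e ->
  (forall i, (i < 6)%nat -> Rabs (nth i (coords z) 0 - nth i (coords w) 0) <= e) ->
  V3dist z w <= 3 * e.
Proof.
  intros He H. apply le_of_sq_le; [lra|]. rewrite V3dist_sq.
  assert (Q : forall i, (i < 6)%nat -> (nth i (coords z) 0 - nth i (coords w) 0) ^ 2 <= e ^ 2).
  { intros i Hi. specialize (H i Hi). rewrite <- pow2_abs. apply pow_incr. split; [apply Rabs_pos|exact H]. }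
  pose proof (Q 0%nat ltac:(lia)). pose proof (Q 1%nat ltac:(lia)). pose proof (Q 2%nat ltac:(lia)).
  pose proof (Q 3%nat ltac:(lia)). pose proof (Q 4%nat ltac:(lia)). pose proof (Q 5%nat ltac:(lia)).
  cbn [nth coords] in *. nra.
Qed.

Lemma coord_le_V3dist (z w : C3) (i : nat) : (i < 6)%nat ->
  Rabs (nth i (coords z) 0 - nth i (coords w) 0) <= V3dist z w.
Proof.
  intros Hi. apply le_of_sq_le; [apply V3norm_nonneg|]. rewrite pow2_abs, V3dist_sq.
  pose proof (pow2_ge_0 (fst (c1 z) - fst (c1 w))). pose proof (pow2_ge_0 (snd (c1 z) - snd (c1 w))).
  pose proof (pow2_ge_0 (fst (c2 z) - fst (c2 w))). pose proof (pow2_ge_0 (snd (c2 z) - snd (c2 w))).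
  pose proof (pow2_ge_0 (fst (c3 z) - fst (c3 w))). pose proof (pow2_ge_0 (snd (c3 z) - snd (c3 w))).
  do 6 (destruct i as [|i]; [cbn [nth coords]; lra|]). lia.
Qed.

Lemma V3dist_line (z w : C3) (l l' : C) :
  V3dist (V3add z (V3cscal l w)) (V3add z (V3cscal l' w)) = Cdist l l' * V3norm w.
Proof.
  pose proof (V3norm_nonneg w). pose proof (Cnorm_nonneg (Cadd l (Copp l'))) as Q.
  fold (Cdist l l') in Q.
  assert (E : V3dist (V3add z (V3cscal l w)) (V3add z (V3cscal l' w)) ^ 2 = (Cdist l l' * V3norm w) ^ 2).
  { rewrite V3dist_sq, Rpow_mult_distr. unfold Cdist. rewrite Cnorm_sq, V3norm_sq. unfold V3dot, Cdot.
    destruct z as [[[x1 y1] [x2 y2]] [x3 y3]], w as [[[a1 b1] [a2 b2]] [a3 b3]], l, l'. simpl. ring. }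
  apply Rle_antisym; apply le_of_sq_le; try rewrite E; try lra.
  - apply Rmult_le_pos; lra.
  - apply V3norm_nonneg.
Qed.

Definition smooth3 (k : nat) (f : C3 -> R) : Prop :=
  Ck V3dist V3add V3rscal basis6 k (fun _ => True) f.

Definition cont3 (f : C3 -> R) : Prop := cont_on V3dist (fun _ => True) f.

Lemma smooth3_cont (k : nat) (f : C3 -> R) : smooth3 k f -> cont3 f.
Proof. destruct k; [auto|intros [H _]; exact H]. Qed.

Lemma smooth3_weaken (k : nat) (f : C3 -> R) : smooth3 (S k) f -> smooth3 k f.
Proof.
  revert f. induction k as [|k IH]; intros f [H1 H2]; [exact H1|].
  split; [exact H1|]. intros e He. destruct (H2 e He) as [g [G1 G2]].
  exists g. split; [exact G1|]. apply IH, G2.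
Qed.

Lemma cont_on_const {V} (dist : V -> V -> R) (U : V -> Prop) (c : R) : cont_on dist U (fun _ => c).
Proof.
  intros x _ e He. exists 1. split; [lra|]. intros y _ _.
  rewrite Rminus_diag, Rabs_R0. exact He.
Qed.

Lemma cont_on_plus {V} (dist : V -> V -> R) (U : V -> Prop) (f g : V -> R) :
  cont_on dist U f -> cont_on dist U g -> cont_on dist U (fun z => f z + g z).
Proof.
  intros Hf Hg x Hx e He.
  destruct (Hf x Hx (e / 2) ltac:(lra)) as [d1 [D1 F1]].
  destruct (Hg x Hx (e / 2) ltac:(lra)) as [d2 [D2 F2]].
  exists (Rmin d1 d2). split; [apply Rmin_pos; assumption|]. intros y HUy Hy.
  specialize (F1 y HUy ltac:(eapply Rlt_le_trans; [exact Hy|apply Rmin_l])).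
  specialize (F2 y HUy ltac:(eapply Rlt_le_trans; [exact Hy|apply Rmin_r])).
  replace (f y + g y - (f x + g x)) with ((f y - f x) + (g y - g x)) by ring.
  eapply Rle_lt_trans; [apply Rabs_triang|lra].
Qed.

Lemma cont_on_mult {V} (dist : V -> V -> R) (U : V -> Prop) (f g : V -> R) :
  cont_on dist U f -> cont_on dist U g -> cont_on dist U (fun z => f z * g z).
Proof.
  intros Hf Hg x Hx e He.
  set (M := Rabs (f x) + Rabs (g x) + 1).
  pose proof (Rabs_pos (f x)). pose proof (Rabs_pos (g x)).
  assert (HM : 0 < M) by (unfold M; lra).
  set (d := Rmin 1 (e / (2 * M))).
  assert (Hd : 0 < d) by (apply Rmin_pos; [lra|apply Rdiv_lt_0_compat; lra]).
  destruct (Hf x Hx d Hd) as [d1 [D1 F1]]. destruct (Hg x Hx d Hd) as [d2 [D2 F2]].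
  exists (Rmin d1 d2). split; [apply Rmin_pos; assumption|]. intros y HUy Hy.
  specialize (F1 y HUy ltac:(eapply Rlt_le_trans; [exact Hy|apply Rmin_l])).
  specialize (F2 y HUy ltac:(eapply Rlt_le_trans; [exact Hy|apply Rmin_r])).
  replace (f y * g y - f x * g x) with ((f y - f x) * (g y - g x) + ((f y - f x) * g x + f x * (g y - g x))) by ring.
  assert (d <= 1) by apply Rmin_l. assert (Q : d <= e / (2 * M)) by apply Rmin_r.
  assert (d * M <= e / 2).
  { apply (Rmult_le_compat_r M) in Q; [|lra]. replace (e / (2 * M) * M) with (e / 2) in Q by (field; lra). exact Q. }
  eapply Rle_lt_trans; [apply Rabs_triang|]. rewrite Rabs_mult.
  eapply Rle_lt_trans; [apply Rplus_le_compat_l, Rabs_triang|]. rewrite !Rabs_mult.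
  pose proof (Rabs_pos (f y - f x)). pose proof (Rabs_pos (g y - g x)).
  set (u := Rabs (f y - f x)) in *. set (v := Rabs (g y - g x)) in *.
  assert (u * v <= d * 1) by (apply Rmult_le_compat; lra).
  assert (u * Rabs (g x) <= d * Rabs (g x)) by (apply Rmult_le_compat_r; lra).
  assert (Rabs (f x) * v <= Rabs (f x) * d) by (apply Rmult_le_compat_l; lra).
  unfold M in *. nra.
Qed.

Lemma is_derive_cont (F : R -> R) (x l : R) : is_derive F x l ->
  forall e, 0 < e -> exists d, 0 < d /\ forall y, Rabs (y - x) < d -> Rabs (F y - F x) < e.
Proof.
  intros H e He.
  assert (Hc : continuity_pt F x).
  { apply derivable_continuous_pt. exists l. apply is_derive_Reals, H. }
  destruct (Hc e He) as [d [Hd Hy]]. exists d. split; [exact Hd|]. intros y Hyd.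
  destruct (Req_dec y x) as [->|Hne]; [rewrite Rminus_diag, Rabs_R0; exact He|].
  apply Hy. split; [split; [exact I|auto]|exact Hyd].
Qed.

Lemma cont3_comp (F : R -> R) (f : C3 -> R) : (forall x, exists l, is_derive F x l) ->
  cont3 f -> cont3 (fun z => F (f z)).
Proof.
  intros HF Hf x _ e He. destruct (HF (f x)) as [l Hl].
  destruct (is_derive_cont F (f x) l Hl e He) as [d [Hd H]].
  destruct (Hf x I d Hd) as [d' [Hd' H']]. exists d'. split; [exact Hd'|].
  intros y _ Hy. apply H, H'; auto.
Qed.

Lemma smooth3_const (k : nat) (c : R) : smooth3 k (fun _ => c).
Proof.
  revert c. induction k as [|k IH]; intros c; [apply cont_on_const|].
  split; [apply cont_on_const|]. intros e _. exists (fun _ => 0). split; [|apply IH].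
  intros x _. apply derivable_pt_lim_const.
Qed.

Lemma smooth3_plus (k : nat) (f g : C3 -> R) :
  smooth3 k f -> smooth3 k g -> smooth3 k (fun z => f z + g z).
Proof.
  revert f g. induction k as [|k IH]; intros f g; [apply cont_on_plus|].
  intros [F1 F2] [G1 G2]. split; [apply cont_on_plus; assumption|].
  intros e He. destruct (F2 e He) as [f' [F3 F4]]. destruct (G2 e He) as [g' [G3 G4]].
  exists (fun z => f' z + g' z). split; [|apply IH; assumption].
  intros x _. apply (derivable_pt_lim_plus (fun t => f (V3add x (V3rscal t e)))); auto.
Qed.

Lemma V3add_zero (x e : C3) : V3add x (V3rscal 0 e) = x.
Proof.
  destruct x as [[[x1 y1] [x2 y2]] [x3 y3]], e as [[[a1 b1] [a2 b2]] [a3 b3]].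
  unfold V3add, V3rscal, V3, Cadd, Crscal; simpl.
  repeat f_equal; ring.
Qed.

Lemma smooth3_mult (k : nat) (f g : C3 -> R) :
  smooth3 k f -> smooth3 k g -> smooth3 k (fun z => f z * g z).
Proof.
  revert f g. induction k as [|k IH]; intros f g; [apply cont_on_mult|].
  intros HF HG. pose proof (smooth3_weaken _ _ HF) as WF. pose proof (smooth3_weaken _ _ HG) as WG.
  destruct HF as [F1 F2], HG as [G1 G2]. split; [apply cont_on_mult; assumption|].
  intros e He. destruct (F2 e He) as [f' [F3 F4]]. destruct (G2 e He) as [g' [G3 G4]].
  exists (fun z => f' z * g z + f z * g' z). split; [|apply smooth3_plus; apply IH; assumption].
  intros x Hx. specialize (F3 x Hx). specialize (G3 x Hx).
  pose proof (derivable_pt_lim_mult (fun t => f (V3add x (V3rscal t e))) _ 0 _ _ F3 G3) as D.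
  cbv beta in D. rewrite V3add_zero in D. exact D.
Qed.

Lemma smooth3_pow (k m : nat) (f : C3 -> R) : smooth3 k f -> smooth3 k (fun z => f z ^ m).
Proof.
  intros H. induction m as [|m IH]; simpl; [apply smooth3_const|]. apply smooth3_mult; assumption.
Qed.

Lemma smooth3_opp (k : nat) (f : C3 -> R) : smooth3 k f -> smooth3 k (fun z => - f z).
Proof.
  intros H. replace (fun z => - f z) with (fun z => -1 * f z).
  - apply smooth3_mult; [apply smooth3_const|exact H].
  - apply FunctionalExtensionality.functional_extensionality. intros z. ring.
Qed.

Lemma smooth3_minus (k : nat) (f g : C3 -> R) :
  smooth3 k f -> smooth3 k g -> smooth3 k (fun z => f z - g z).
Proof. intros Hf Hg. apply smooth3_plus; [exact Hf|apply smooth3_opp, Hg]. Qed.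

(** The strict inequality [i + k < n] makes the last derivative [F (i + k)] differentiable, which is
    how its continuity is obtained. *)
Lemma smooth3_comp (k i n : nat) (F : nat -> R -> R) (f : C3 -> R) :
  (forall j x, (j < n)%nat -> is_derive (F j) x (F (S j) x)) ->
  (i + k < n)%nat -> smooth3 k f -> smooth3 k (fun z => F i (f z)).
Proof.
  intros HF. revert i f. induction k as [|k IH]; intros i f Hi Hf.
  - apply cont3_comp; [|exact Hf]. intros x. exists (F (S i) x). apply HF. lia.
  - pose proof (smooth3_weaken _ _ Hf) as Wf. destruct Hf as [F1 F2]. split.
    + apply cont3_comp; [|exact F1]. intros x. exists (F (S i) x). apply HF. lia.
    + intros e He. destruct (F2 e He) as [f' [F3 F4]].
      exists (fun z => F (S i) (f z) * f' z). split.
      * intros x Hx.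
        apply (derivable_pt_lim_comp (fun t => f (V3add x (V3rscal t e))) (F i)); [apply F3, Hx|].
        rewrite V3add_zero. apply is_derive_Reals, HF. lia.
      * apply smooth3_mult; [|exact F4]. apply IH; [lia|exact Wf].
Qed.

Lemma smooth3_coord (k i : nat) : (i < 6)%nat -> smooth3 k (fun z => nth i (coords z) 0).
Proof.
  intros Hi.
  assert (Hc : cont3 (fun z => nth i (coords z) 0)).
  { intros x _ e He. exists e. split; [exact He|]. intros y _ Hy.
    rewrite Rabs_minus_sym. eapply Rle_lt_trans; [apply coord_le_V3dist, Hi|exact Hy]. }
  destruct k as [|k]; [exact Hc|]. split; [exact Hc|]. intros e _.
  exists (fun _ => nth i (coords e) 0). split; [|apply smooth3_const].
  intros x _. apply is_derive_Reals.
  apply is_derive_ext with (fun t => nth i (coords x) 0 + t * nth i (coords e) 0).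
  - intros t. destruct x as [[[x1 y1] [x2 y2]] [x3 y3]], e as [[[a1 b1] [a2 b2]] [a3 b3]].
    do 6 (destruct i as [|i]; [reflexivity|]). lia.
  - generalize (nth i (coords x) 0) (nth i (coords e) 0). intros u v.
    auto_derive; [exact I|ring].
Qed.

(** * The defining function and its Levi form *)

Definition sq1 (z : C3) : R := fst (c1 z) ^ 2 + snd (c1 z) ^ 2.
Definition sq2 (z : C3) : R := fst (c2 z) ^ 2 + snd (c2 z) ^ 2.
(* Real and imaginary parts of [F = z2^2 - z1^3]. *)
Definition cusp_re (z : C3) : R :=
  fst (c2 z) ^ 2 - snd (c2 z) ^ 2 - (fst (c1 z) ^ 3 - 3 * fst (c1 z) * snd (c1 z) ^ 2).
Definition cusp_im (z : C3) : R :=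
  2 * fst (c2 z) * snd (c2 z) - (3 * fst (c1 z) ^ 2 * snd (c1 z) - snd (c1 z) ^ 3).
Definition re12 (z : C3) : R := fst (c1 z) * fst (c2 z) + snd (c1 z) * snd (c2 z).

(** The first three summands are [Re w + |w|^2] with the square completed: the centre [w = -1/2] is
    both the only critical point in [w] and the centre of the contraction used for connectedness. *)
Definition defn (m : nat) (l b : R -> R) (z : C3) : R :=
  (fst (c3 z) + 1 / 2) ^ 2 + snd (c3 z) ^ 2 - 1 / 4 +
  (sq1 z ^ m + (cusp_re z ^ 2 + cusp_im z ^ 2) * (1 + sq1 z + sq2 z) + l (sq1 z)
   - re12 z * b (sq1 z)).

(** In what follows the prefix [d] marks the first derivative along the real direction [v], and [dd]
    the second. For the quadratic functions the second derivatives are [2 * sq1 v], [2 * sq2 v] and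
    [2 * re12 v]. *)
Definition dsq1 (z v : C3) : R := 2 * (fst (c1 z) * fst (c1 v) + snd (c1 z) * snd (c1 v)).
Definition dsq2 (z v : C3) : R := 2 * (fst (c2 z) * fst (c2 v) + snd (c2 z) * snd (c2 v)).
Definition dcusp_re (z v : C3) : R :=
  2 * (fst (c2 z) * fst (c2 v) - snd (c2 z) * snd (c2 v)) -
  3 * ((fst (c1 z) ^ 2 - snd (c1 z) ^ 2) * fst (c1 v) - 2 * fst (c1 z) * snd (c1 z) * snd (c1 v)).
Definition dcusp_im (z v : C3) : R :=
  2 * (fst (c2 z) * snd (c2 v) + snd (c2 z) * fst (c2 v)) -
  3 * ((fst (c1 z) ^ 2 - snd (c1 z) ^ 2) * snd (c1 v) + 2 * fst (c1 z) * snd (c1 z) * fst (c1 v)).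
Definition dre12 (z v : C3) : R :=
  fst (c1 v) * fst (c2 z) + fst (c1 z) * fst (c2 v) + snd (c1 v) * snd (c2 z) + snd (c1 z) * snd (c2 v).
Definition ddcusp_re (z v : C3) : R :=
  2 * (fst (c2 v) ^ 2 - snd (c2 v) ^ 2) -
  6 * (fst (c1 z) * (fst (c1 v) ^ 2 - snd (c1 v) ^ 2) - 2 * snd (c1 z) * fst (c1 v) * snd (c1 v)).
Definition ddcusp_im (z v : C3) : R :=
  4 * fst (c2 v) * snd (c2 v) -
  6 * (snd (c1 z) * (fst (c1 v) ^ 2 - snd (c1 v) ^ 2) + 2 * fst (c1 z) * fst (c1 v) * snd (c1 v)).

Definition line (z v : C3) (s : R) : C3 := V3add z (V3rscal s v).

Definition ddefn (m : nat) (l1 b b1 : R -> R) (z v : C3) : R :=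
  2 * (fst (c3 z) + 1 / 2) * fst (c3 v) + 2 * snd (c3 z) * snd (c3 v) +
  (INR m * sq1 z ^ pred m * dsq1 z v +
   2 * (cusp_re z * dcusp_re z v + cusp_im z * dcusp_im z v) * (1 + sq1 z + sq2 z) +
   (cusp_re z ^ 2 + cusp_im z ^ 2) * (dsq1 z v + dsq2 z v) + l1 (sq1 z) * dsq1 z v -
   dre12 z v * b (sq1 z) - re12 z * b1 (sq1 z) * dsq1 z v).

Definition dddefn (m : nat) (l1 l2 b b1 b2 : R -> R) (z v : C3) : R :=
  2 * fst (c3 v) ^ 2 + 2 * snd (c3 v) ^ 2 +
  (INR m * (INR (pred m) * sq1 z ^ pred (pred m) * dsq1 z v ^ 2 + sq1 z ^ pred m * (2 * sq1 v)) +
   2 * (dcusp_re z v ^ 2 + dcusp_im z v ^ 2 + cusp_re z * ddcusp_re z v + cusp_im z * ddcusp_im z v)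
     * (1 + sq1 z + sq2 z) +
   4 * (cusp_re z * dcusp_re z v + cusp_im z * dcusp_im z v) * (dsq1 z v + dsq2 z v) +
   (cusp_re z ^ 2 + cusp_im z ^ 2) * (2 * sq1 v + 2 * sq2 v) +
   l2 (sq1 z) * dsq1 z v ^ 2 + l1 (sq1 z) * (2 * sq1 v) -
   2 * re12 v * b (sq1 z) - 2 * dre12 z v * b1 (sq1 z) * dsq1 z v -
   re12 z * (b2 (sq1 z) * dsq1 z v ^ 2 + b1 (sq1 z) * (2 * sq1 v))).

Ltac line_derive :=
  intros z v s; destruct z as [[[x1 y1] [x2 y2]] [x3 y3]], v as [[[a1 b1] [a2 b2]] [a3 b3]];
  unfold line, sq1, sq2, cusp_re, cusp_im, re12, dsq1, dsq2, dcusp_re, dcusp_im, dre12,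
    ddcusp_re, ddcusp_im, V3add, V3rscal, V3, Cadd, Crscal, c1, c2, c3; cbn [fst snd];
  auto_derive; [exact I|ring].

Lemma sq1_line : forall z v s, is_derive (fun s => sq1 (line z v s)) s (dsq1 (line z v s) v).
Proof. line_derive. Qed.
Lemma sq2_line : forall z v s, is_derive (fun s => sq2 (line z v s)) s (dsq2 (line z v s) v).
Proof. line_derive. Qed.
Lemma cusp_re_line : forall z v s, is_derive (fun s => cusp_re (line z v s)) s (dcusp_re (line z v s) v).
Proof. line_derive. Qed.
Lemma cusp_im_line : forall z v s, is_derive (fun s => cusp_im (line z v s)) s (dcusp_im (line z v s) v).
Proof. line_derive. Qed.
Lemma re12_line : forall z v s, is_derive (fun s => re12 (line z v s)) s (dre12 (line z v s) v).
Proof. line_derive. Qed.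
Lemma dsq1_line : forall z v s, is_derive (fun s => dsq1 (line z v s) v) s (2 * sq1 v).
Proof. line_derive. Qed.
Lemma dsq2_line : forall z v s, is_derive (fun s => dsq2 (line z v s) v) s (2 * sq2 v).
Proof. line_derive. Qed.
Lemma dcusp_re_line : forall z v s, is_derive (fun s => dcusp_re (line z v s) v) s (ddcusp_re (line z v s) v).
Proof. line_derive. Qed.
Lemma dcusp_im_line : forall z v s, is_derive (fun s => dcusp_im (line z v s) v) s (ddcusp_im (line z v s) v).
Proof. line_derive. Qed.
Lemma dre12_line : forall z v s, is_derive (fun s => dre12 (line z v s) v) s (2 * re12 v).
Proof. line_derive. Qed.
Lemma re3_line : forall z v s, is_derive (fun s => fst (c3 (line z v s))) s (fst (c3 v)).
Proof. line_derive. Qed.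
Lemma im3_line : forall z v s, is_derive (fun s => snd (c3 (line z v s))) s (snd (c3 v)).
Proof. line_derive. Qed.

Lemma is_derive_eq (f : R -> R) (s l l' : R) : is_derive f s l -> l = l' -> is_derive f s l'.
Proof. intros H <-. exact H. Qed.

Lemma comp_line (F : R -> R) (d : R) (f : R -> R) (s d' : R) :
  is_derive F (f s) d -> is_derive f s d' -> is_derive (fun s => F (f s)) s (d * d').
Proof.
  intros H1 H2. rewrite Rmult_comm. apply (is_derive_comp F f s d d'); assumption.
Qed.

Ltac rewrite_derives :=
  repeat match goal with
  | H : is_derive ?f ?s ?l |- context [Derive ?g ?s] =>
    let E := fresh in
    assert (E : Derive g s = l) by (apply is_derive_unique; exact H); rewrite E; clear E
  end.

(** Stated for arbitrary functions of [s], so that [auto_derive] treats the ingredients as atoms and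
    never expands them in coordinates. *)
Lemma defn_jet (m : nat) (T Q A B Y X Z L H : R -> R) (s T' Q' A' B' Y' X' Z' L' H' : R) :
  is_derive T s T' -> is_derive Q s Q' -> is_derive A s A' -> is_derive B s B' ->
  is_derive Y s Y' -> is_derive X s X' -> is_derive Z s Z' -> is_derive L s L' -> is_derive H s H' ->
  is_derive (fun s => (X s + 1 / 2) ^ 2 + Z s ^ 2 - 1 / 4 +
    (T s ^ m + (A s ^ 2 + B s ^ 2) * (1 + T s + Q s) + L s - Y s * H s)) s
  (2 * (X s + 1 / 2) * X' + 2 * Z s * Z' +
    (INR m * T s ^ pred m * T' + 2 * (A s * A' + B s * B') * (1 + T s + Q s) +
     (A s ^ 2 + B s ^ 2) * (T' + Q') + L' - Y' * H s - Y s * H')).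
Proof.
  intros H1 H2 H3 H4 H5 H6 H7 H8 H9.
  auto_derive.
  - repeat split; eexists; eassumption.
  - rewrite_derives. ring.
Qed.

Lemma ddefn_jet (m : nat) (T Q A B Y X Z L1 H H1 dT dQ dA dB dY : R -> R)
  (s x z T' Q' A' B' Y' X' Z' L1' H' H1' dT' dQ' dA' dB' dY' : R) :
  is_derive T s T' -> is_derive Q s Q' -> is_derive A s A' -> is_derive B s B' ->
  is_derive Y s Y' -> is_derive X s X' -> is_derive Z s Z' -> is_derive L1 s L1' ->
  is_derive H s H' -> is_derive H1 s H1' ->
  is_derive dT s dT' -> is_derive dQ s dQ' -> is_derive dA s dA' -> is_derive dB s dB' ->
  is_derive dY s dY' ->
  is_derive (fun s => 2 * (X s + 1 / 2) * x + 2 * Z s * z +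
    (INR m * T s ^ pred m * dT s + 2 * (A s * dA s + B s * dB s) * (1 + T s + Q s) +
     (A s ^ 2 + B s ^ 2) * (dT s + dQ s) + L1 s * dT s - dY s * H s - Y s * H1 s * dT s)) s
  (2 * X' * x + 2 * Z' * z +
   (INR m * (INR (pred m) * T s ^ pred (pred m) * T' * dT s + T s ^ pred m * dT') +
    2 * (A' * dA s + A s * dA' + B' * dB s + B s * dB') * (1 + T s + Q s) +
    2 * (A s * dA s + B s * dB s) * (T' + Q') +
    2 * (A s * A' + B s * B') * (dT s + dQ s) + (A s ^ 2 + B s ^ 2) * (dT' + dQ') +
    L1' * dT s + L1 s * dT' - dY' * H s - dY s * H' -
    (Y' * H1 s * dT s + Y s * H1' * dT s + Y s * H1 s * dT'))).
Proof.
  intros E1 E2 E3 E4 E5 E6 E7 E8 E9 E10 E11 E12 E13 E14 E15.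
  auto_derive.
  - repeat split; eexists; eassumption.
  - rewrite_derives. ring.
Qed.

Lemma defn_line (m : nat) (l l1 b b1 : R -> R) :
  (forall x, is_derive l x (l1 x)) -> (forall x, is_derive b x (b1 x)) ->
  forall z v s, is_derive (fun s => defn m l b (line z v s)) s (ddefn m l1 b b1 (line z v s) v).
Proof.
  intros Hl Hb z v s. unfold defn.
  eapply is_derive_eq.
  - apply (defn_jet m (fun s => sq1 (line z v s)) (fun s => sq2 (line z v s))
      (fun s => cusp_re (line z v s)) (fun s => cusp_im (line z v s)) (fun s => re12 (line z v s))
      (fun s => fst (c3 (line z v s))) (fun s => snd (c3 (line z v s)))
      (fun s => l (sq1 (line z v s))) (fun s => b (sq1 (line z v s)))).
    + apply sq1_line.
    + apply sq2_line.
    + apply cusp_re_line.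
    + apply cusp_im_line.
    + apply re12_line.
    + apply re3_line.
    + apply im3_line.
    + apply comp_line; [apply Hl|apply sq1_line].
    + apply comp_line; [apply Hb|apply sq1_line].
  - unfold ddefn. ring.
Qed.

Lemma ddefn_line (m : nat) (l1 l2 b b1 b2 : R -> R) :
  (forall x, is_derive l1 x (l2 x)) -> (forall x, is_derive b x (b1 x)) ->
  (forall x, is_derive b1 x (b2 x)) ->
  forall z v s, is_derive (fun s => ddefn m l1 b b1 (line z v s) v) s
    (dddefn m l1 l2 b b1 b2 (line z v s) v).
Proof.
  intros Hl Hb Hb1 z v s. unfold ddefn.
  eapply is_derive_eq.
  - apply (ddefn_jet m (fun s => sq1 (line z v s)) (fun s => sq2 (line z v s))
      (fun s => cusp_re (line z v s)) (fun s => cusp_im (line z v s)) (fun s => re12 (line z v s))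
      (fun s => fst (c3 (line z v s))) (fun s => snd (c3 (line z v s)))
      (fun s => l1 (sq1 (line z v s))) (fun s => b (sq1 (line z v s))) (fun s => b1 (sq1 (line z v s)))
      (fun s => dsq1 (line z v s) v) (fun s => dsq2 (line z v s) v)
      (fun s => dcusp_re (line z v s) v) (fun s => dcusp_im (line z v s) v)
      (fun s => dre12 (line z v s) v)).
    + apply sq1_line.
    + apply sq2_line.
    + apply cusp_re_line.
    + apply cusp_im_line.
    + apply re12_line.
    + apply re3_line.
    + apply im3_line.
    + apply comp_line; [apply Hl|apply sq1_line].
    + apply comp_line; [apply Hb|apply sq1_line].
    + apply comp_line; [apply Hb1|apply sq1_line].
    + apply dsq1_line.
    + apply dsq2_line.
    + apply dcusp_re_line.
    + apply dcusp_im_line.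
    + apply dre12_line.
  - unfold dddefn. ring.
Qed.

(** * Positivity of the Levi form *)

(** Dictionary: [s^2 = |z1|], [p = |z2|], [n1] and [n2] are [|v1|] and [|v2|], [f = |F|], and [f1],
    [g1], [g2] are the norms of the derivatives of [F], [z1 F], [z2 F] along [v]; [B1] and [B2] are
    [|(t b)'|] and [|(t b)''|], and [lam = l' + t l'']. The proof compares [|z2|^2] with [|z1|^3]:
    if they differ by a factor of at least 2, the squares absorb everything; otherwise the point is
    near the cusp and [lam] is needed. *)
Lemma levi_inequality (s p n1 n2 f f1 g1 g2 e lam B1 B2 : R) :
  0 <= s <= 1 -> 0 <= p -> p ^ 2 <= 3 -> 0 <= n1 -> 0 <= n2 -> 0 <= f -> 0 <= f1 ->
  0 <= g1 -> 0 <= g2 -> 0 <= B1 -> 0 <= B2 ->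
  p ^ 2 - s ^ 6 <= f -> s ^ 6 - p ^ 2 <= f ->
  2 * p * n2 <= f1 + 3 * s ^ 4 * n1 ->
  f * n1 <= g1 + s ^ 2 * f1 -> f * n2 <= g2 + p * f1 ->
  0 <= e <= s ^ 12 / 100 -> 4 * s * e <= lam -> B1 <= e -> s ^ 4 * B2 <= e ->
  s ^ 2 * p * B2 * n1 ^ 2 + B1 * n1 * n2 <= lam * n1 ^ 2 + f1 ^ 2 + g1 ^ 2 + g2 ^ 2.
Proof.
  intros Hs Hp Hp3 Hn1 Hn2 Hf Hf1 Hg1 Hg2 HB1 HB2 HF1 HF2 Hv HG1 HG2 He Hlam HE1 HE2.
  pose proof (pow2_ge_0 n1) as Qn1. pose proof (pow2_ge_0 n2) as Qn2.
  destruct (Req_dec s 0) as [->|Hs0].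
  { assert (He0 : e = 0) by lra. assert (B1 = 0) by lra. subst B1.
    pose proof (pow2_ge_0 f1). pose proof (pow2_ge_0 g1). pose proof (pow2_ge_0 g2). nra. }
  assert (Hs1 : 0 < s) by lra.
  set (X := s ^ 2 * B2). assert (HX0 : 0 <= X) by (unfold X; nra).
  assert (HX : s ^ 2 * X <= e) by (unfold X; replace (s ^ 2 * (s ^ 2 * B2)) with (s ^ 4 * B2) by ring; exact HE2).
  replace (s ^ 2 * p * B2) with (p * X) by (unfold X; ring).
  assert (Hs2 : 0 < s ^ 2) by (apply pow_lt; lra).
  assert (Hs3 : 0 < s ^ 3) by (apply pow_lt; lra).
  assert (HX10 : X <= s ^ 10 / 100).
  { apply Rmult_le_reg_l with (s ^ 2); [exact Hs2|]. replace (s ^ 2 * (s ^ 10 / 100)) with (s ^ 12 / 100) by field. lra. }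
  clearbody X.
  assert (Hlam0 : 0 <= lam) by nra.
  (* The three squares control all directions where [F] is nonzero. The 8 is the total coefficient
     [2 + 6] of [f1^2], from [s <= 1] and [p^2 <= 3]. *)
  assert (T : f ^ 2 * (n1 ^ 2 + n2 ^ 2) <= 8 * (f1 ^ 2 + g1 ^ 2 + g2 ^ 2)).
  { assert (T1 : (f * n1) ^ 2 <= 2 * g1 ^ 2 + 2 * f1 ^ 2).
    { assert (s ^ 2 <= 1) by nra. assert (f * n1 <= g1 + f1) by nra.
      assert (0 <= f * n1) by nra. assert ((f * n1) ^ 2 <= (g1 + f1) ^ 2) by (apply pow_incr; lra).
      pose proof (pow2_ge_0 (g1 - f1)). nra. }
    assert (T2 : (f * n2) ^ 2 <= 2 * g2 ^ 2 + 6 * f1 ^ 2).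
    { assert (0 <= f * n2) by nra. assert ((f * n2) ^ 2 <= (g2 + p * f1) ^ 2) by (apply pow_incr; lra).
      pose proof (pow2_ge_0 (g2 - p * f1)). pose proof (pow2_ge_0 f1).
      assert (p ^ 2 * f1 ^ 2 <= 3 * f1 ^ 2) by nra. nra. }
    pose proof (pow2_ge_0 f1). pose proof (pow2_ge_0 g1). pose proof (pow2_ge_0 g2). nra. }
  assert (Main : p * X + B1 / 2 <= f ^ 2 / 8 ->
    p * X * n1 ^ 2 + B1 * n1 * n2 <= lam * n1 ^ 2 + f1 ^ 2 + g1 ^ 2 + g2 ^ 2).
  { intros M. pose proof (pow2_ge_0 (n1 - n2)).
    assert (B1 * (2 * n1 * n2) <= B1 * (n1 ^ 2 + n2 ^ 2)) by nra.
    assert (0 <= p * X) by nra. assert (0 <= p * X * n2 ^ 2) by nra.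
    assert ((p * X + B1 / 2) * (n1 ^ 2 + n2 ^ 2) <= f ^ 2 / 8 * (n1 ^ 2 + n2 ^ 2)) by (apply Rmult_le_compat_r; lra).
    assert (0 <= lam * n1 ^ 2) by nra. nra. }
  assert (Hs12 : s ^ 12 = (s ^ 6) ^ 2) by ring.
  assert (Hs6 : 0 < s ^ 6) by (apply pow_lt; lra).
  destruct (Rle_dec (2 * s ^ 6) (p ^ 2)) as [C1'|C1'].
  - apply Main.
    assert (H1 : f >= p ^ 2 / 2) by lra.
    assert (H2 : (p ^ 2 / 2) ^ 2 <= f ^ 2) by (apply pow_incr; pose proof (pow2_ge_0 p); lra).
    assert (H3 : s ^ 3 <= p) by (apply le_of_sq_le; [exact Hp|]; replace ((s ^ 3) ^ 2) with (s ^ 6) by ring; lra).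
    assert (H4 : s ^ 10 <= p ^ 3).
    { apply Rle_trans with (s ^ 9); [apply pow_antitone; [lra|lia]|].
      replace (s ^ 9) with ((s ^ 3) ^ 3) by ring. apply pow_incr. lra. }
    assert (H5 : p * X <= p * (p ^ 3 / 100)) by (apply Rmult_le_compat_l; lra).
    assert (H6 : s ^ 12 <= (p ^ 2) ^ 2) by (rewrite Hs12; apply pow_incr; lra).
    nra.
  - destruct (Rle_dec (p ^ 2) (s ^ 6 / 2)) as [C2'|C2'].
    + apply Main.
      assert (H1 : f >= s ^ 6 / 2) by lra.
      assert (H2 : (s ^ 6 / 2) ^ 2 <= f ^ 2) by (apply pow_incr; lra).
      assert (H3 : p <= s ^ 3) by (apply le_of_sq_le; [lra|]; replace ((s ^ 3) ^ 2) with (s ^ 6) by ring; lra).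
      assert (H4 : p * X <= s ^ 3 * (s ^ 10 / 100)) by (apply Rmult_le_compat; lra).
      assert (H5 : s ^ 13 <= s ^ 12) by (apply pow_antitone; [lra|lia]).
      replace (s ^ 3 * (s ^ 10 / 100)) with (s ^ 13 / 100) in H4 by field.
      nra.
    (* Near the cusp [p] is comparable to [s^3], so [K2] bounds [n2] by a multiple of [s * n1] up to
       [f1]. The demands on [lam] add up to [3/2 + 15/7] plus a small remainder, in units of
       [s * e], and stay below 4. *)
    + assert (P1 : p <= 3 / 2 * s ^ 3).
      { apply le_of_sq_le; [lra|]. replace ((3 / 2 * s ^ 3) ^ 2) with (9 / 4 * s ^ 6) by field. lra. }
      assert (P2 : 7 / 10 * s ^ 3 <= p).
      { apply le_of_sq_le; [lra|]. replace ((7 / 10 * s ^ 3) ^ 2) with (49 / 100 * s ^ 6) by field. lra. }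
      assert (K1 : p * X * n1 ^ 2 <= 3 / 2 * (s * e) * n1 ^ 2).
      { apply Rmult_le_compat_r; [exact Qn1|].
        apply Rle_trans with (3 / 2 * s ^ 3 * X); [apply Rmult_le_compat_r; lra|].
        replace (3 / 2 * s ^ 3 * X) with (3 / 2 * s * (s ^ 2 * X)) by ring.
        replace (3 / 2 * (s * e)) with (3 / 2 * s * e) by ring. apply Rmult_le_compat_l; lra. }
      set (e' := e / s ^ 3). assert (Ee : e = e' * s ^ 3) by (unfold e'; field; lra).
      assert (He'0 : 0 <= e') by (apply Rdiv_le_0_compat; lra).
      assert (He' : e' <= s ^ 9 / 100).
      { apply Rmult_le_reg_r with (s ^ 3); [exact Hs3|]. rewrite <- Ee.
        replace (s ^ 9 / 100 * s ^ 3) with (s ^ 12 / 100) by field. lra. }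
      clearbody e'.
      assert (K2 : s ^ 3 * n2 <= 5 / 7 * (f1 + 3 * s ^ 4 * n1)).
      { assert (7 / 10 * s ^ 3 * n2 <= p * n2) by (apply Rmult_le_compat_r; lra). lra. }
      assert (K3 : B1 * n1 * n2 <= e' * n1 * (5 / 7 * (f1 + 3 * s ^ 4 * n1))).
      { apply Rle_trans with (e * (n1 * n2)).
        - rewrite Rmult_assoc. apply Rmult_le_compat_r; nra.
        - rewrite Ee. replace (e' * s ^ 3 * (n1 * n2)) with (e' * n1 * (s ^ 3 * n2)) by ring.
          apply Rmult_le_compat_l; nra. }
      assert (K4 : e' * n1 * f1 <= f1 ^ 2 + e' ^ 2 * n1 ^ 2).
      { pose proof (pow2_ge_0 (f1 - e' * n1)). 
        assert (0 <= e' * n1 * f1) by (apply Rmult_le_pos; [apply Rmult_le_pos|]; assumption). nra. }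
      assert (K5 : e' ^ 2 <= s * e / 100).
      { assert (s ^ 9 <= s ^ 4) by (apply pow_antitone; [lra|lia]).
        assert (e' * e' <= e' * (s ^ 4 / 100)) by (apply Rmult_le_compat_l; lra).
        rewrite Ee. nra. }
      assert (K6 : e' * n1 * (3 * s ^ 4 * n1) = 3 * (s * e) * n1 ^ 2) by (rewrite Ee; ring).
      assert (K7 : e' ^ 2 * n1 ^ 2 <= s * e / 100 * n1 ^ 2) by (apply Rmult_le_compat_r; lra).
      assert (K8 : 4 * (s * e) * n1 ^ 2 <= lam * n1 ^ 2) by (apply Rmult_le_compat_r; lra).
      assert (K9 : 0 <= s * e * n1 ^ 2) by (apply Rmult_le_pos; nra).
      pose proof (pow2_ge_0 f1). pose proof (pow2_ge_0 g1). pose proof (pow2_ge_0 g2). nra.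
Qed.

Definition cusp (z : C3) : C := (cusp_re z, cusp_im z).
Definition dcusp (z v : C3) : C := (dcusp_re z v, dcusp_im z v).

Lemma C_ext (a b : C) : fst a = fst b -> snd a = snd b -> a = b.
Proof. destruct a, b; simpl; intros; subst; reflexivity. Qed.

Lemma Cnorm_rscal (a b : R) (w : C) : 0 <= a -> fst w = a * b -> snd w = 0 -> Cnorm w = a * Rabs b.
Proof.
  intros Ha H1 H2. pose proof (Rabs_pos b).
  assert (0 <= a * Rabs b) by (apply Rmult_le_pos; lra).
  assert (E : Cnorm w ^ 2 = (a * Rabs b) ^ 2).
  { rewrite Cnorm_sq, H1, H2, !Rpow_mult_distr, pow2_abs. ring. }
  pose proof (Cnorm_nonneg w). apply Rle_antisym; apply le_of_sq_le; lra.
Qed.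

Lemma cusp_bounds (z : C3) :
  Cnorm (c2 z) ^ 2 - Cnorm (c1 z) ^ 3 <= Cnorm (cusp z) /\
  Cnorm (c1 z) ^ 3 - Cnorm (c2 z) ^ 2 <= Cnorm (cusp z).
Proof.
  set (A := Cmul (c2 z) (c2 z)). set (B := Cmul (c1 z) (Cmul (c1 z) (c1 z))).
  assert (EA : Cnorm A = Cnorm (c2 z) ^ 2) by (unfold A; rewrite Cnorm_mul; ring).
  assert (EB : Cnorm B = Cnorm (c1 z) ^ 3) by (unfold B; rewrite !Cnorm_mul; ring).
  assert (E1 : A = Cadd (cusp z) B).
  { apply C_ext; destruct z as [[[x1 y1] [x2 y2]] [x3 y3]]; unfold cusp, cusp_re, cusp_im; simpl; ring. }
  assert (E2 : B = Cadd A (Copp (cusp z))).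
  { apply C_ext; destruct z as [[[x1 y1] [x2 y2]] [x3 y3]]; unfold cusp, cusp_re, cusp_im; simpl; ring. }
  pose proof (Cnorm_triang (cusp z) B) as T1. rewrite <- E1 in T1.
  pose proof (Cnorm_triang A (Copp (cusp z))) as T2. rewrite <- E2, Cnorm_opp in T2.
  lra.
Qed.

Lemma dcusp_bound (z v : C3) :
  2 * Cnorm (c2 z) * Cnorm (c2 v) <= Cnorm (dcusp z v) + 3 * Cnorm (c1 z) ^ 2 * Cnorm (c1 v).
Proof.
  set (A := Cmul (2, 0) (Cmul (c2 z) (c2 v))).
  set (B := Cmul (3, 0) (Cmul (Cmul (c1 z) (c1 z)) (c1 v))).
  assert (EA : Cnorm A = 2 * Cnorm (c2 z) * Cnorm (c2 v)).
  { unfold A. rewrite !Cnorm_mul, (Cnorm_rscal 2 1), Rabs_R1 by (simpl; lra). ring. }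
  assert (EB : Cnorm B = 3 * Cnorm (c1 z) ^ 2 * Cnorm (c1 v)).
  { unfold B. rewrite !Cnorm_mul, (Cnorm_rscal 3 1), Rabs_R1 by (simpl; lra). ring. }
  assert (E1 : A = Cadd (dcusp z v) B).
  { apply C_ext; destruct z as [[[x1 y1] [x2 y2]] [x3 y3]], v as [[[a1 b1] [a2 b2]] [a3 b3]];
      unfold A, B, dcusp, dcusp_re, dcusp_im, Cmul, Cadd, c1, c2; simpl; ring. }
  pose proof (Cnorm_triang (dcusp z v) B) as T1. rewrite <- E1 in T1. lra.
Qed.

(** If [F1] and [w] are the derivatives of [F] and [a], then [a F1 + F w] is that of the product
    [a F]. *)
Lemma leibniz_bound (F F1 a w : C) :
  Cnorm F * Cnorm w <= Cnorm (Cadd (Cmul a F1) (Cmul F w)) + Cnorm a * Cnorm F1.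
Proof.
  rewrite <- !Cnorm_mul.
  replace (Cmul F w) with (Cadd (Cadd (Cmul a F1) (Cmul F w)) (Copp (Cmul a F1))) at 1.
  - eapply Rle_trans; [apply Cnorm_triang|]. rewrite Cnorm_opp. lra.
  - apply C_ext; simpl; ring.
Qed.

(* Four times the Levi form, as a sum of squares minus the contribution of [b]. *)
Lemma laplace_identity (m : nat) (l1 l2 b b1 b2 : R -> R) (z v : C3) :
  let t := sq1 z in
  let G1 := Cadd (Cmul (c1 z) (dcusp z v)) (Cmul (cusp z) (c1 v)) in
  let G2 := Cadd (Cmul (c2 z) (dcusp z v)) (Cmul (cusp z) (c2 v)) in
  dddefn m l1 l2 b b1 b2 z v + dddefn m l1 l2 b b1 b2 z (V3cscal Ci v) =
  4 * (Cnorm (c3 v) ^ 2 +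
    INR m * (t ^ pred m + INR (pred m) * (t ^ pred (pred m) * t)) * Cnorm (c1 v) ^ 2 +
    (Cnorm (dcusp z v) ^ 2 + Cnorm G1 ^ 2 + Cnorm G2 ^ 2) +
    (l1 t + t * l2 t) * Cnorm (c1 v) ^ 2 -
    (re12 z * (2 * b1 t + t * b2 t) * Cnorm (c1 v) ^ 2 + (b t + t * b1 t) * re12 v)).
Proof.
  intros t G1 G2. rewrite !Cnorm_sq. unfold dddefn. fold t.
  generalize (l1 t) (l2 t) (b t) (b1 t) (b2 t) (INR m) (INR (pred m)) (t ^ pred m) (t ^ pred (pred m)).
  intros L1 L2 B B1 B2 M1 M2 T1 T2.
  set (u := V3cscal Ci v).
  assert (U1 : fst (c1 u) = - snd (c1 v)) by (simpl; ring).
  assert (U2 : snd (c1 u) = fst (c1 v)) by (simpl; ring).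
  assert (U3 : fst (c2 u) = - snd (c2 v)) by (simpl; ring).
  assert (U4 : snd (c2 u) = fst (c2 v)) by (simpl; ring).
  assert (U5 : fst (c3 u) = - snd (c3 v)) by (simpl; ring).
  assert (U6 : snd (c3 u) = fst (c3 v)) by (simpl; ring).
  clearbody u.
  unfold G1, G2, t, cusp, dcusp, Cmul, Cadd. cbn [fst snd].
  (* [F] is holomorphic: passing from [v] to [i v] multiplies its first derivative by [i] and its
     second by [-1], so the second derivatives cancel in the sum. *)
  assert (D1 : dcusp_re z u = - dcusp_im z v) by (unfold dcusp_re, dcusp_im; rewrite U1, U2, U3, U4; ring).
  assert (D2 : dcusp_im z u = dcusp_re z v) by (unfold dcusp_re, dcusp_im; rewrite U1, U2, U3, U4; ring).
  assert (D3 : ddcusp_re z u = - ddcusp_re z v) by (unfold ddcusp_re; rewrite U1, U2, U3, U4; ring).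
  assert (D4 : ddcusp_im z u = - ddcusp_im z v) by (unfold ddcusp_im; rewrite U1, U2, U3, U4; ring).
  rewrite D1, D2, D3, D4.
  generalize (dcusp_re z v) (dcusp_im z v) (ddcusp_re z v) (ddcusp_im z v) (cusp_re z) (cusp_im z).
  intros F1 F2 DD1 DD2 A1 A2.
  unfold dsq1, dsq2, dre12, re12, sq1, sq2. rewrite U1, U2, U3, U4, U5, U6. ring.
Qed.

Lemma re12_bound (z : C3) : Rabs (re12 z) <= Cnorm (c1 z) * Cnorm (c2 z).
Proof.
  pose proof (Cnorm_nonneg (c1 z)). pose proof (Cnorm_nonneg (c2 z)).
  apply le_of_sq_le; [nra|]. rewrite pow2_abs, Rpow_mult_distr, !Cnorm_sq. unfold re12.
  pose proof (pow2_ge_0 (fst (c1 z) * snd (c2 z) - snd (c1 z) * fst (c2 z))). nra.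
Qed.

Lemma laplace_nonneg (m n : nat) (l b : nat -> R -> R) (z v : C3) :
  profile n l b -> sq1 z <= 1 -> sq2 z <= 3 ->
  0 <= dddefn m (l 1%nat) (l 2%nat) (b 0%nat) (b 1%nat) (b 2%nat) z v +
    dddefn m (l 1%nat) (l 2%nat) (b 0%nat) (b 1%nat) (b 2%nat) z (V3cscal Ci v).
Proof.
  intros Hp Ht Hq. rewrite laplace_identity. cbv zeta.
  pose proof (Cnorm_nonneg (c1 z)) as N1. pose proof (Cnorm_nonneg (c2 z)) as N2.
  pose proof (Cnorm_sq (c1 z)) as S1. pose proof (Cnorm_sq (c2 z)) as S2.
  fold (sq1 z) in S1. fold (sq2 z) in S2.
  set (s := sqrt (Cnorm (c1 z))).
  assert (Hs0 : 0 <= s) by apply sqrt_pos.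
  assert (Hs2 : s ^ 2 = Cnorm (c1 z)) by (unfold s; apply pow2_sqrt, N1).
  assert (Hs4 : s ^ 4 = sq1 z) by (rewrite <- S1, <- Hs2; ring).
  assert (Hs1 : s <= 1).
  { apply Rnot_lt_le. intros L. assert (1 < s ^ 4) by (apply Rlt_pow_R1; [exact L|lia]). lra. }
  destruct (profile_levi n l b Hp s (conj Hs0 Hs1)) as [e He]. cbv zeta in He. rewrite Hs4 in He.
  destruct He as [E0 [E1 [E2 [E3 E4]]]].
  set (t := sq1 z) in *. assert (Ht0 : 0 <= t) by (rewrite <- Hs4; apply pow_le, Hs0).
  destruct (cusp_bounds z) as [F1 F2].
  set (G1 := Cadd (Cmul (c1 z) (dcusp z v)) (Cmul (cusp z) (c1 v))).
  set (G2 := Cadd (Cmul (c2 z) (dcusp z v)) (Cmul (cusp z) (c2 v))).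
  pose proof (leibniz_bound (cusp z) (dcusp z v) (c1 z) (c1 v)) as L1. fold G1 in L1.
  pose proof (leibniz_bound (cusp z) (dcusp z v) (c2 z) (c2 v)) as L2. fold G2 in L2.
  pose proof (dcusp_bound z v) as L3.
  rewrite <- Hs2 in F1, F2, L1, L3.
  replace ((s ^ 2) ^ 3) with (s ^ 6) in F1, F2 by ring.
  replace ((s ^ 2) ^ 2) with (s ^ 4) in L3 by ring.
  set (B1 := b 0%nat t + t * b 1%nat t) in *. set (B2 := 2 * b 1%nat t + t * b 2%nat t) in *.
  rewrite <- Hs4 in E2.
  assert (K : s ^ 2 * Cnorm (c2 z) * Rabs B2 * Cnorm (c1 v) ^ 2 + Rabs B1 * Cnorm (c1 v) * Cnorm (c2 v)
    <= (l 1%nat t + t * l 2%nat t) * Cnorm (c1 v) ^ 2 +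
       Cnorm (dcusp z v) ^ 2 + Cnorm G1 ^ 2 + Cnorm G2 ^ 2).
  { apply (levi_inequality s (Cnorm (c2 z)) (Cnorm (c1 v)) (Cnorm (c2 v)) (Cnorm (cusp z)) _ _ _ e);
      try apply Cnorm_nonneg; try apply Rabs_pos; try assumption; try lra; split; lra. }
  assert (K1 : re12 z * B2 * Cnorm (c1 v) ^ 2 <= s ^ 2 * Cnorm (c2 z) * Rabs B2 * Cnorm (c1 v) ^ 2).
  { apply Rmult_le_compat_r; [apply pow2_ge_0|]. rewrite Hs2.
    apply Rle_trans with (1 := Rle_abs _). rewrite Rabs_mult.
    apply Rmult_le_compat_r; [apply Rabs_pos|apply re12_bound]. }
  assert (K2 : B1 * re12 v <= Rabs B1 * Cnorm (c1 v) * Cnorm (c2 v)).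
  { apply Rle_trans with (1 := Rle_abs _). rewrite Rabs_mult, Rmult_assoc.
    apply Rmult_le_compat_l; [apply Rabs_pos|apply re12_bound]. }
  assert (K3 : 0 <= INR m * (t ^ pred m + INR (pred m) * (t ^ pred (pred m) * t)) * Cnorm (c1 v) ^ 2).
  { apply Rmult_le_pos; [|apply pow2_ge_0]. apply Rmult_le_pos; [apply pos_INR|].
    apply Rplus_le_le_0_compat; [apply pow_le, Ht0|].
    apply Rmult_le_pos; [apply pos_INR|]. apply Rmult_le_pos; [apply pow_le|]; exact Ht0. }
  pose proof (pow2_ge_0 (Cnorm (c3 v))). lra.
Qed.

(** The term with [b] is at most [(t + q) / 200], too small to balance [|z1|^(2m)] and
    [|F|^2 (1 + t + q)] far out. If [|z1| > 1], either [|z2|^2 >= 2 |z1|^3] and [|F|] is large, or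
    [q <= 1 + t^3] and [t^m] wins. The weak inequality makes the bounds available on the boundary
    too. *)
Lemma defn_region (m n : nat) (l b : nat -> R -> R) (z : C3) :
  (4 <= m)%nat -> profile n l b -> defn m (l 0%nat) (b 0%nat) z <= 0 ->
  sq1 z <= 1 /\ sq2 z <= 3 /\
  (fst (c3 z) + 1 / 2) ^ 2 <= 1 /\ snd (c3 z) ^ 2 <= 1.
Proof.
  intros Hm Hp H. unfold defn in H.
  assert (EF : cusp_re z ^ 2 + cusp_im z ^ 2 = Cnorm (cusp z) ^ 2) by (rewrite Cnorm_sq; reflexivity).
  rewrite EF in H.
  destruct (cusp_bounds z) as [F1 F2].
  pose proof (Cnorm_nonneg (c1 z)) as N1. pose proof (Cnorm_nonneg (c2 z)) as N2.
  pose proof (Cnorm_nonneg (cusp z)) as N3.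
  pose proof (Cnorm_sq (c1 z)) as S1. pose proof (Cnorm_sq (c2 z)) as S2.
  fold (sq1 z) in S1. fold (sq2 z) in S2.
  pose proof (re12_bound z) as HR.
  pose proof (profile_b_small n l b Hp (sq1 z)) as HB.
  assert (HL : 0 <= l 0%nat (sq1 z)).
  { rewrite <- (profile_l_zero n l b Hp) at 1. apply (profile_l_mono n l b Hp). rewrite <- S1. nra. }
  set (r := Cnorm (c1 z)) in *. set (p := Cnorm (c2 z)) in *. set (f := Cnorm (cusp z)) in *.
  set (q := sq2 z) in *. set (t := sq1 z) in *.
  assert (HY : re12 z * b 0%nat t <= (t + q) / 200).
  { apply Rle_trans with (1 := Rle_abs _). rewrite Rabs_mult.
    apply Rle_trans with (r * p * (1 / 100)).
    - apply Rmult_le_compat; try apply Rabs_pos; assumption.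
    - pose proof (pow2_ge_0 (r - p)). nra. }
  pose proof (pow2_ge_0 (fst (c3 z) + 1 / 2)). pose proof (pow2_ge_0 (snd (c3 z))).
  assert (Ht0 : 0 <= t) by (rewrite <- S1; apply pow2_ge_0).
  assert (Hq0 : 0 <= q) by (rewrite <- S2; apply pow2_ge_0).
  assert (Htm : 0 <= t ^ m) by (apply pow_le, Ht0).
  assert (Hf2 : 0 <= f ^ 2) by apply pow2_ge_0.
  assert (Main : t ^ m + f ^ 2 * (1 + t + q) <= 1 / 4 + (t + q) / 200) by lra.
  assert (Hfq : f ^ 2 * q <= f ^ 2 * (1 + t + q)) by nra.
  assert (Ht1 : t <= 1).
  { apply Rnot_lt_le. intros L.
    assert (L4 : t ^ 4 <= t ^ m) by (apply Rle_pow; [lra|exact Hm]).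
    assert (L3 : t <= t ^ 3 <= t ^ 4) by (split; [rewrite <- (pow_1 t) at 1|]; apply Rle_pow; lra || lia).
    assert (L6 : (r ^ 3) ^ 2 = t ^ 3) by (rewrite <- S1; ring).
    assert (Lr : 0 <= r ^ 3) by (apply pow_le, N1).
    destruct (Rle_dec (2 * r ^ 3) q) as [Q|Q].
    - assert (f >= q / 2) by lra.
      assert (r ^ 3 >= 1) by (apply Rle_ge, pow_R1_Rle; nra).
      assert ((q / 2) ^ 2 <= f ^ 2) by (apply pow_incr; lra).
      assert (1 <= f ^ 2) by nra. assert (q <= f ^ 2 * q) by nra. lra.
    - assert (q <= 1 + t ^ 3) by (pose proof (pow2_ge_0 (r ^ 3 - 1)); nra).
      assert (0 <= f ^ 2 * q) by nra. lra. }
  assert (Hr1 : r ^ 3 <= 1).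
  { apply (pow_antitone r 0); [|lia]. split; [exact N1|nra]. }
  assert (Hq3 : q <= 3).
  { apply Rnot_lt_le. intros L. assert (f >= 2) by lra.
    assert (2 ^ 2 <= f ^ 2) by (apply pow_incr; lra). assert (4 * q <= f ^ 2 * q) by nra. lra. }
  assert (0 <= f ^ 2 * (1 + t + q)) by nra.
  repeat split; lra.
Qed.

(** * Subharmonicity *)

(** [Q] is a filter base, and [X] is the limit superior of [f] along it. Filter bases replace
    sequences, so no points have to be chosen. *)
Lemma cluster_value {V J : Type} (Q : J -> V -> Prop) (f : V -> R) (M : R) :
  (forall i j, exists k, forall p, Q k p -> Q i p /\ Q j p) ->
  (exists i : J, True) -> (forall i, exists p, Q i p) ->
  (forall i p, Q i p -> Rabs (f p) <= M) ->
  exists X, forall i e, 0 < e -> exists p, Q i p /\ Rabs (f p - X) < e.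
Proof.
  intros Hdir [i0 _] Hne HM.
  destruct (completeness (fun x => forall i, exists p, Q i p /\ x <= f p)) as [X [HX1 HX2]].
  - exists M. intros x Hx. destruct (Hx i0) as [p [Hp Hxp]].
    specialize (HM i0 p Hp). apply Rabs_le_between in HM. lra.
  - exists (- M). intros i. destruct (Hne i) as [p Hp]. exists p. split; [exact Hp|].
    specialize (HM i p Hp). apply Rabs_le_between in HM. lra.
  - exists X. intros i e He.
    assert (A : exists x, (forall j, exists p, Q j p /\ x <= f p) /\ X - e < x).
    { apply NNPP. intros N.
      assert (X <= X - e); [|lra]. apply HX2. intros x Hx. apply Rnot_lt_le. intros L.
      apply N. exists x. split; assumption. }
    destruct A as [x [Hx HxX]].
    assert (B : exists j, forall p, Q j p -> f p < X + e).
    { apply NNPP. intros N. assert (X + e / 2 <= X); [|lra]. apply HX1. intros j.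
      apply NNPP. intros N'. apply N. exists j. intros p Hp. apply Rnot_le_lt. intros L.
      apply N'. exists p. split; [exact Hp|lra]. }
    destruct B as [j Hj]. destruct (Hdir i j) as [k Hk]. destruct (Hx k) as [p [Hp Hxp]].
    exists p. destruct (Hk p Hp) as [Hi Hpj]. split; [exact Hi|].
    specialize (Hj p Hpj). apply Rabs_def1; lra.
Qed.

Lemma compact_max (K : C -> Prop) (G : C -> R) :
  is_compact Cdist C0 K -> cont_on Cdist K G -> (exists p, K p) ->
  exists p, K p /\ forall q, K q -> G q <= G p.
Proof.
  intros [Hcl [M HM]] HG [p0 Hp0].
  (* Superlevel sets of [G], directed because their levels are totally ordered. A cluster point of
     this family is a maximum point. *)
  set (Q := fun (q : {q | K q}) (p : C) => K p /\ G (proj1_sig q) <= G p).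
  assert (Hb : forall p, K p -> Rabs (fst p) <= M /\ Rabs (snd p) <= M).
  { intros p Hp. specialize (HM p Hp).
    assert (Hn : Cnorm (Cadd p (Copp C0)) <= M) by exact HM.
    pose proof (Cnorm_sq (Cadd p (Copp C0))) as S. pose proof (Cnorm_nonneg (Cadd p (Copp C0))).
    simpl in S. rewrite !Ropp_0, !Rplus_0_r, !Rmult_1_r in S.
    split; apply le_of_sq_le; try lra; rewrite pow2_abs; nra. }
  assert (Hdir : forall i j, exists k, forall p, Q k p -> Q i p /\ Q j p).
  { intros [i Hi] [j Hj]. destruct (Rle_dec (G i) (G j)) as [L|L].
    - exists (exist _ j Hj). intros p [P1 P2]. unfold Q; simpl in *. repeat split; auto; lra.
    - exists (exist _ i Hi). intros p [P1 P2]. unfold Q; simpl in *. repeat split; auto; lra. }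
  destruct (cluster_value Q fst M Hdir) as [X HX].
  { exists (exist _ p0 Hp0); exact I. }
  { intros [q Hq]. exists q. split; simpl; [exact Hq|lra]. }
  { intros i p [Hp _]. apply Hb, Hp. }
  (* Restricting to points whose first coordinate is near [X] makes a cluster value of the second
     coordinate complete a cluster point in the plane. *)
  set (Q' := fun (ie : {q | K q} * posreal) (p : C) => Q (fst ie) p /\ Rabs (fst p - X) < snd ie).
  destruct (cluster_value Q' snd M) as [Y HY].
  { intros [i e] [j d]. destruct (Hdir i j) as [k Hk].
    exists (k, mkposreal (Rmin e d) (Rmin_pos _ _ (cond_pos e) (cond_pos d))).
    intros p [P1 P2]; simpl in P1, P2. destruct (Hk p P1) as [Pi Pj].
    pose proof (Rmin_l e d). pose proof (Rmin_r e d).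
    unfold Q'; simpl. repeat split; try apply Pi; try apply Pj; lra. }
  { exists (exist _ p0 Hp0, mkposreal 1 Rlt_0_1); exact I. }
  { intros [i e]. destruct (HX i e (cond_pos e)) as [p Hp]. exists p. exact Hp. }
  { intros i p [[Hp _] _]. apply Hb, Hp. }
  assert (Near : forall q (Hq : K q) e, 0 < e -> exists p, K p /\ G q <= G p /\ Cdist (X, Y) p < e).
  { intros q Hq e He.
    destruct (HY (exist _ q Hq, mkposreal (e / 2) ltac:(lra)) (e / 2) ltac:(lra)) as [p [[[P1 P2] P3] P4]].
    simpl in *. exists p. repeat split; auto.
    unfold Cdist. apply Rle_lt_trans with (Rabs (fst p - X) + Rabs (snd p - Y)); [|lra].
    pose proof (Rabs_pos (fst p - X)). pose proof (Rabs_pos (snd p - Y)).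
    apply le_of_sq_le; [lra|]. rewrite Cnorm_sq; simpl fst; simpl snd.
    pose proof (pow2_abs (fst p - X)). pose proof (pow2_abs (snd p - Y)). nra. }
  assert (Kc : K (X, Y)).
  { apply Hcl. intros e He. destruct (Near p0 Hp0 e He) as [p [P1 [_ P3]]]. exists p. auto. }
  exists (X, Y). split; [exact Kc|]. intros q Hq. apply Rnot_lt_le. intros L.
  destruct (HG (X, Y) Kc (G q - G (X, Y)) ltac:(lra)) as [d [Hd Hc]].
  destruct (Near q Hq d Hd) as [p [P1 [P2 P3]]].
  specialize (Hc p P1 P3). apply Rabs_def2 in Hc. lra.
Qed.

Lemma second_derivative_max (f g : R -> R) (a d : R) : 0 < d ->
  (forall s, Rabs s < d -> is_derive f s (g s)) -> is_derive g 0 a ->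
  (forall s, Rabs s < d -> f s <= f 0) -> a <= 0.
Proof.
  intros Hd Hf Hg Hmax. apply Rnot_lt_le. intros Ha.
  apply is_derive_Reals in Hg. destruct (Hg (a / 2) ltac:(lra)) as [[d' Hd'] H]. simpl in H.
  assert (Hquot : forall s, s <> 0 -> Rabs s < d' -> a / 2 < (g s - g 0) / s).
  { intros s Hs Hs'. specialize (H s Hs Hs'). rewrite Rplus_0_l in H. apply Rabs_def2 in H. lra. }
  set (e := Rmin d d' / 2).
  assert (He : 0 < e /\ e < d /\ e < d').
  { pose proof (Rmin_l d d'). pose proof (Rmin_r d d'). assert (0 < Rmin d d') by (apply Rmin_pos; assumption).
    unfold e. lra. }
  assert (Hmul : forall s, s <> 0 -> (g s - g 0) / s * s = g s - g 0) by (intros; field; assumption).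
  (* If [a > 0], then [g] is positive just right of 0 when [g 0 >= 0], and negative just left of 0
     otherwise; in either case [f] exceeds [f 0] nearby. *)
  destruct (Rle_dec 0 (g 0)) as [G0|G0].
  - destruct (MVT_cor2 f g 0 e) as [c [E Hc]]; [lra| |].
    { intros c Hc. apply is_derive_Reals, Hf. rewrite Rabs_right; lra. }
    assert (f e <= f 0) by (apply Hmax; rewrite Rabs_right; lra).
    pose proof (Hquot c ltac:(lra) ltac:(rewrite Rabs_right; lra)) as Q1.
    apply (Rmult_lt_compat_r c) in Q1; [|lra]. rewrite (Hmul c) in Q1 by lra.
    assert (0 < a / 2 * c) by (apply Rmult_lt_0_compat; lra).
    assert (0 < g c * (e - 0)) by (apply Rmult_lt_0_compat; lra). lra.
  - destruct (MVT_cor2 f g (- e) 0) as [c [E Hc]]; [lra| |].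
    { intros c Hc. apply is_derive_Reals, Hf. rewrite Rabs_left1; lra. }
    assert (f (- e) <= f 0) by (apply Hmax; rewrite Rabs_left; lra).
    pose proof (Hquot c ltac:(lra) ltac:(rewrite Rabs_left; lra)) as Q1.
    apply (Rmult_lt_compat_r (- c)) in Q1; [|lra].
    rewrite !Ropp_mult_distr_r_reverse, (Hmul c) in Q1 by lra.
    assert (0 < a / 2 * - c) by (apply Rmult_lt_0_compat; lra).
    assert (0 < - g c * (0 - - e)) by (apply Rmult_lt_0_compat; lra). lra.
Qed.

(** Convexity of [-1/x] on the negative half-line. *)
Lemma inv_support (x x0 : R) : x < 0 -> x0 < 0 -> - / x0 + (x - x0) / x0 ^ 2 <= - / x.
Proof.
  intros H H0. apply Rminus_le_0.
  replace (- / x - (- / x0 + (x - x0) / x0 ^ 2)) with ((x - x0) ^ 2 / (x0 ^ 2 * - x)) by (field; lra).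
  apply Rdiv_le_0_compat; [apply pow2_ge_0|]. apply Rmult_lt_0_compat; nra.
Qed.

Lemma derive_shift (F : R -> R) (s l : R) :
  derivable_pt_lim (fun t => F (s + t)) 0 l -> is_derive F s l.
Proof.
  intros H. apply is_derive_Reals. intros e He. destruct (H e He) as [d Hd].
  exists d. intros h Hh Hhd. specialize (Hd h Hh Hhd). rewrite Rplus_0_l, Rplus_0_r in Hd. exact Hd.
Qed.

(* At an interior maximum of [u - h + ep |z|^2] the tangent of [x |-> -1/x] replaces [u = -1/phi]
   by a multiple of [phi], so that only the Laplacian of [phi] is needed. *)
Lemma subharmonic_neg_inv (Om : C -> Prop) (phi : C -> R) :
  (forall z, Om z -> phi z < 0) -> cont_on Cdist Om (fun z => - / phi z) ->
  (forall z, Om z -> exists gx gy ax ay,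
    (forall s, is_derive (fun s => phi (Cadd z (Crscal s C1))) s (gx s)) /\ is_derive gx 0 ax /\
    (forall s, is_derive (fun s => phi (Cadd z (Crscal s Ci))) s (gy s)) /\ is_derive gy 0 ay /\
    0 <= ax + ay) ->
  subharmonic Om (fun z => - / phi z).
Proof.
  intros Hneg Hcont Hlap. split; [exact Hcont|].
  intros K h HK HKO Hh Hharm Hbd z0 Hz0. apply Rnot_lt_le. intros Hlt.
  destruct HK as [Hcl [M HM]].
  set (eta := - / phi z0 - h z0). assert (Heta : 0 < eta) by (unfold eta; lra).
  (* On [K] the perturbation [ep |z|^2] stays below [eta], so the maximum cannot lie at a point of
     [K] outside the interior. *)
  set (ep := eta / (2 * (M ^ 2 + 1))).
  assert (HM2 : 0 <= M ^ 2) by apply pow2_ge_0.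
  assert (Hep : 0 < ep) by (apply Rdiv_lt_0_compat; lra).
  assert (HepM : ep * M ^ 2 < eta).
  { assert (ep * (2 * (M ^ 2 + 1)) = eta) by (unfold ep; field; lra). nra. }
  set (N := fun z : C => fst z * fst z + snd z * snd z).
  set (G := fun z : C => - / phi z + (- 1 * h z + ep * N z)).
  assert (HN : forall z, K z -> N z <= M ^ 2).
  { intros z Hz. specialize (HM z Hz).
    assert (Hn : Cnorm (Cadd z (Copp C0)) <= M) by exact HM.
    pose proof (Cnorm_sq (Cadd z (Copp C0))) as S. pose proof (Cnorm_nonneg (Cadd z (Copp C0))).
    simpl in S. rewrite !Ropp_0, !Rplus_0_r, !Rmult_1_r in S. unfold N.
    assert (Cnorm (Cadd z (Copp C0)) * Cnorm (Cadd z (Copp C0)) <= M * M) by (apply Rmult_le_compat; lra).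
    simpl. lra. }
  assert (HN0 : forall z, 0 <= N z) by (intros z; unfold N; nra).
  assert (Cf : cont_on Cdist K fst).
  { intros x _ e He. exists e. split; [exact He|]. intros y _ Hy.
    eapply Rle_lt_trans; [|exact Hy]. apply le_of_sq_le; [apply Cnorm_nonneg|].
    rewrite pow2_abs. unfold Cdist. rewrite Cnorm_sq. simpl fst; simpl snd.
    pose proof (pow2_ge_0 (fst x + - fst y)). pose proof (pow2_ge_0 (snd x + - snd y)). nra. }
  assert (Cs : cont_on Cdist K snd).
  { intros x _ e He. exists e. split; [exact He|]. intros y _ Hy.
    eapply Rle_lt_trans; [|exact Hy]. apply le_of_sq_le; [apply Cnorm_nonneg|].
    rewrite pow2_abs. unfold Cdist. rewrite Cnorm_sq. simpl fst; simpl snd.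
    pose proof (pow2_ge_0 (fst x + - fst y)). pose proof (pow2_ge_0 (snd x + - snd y)). nra. }
  assert (CG : cont_on Cdist K G).
  { unfold G, N. apply cont_on_plus; [|apply cont_on_plus].
    - intros x Hx e He. destruct (Hcont x (HKO x Hx) e He) as [d [Hd H]].
      exists d. split; [exact Hd|]. intros y Hy. apply H, HKO, Hy.
    - apply (cont_on_mult Cdist K (fun _ => -1)); [apply cont_on_const|exact Hh].
    - apply (cont_on_mult Cdist K (fun _ => ep)); [apply cont_on_const|].
      apply cont_on_plus; apply cont_on_mult; assumption. }
  destruct (compact_max K G (conj Hcl (ex_intro _ M HM)) CG (ex_intro _ z0 Hz0)) as [p [Hp Hmax]].
  assert (Hint : interior Cdist K p).
  { apply NNPP. intros Hn. specialize (Hbd p Hp Hn). specialize (Hmax z0 Hz0).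
    specialize (HN p Hp). specialize (HN0 z0). unfold G in Hmax.
    assert (ep * N p <= ep * M ^ 2) by (apply Rmult_le_compat_l; lra).
    assert (0 <= ep * N z0) by nra. unfold eta in *. lra. }
  destruct Hharm as [_ [hx [hy [Hd1 Hd2]]]].
  destruct (Hd2 p Hint) as [a [b [Ha [Hb Hab]]]].
  destruct (Hlap p (HKO p Hp)) as [gx [gy [ax [ay [X1 [X2 [Y1 [Y2 Hxy]]]]]]]].
  destruct Hint as [d [Hd Hball]].
  pose proof (Hneg p (HKO p Hp)) as Hp0.
  set (c0 := / phi p ^ 2).
  assert (Hc0 : 0 < c0) by (apply Rinv_0_lt_compat; nra).
  assert (Hloc : forall z, K z -> c0 * phi z - h z + ep * N z <= c0 * phi p - h p + ep * N p).
  { intros z Hz. specialize (Hmax z Hz). unfold G in Hmax.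
    pose proof (inv_support (phi z) (phi p) (Hneg z (HKO z Hz)) Hp0) as S.
    unfold Rdiv in S. fold c0 in S. nra. }
  assert (Hint' : forall z, Cdist p z < d -> interior Cdist K z).
  { intros z Hz. exists (d - Cdist p z). split; [lra|]. intros y Hy. apply Hball.
    replace (Cdist p y) with (Cnorm (Cadd (Cadd p (Copp z)) (Cadd z (Copp y)))).
    - eapply Rle_lt_trans; [apply Cnorm_triang|]. unfold Cdist in *. lra.
    - unfold Cdist. f_equal. apply C_ext; simpl; ring. }
  assert (Dx : forall s, Cdist p (Cadd p (Crscal s C1)) = Rabs s).
  { intros s. unfold Cdist, Cnorm. simpl. rewrite <- sqrt_Rsqr_abs. f_equal. unfold Rsqr. ring. }
  assert (Dy : forall s, Cdist p (Cadd p (Crscal s Ci)) = Rabs s).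
  { intros s. unfold Cdist, Cnorm. simpl. rewrite <- sqrt_Rsqr_abs. f_equal. unfold Rsqr. ring. }
  assert (Hx : c0 * ax - a + 2 * ep <= 0).
  { apply (second_derivative_max
      (fun s => c0 * phi (Cadd p (Crscal s C1)) - h (Cadd p (Crscal s C1)) + ep * N (Cadd p (Crscal s C1)))
      (fun s => c0 * gx s - hx (Cadd p (Crscal s C1)) + ep * (2 * (fst p + s))) _ d Hd).
    - intros s Hs.
      assert (Hh' : is_derive (fun s => h (Cadd p (Crscal s C1))) s (hx (Cadd p (Crscal s C1)))).
      { apply derive_shift.
        replace (fun t => h (Cadd p (Crscal (s + t) C1))) with
          (fun t => h (Cadd (Cadd p (Crscal s C1)) (Crscal t C1))).
        - apply (Hd1 (Cadd p (Crscal s C1))). apply Hint'. rewrite Dx. exact Hs.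
        - apply FunctionalExtensionality.functional_extensionality. intros t. f_equal.
          apply C_ext; simpl; ring. }
      apply (is_derive_plus (fun s => c0 * phi (Cadd p (Crscal s C1)) - h (Cadd p (Crscal s C1)))).
      + apply (is_derive_minus (fun s => c0 * phi (Cadd p (Crscal s C1)))); [|exact Hh'].
        apply (is_derive_scal (fun s => phi (Cadd p (Crscal s C1)))). apply X1.
      + unfold N. simpl. auto_derive; [exact I|]. ring.
    - apply (is_derive_plus (fun s => c0 * gx s - hx (Cadd p (Crscal s C1)))).
      + apply (is_derive_minus (fun s => c0 * gx s)); [apply (is_derive_scal gx), X2|].
        apply is_derive_Reals, Ha.
      + auto_derive; [exact I|ring].
    - intros s Hs. replace (Cadd p (Crscal 0 C1)) with p by (apply C_ext; simpl; ring).
      apply Hloc, Hball. rewrite Dx. exact Hs. }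
  assert (Hy : c0 * ay - b + 2 * ep <= 0).
  { apply (second_derivative_max
      (fun s => c0 * phi (Cadd p (Crscal s Ci)) - h (Cadd p (Crscal s Ci)) + ep * N (Cadd p (Crscal s Ci)))
      (fun s => c0 * gy s - hy (Cadd p (Crscal s Ci)) + ep * (2 * (snd p + s))) _ d Hd).
    - intros s Hs.
      assert (Hh' : is_derive (fun s => h (Cadd p (Crscal s Ci))) s (hy (Cadd p (Crscal s Ci)))).
      { apply derive_shift.
        replace (fun t => h (Cadd p (Crscal (s + t) Ci))) with
          (fun t => h (Cadd (Cadd p (Crscal s Ci)) (Crscal t Ci))).
        - apply (Hd1 (Cadd p (Crscal s Ci))). apply Hint'. rewrite Dy. exact Hs.
        - apply FunctionalExtensionality.functional_extensionality. intros t. f_equal.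
          apply C_ext; simpl; ring. }
      apply (is_derive_plus (fun s => c0 * phi (Cadd p (Crscal s Ci)) - h (Cadd p (Crscal s Ci)))).
      + apply (is_derive_minus (fun s => c0 * phi (Cadd p (Crscal s Ci)))); [|exact Hh'].
        apply (is_derive_scal (fun s => phi (Cadd p (Crscal s Ci)))). apply Y1.
      + unfold N. simpl. auto_derive; [exact I|]. ring.
    - apply (is_derive_plus (fun s => c0 * gy s - hy (Cadd p (Crscal s Ci)))).
      + apply (is_derive_minus (fun s => c0 * gy s)); [apply (is_derive_scal gy), Y2|].
        apply is_derive_Reals, Hb.
      + auto_derive; [exact I|ring].
    - intros s Hs. replace (Cadd p (Crscal 0 Ci)) with p by (apply C_ext; simpl; ring).
      apply Hloc, Hball. rewrite Dy. exact Hs. }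
  (* The sum of the two inequalities is [c0 (ax + ay) - (a + b) + 4 ep <= 0], while [ax + ay >= 0],
     [a + b = 0] and [ep > 0]. *)
  nra.
Qed.

(** * The domain *)

Lemma smooth3_defn (k n m : nat) (l b : nat -> R -> R) : (k < n)%nat -> profile n l b ->
  smooth3 k (defn m (l 0%nat) (b 0%nat)).
Proof.
  intros Hk Hp.
  pose proof (smooth3_coord k 0 ltac:(lia)) as X1. pose proof (smooth3_coord k 1 ltac:(lia)) as Y1.
  pose proof (smooth3_coord k 2 ltac:(lia)) as X2. pose proof (smooth3_coord k 3 ltac:(lia)) as Y2.
  pose proof (smooth3_coord k 4 ltac:(lia)) as X3. pose proof (smooth3_coord k 5 ltac:(lia)) as Y3.
  cbn [nth coords] in X1, Y1, X2, Y2, X3, Y3.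
  pose proof (smooth3_const k) as Cst.
  assert (T : smooth3 k sq1) by (apply smooth3_plus; apply smooth3_pow; assumption).
  assert (Q : smooth3 k sq2) by (apply smooth3_plus; apply smooth3_pow; assumption).
  assert (A : smooth3 k cusp_re).
  { unfold cusp_re. repeat (first [apply smooth3_minus | apply smooth3_mult | apply smooth3_pow | assumption | apply Cst]). }
  assert (B : smooth3 k cusp_im).
  { unfold cusp_im. repeat (first [apply smooth3_minus | apply smooth3_mult | apply smooth3_pow | assumption | apply Cst]). }
  assert (Y : smooth3 k re12) by (apply smooth3_plus; apply smooth3_mult; assumption).
  assert (L : smooth3 k (fun z => l 0%nat (sq1 z))).
  { apply (smooth3_comp k 0 n l); [apply Hp|lia|exact T]. }
  assert (H : smooth3 k (fun z => b 0%nat (sq1 z))).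
  { apply (smooth3_comp k 0 n b); [apply Hp|lia|exact T]. }
  unfold defn.
  repeat (first [assumption | apply Cst | apply smooth3_minus | apply smooth3_plus | apply smooth3_mult | apply smooth3_pow]).
Qed.

Lemma line_zero (z v : C3) : line z v 0 = z.
Proof. apply V3add_zero. Qed.

Lemma cont3_neg_open (f : C3 -> R) (z : C3) (a : R) : cont3 f -> f z < a ->
  exists d, d > 0 /\ forall y, V3dist z y < d -> f y < a.
Proof.
  intros Hf Hz. destruct (Hf z I (a - f z) ltac:(lra)) as [d [Hd H]].
  exists d. split; [exact Hd|]. intros y Hy. specialize (H y I Hy). apply Rabs_def2 in H. lra.
Qed.

Lemma cont3_pos_open (f : C3 -> R) (z : C3) (a : R) : cont3 f -> a < f z ->
  exists d, d > 0 /\ forall y, V3dist z y < d -> a < f y.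
Proof.
  intros Hf Hz. destruct (Hf z I (f z - a) ltac:(lra)) as [d [Hd H]].
  exists d. split; [exact Hd|]. intros y Hy. specialize (H y I Hy). apply Rabs_def2 in H. lra.
Qed.

Lemma bdry_sublevel (f : C3 -> R) (z : C3) : cont3 f -> bdry V3dist (fun z => f z < 0) z -> f z = 0.
Proof.
  intros Hf [H1 H2]. destruct (Rtotal_order (f z) 0) as [L|[E|L]]; [|exact E|].
  - exfalso. apply H2. destruct (cont3_neg_open f z 0 Hf L) as [d [Hd H]]. exists d. auto.
  - exfalso. destruct (cont3_pos_open f z 0 Hf L) as [d [Hd H]].
    destruct (H1 d Hd) as [y [Y1 Y2]]. specialize (H y Y2). lra.
Qed.

(** * Connectedness by a weighted contraction *)

Lemma connected_of_paths (D : C3 -> Prop) (z0 : C3) : D z0 ->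
  (forall z, D z -> exists g : R -> C3, g 0 = z0 /\ g 1 = z /\
    (forall c, 0 <= c <= 1 -> D (g c)) /\
    (forall c e, 0 < e -> exists d, 0 < d /\ forall c', Rabs (c' - c) < d -> V3dist (g c) (g c') < e)) ->
  is_connected V3dist D.
Proof.
  intros Hz0 Hpath.
  assert (Half : forall A B : C3 -> Prop, is_open V3dist A -> is_open V3dist B ->
    (forall x, D x -> A x \/ B x) -> (forall x, D x -> A x -> B x -> False) -> A z0 ->
    forall x, D x -> A x).
  { intros A B HA HB Hcov Hdis HAz x Hx. apply NNPP. intros HnA.
    destruct (Hpath x Hx) as [g [G0 [G1 [GD Gc]]]].
    destruct (completeness (fun c => 0 <= c <= 1 /\ A (g c))) as [s [S1 S2]].
    { exists 1. intros c [Hc _]. lra. }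
    { exists 0. split; [lra|]. rewrite G0. exact HAz. }
    assert (Hs : 0 <= s <= 1).
    { split; [apply S1; split; [lra|rewrite G0; exact HAz]|]. apply S2. intros c [Hc _]. lra. }
    destruct (Hcov (g s) (GD s Hs)) as [Ha|Hb].
    - destruct (HA _ Ha) as [e [He Hball]]. destruct (Gc s e He) as [d [Hd Hcd]].
      assert (Hs1 : s <> 1) by (intros ->; rewrite G1 in Ha; auto).
      set (c := Rmin 1 (s + d / 2)).
      assert (Hc : s < c <= 1 /\ c <= s + d / 2).
      { unfold c. repeat split; [|apply Rmin_l|apply Rmin_r]. apply Rmin_glb_lt; lra. }
      assert (c <= s); [|lra]. apply S1. split; [lra|]. apply Hball, Hcd. rewrite Rabs_right; lra.
    - destruct (HB _ Hb) as [e [He Hball]]. destruct (Gc s e He) as [d [Hd Hcd]].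
      assert (s <= s - d / 2); [|lra]. apply S2. intros c [Hc Hca]. apply Rnot_lt_le. intros L.
      assert (c <= s) by (apply S1; split; assumption).
      apply (Hdis (g c) (GD c Hc) Hca). apply Hball, Hcd. rewrite Rabs_left1; lra. }
  intros A B HA HB Hcov Hdis. destruct (Hcov z0 Hz0) as [Ha|Hb].
  - left. apply (Half A B); assumption.
  - right. apply (Half B A); try assumption.
    + intros x Hx. destruct (Hcov x Hx); auto.
    + intros x Hx H1 H2. apply (Hdis x Hx H2 H1).
Qed.

Definition base_point : C3 := V3 C0 C0 (- (1 / 2), 0).

(** The weights 2 and 3 make [F] homogeneous of degree 6; weight 2 on [w + 1/2] makes [|w + 1/2|^2]
    scale by [c^4], just as [|z1|^2] does. *)
Definition contraction (z : C3) (c : R) : C3 :=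
  V3 (Crscal (c ^ 2) (c1 z)) (Crscal (c ^ 3) (c2 z))
     (- (1 / 2) + c ^ 2 * (fst (c3 z) + 1 / 2), c ^ 2 * snd (c3 z)).

Lemma contraction_continuous (z : C3) (c e : R) : 0 < e -> exists d, 0 < d /\
  forall c', Rabs (c' - c) < d -> V3dist (contraction z c) (contraction z c') < e.
Proof.
  intros He.
  assert (H : forall i, exists d, 0 < d /\ forall c', Rabs (c' - c) < d -> (i < 6)%nat ->
    Rabs (nth i (coords (contraction z c)) 0 - nth i (coords (contraction z c')) 0) <= e / 4).
  { intros i.
    assert (Hder : forall c, exists l, is_derive (fun c => nth i (coords (contraction z c)) 0) c l).
    { intros c0. destruct z as [[[x1 y1] [x2 y2]] [x3 y3]].
      unfold contraction, coords, V3, Crscal, c1, c2, c3.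
      do 6 (destruct i as [|i]; [cbn [nth fst snd]; eexists; auto_derive; [exact I|reflexivity]|]).
      exists 0. destruct i; apply (is_derive_const 0). }
    destruct (Hder c) as [l Hl].
    destruct (is_derive_cont _ c l Hl (e / 4) ltac:(lra)) as [d [Hd Hc]].
    exists d. split; [exact Hd|]. intros c' Hc' _. specialize (Hc c' Hc').
    rewrite Rabs_minus_sym. lra. }
  assert (U : forall N, exists d, 0 < d /\ forall c', Rabs (c' - c) < d -> forall i, (i < N)%nat -> (i < 6)%nat ->
    Rabs (nth i (coords (contraction z c)) 0 - nth i (coords (contraction z c')) 0) <= e / 4).
  { induction N as [|N [d [Hd IH]]].
    - exists 1. split; [lra|]. intros; lia.
    - destruct (H N) as [d' [Hd' H']]. exists (Rmin d d'). split; [apply Rmin_pos; assumption|].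
      intros c' Hc' i Hi Hi6. pose proof (Rmin_l d d'). pose proof (Rmin_r d d').
      destruct (Nat.eq_dec i N) as [->|]; [apply H'; lra || lia|apply IH; lra || lia]. }
  destruct (U 6%nat) as [d [Hd Hc]]. exists d. split; [exact Hd|]. intros c' Hc'.
  apply Rle_lt_trans with (3 * (e / 4)); [|lra].
  apply V3dist_le; [lra|]. intros i Hi. apply Hc; assumption.
Qed.

Lemma profile_b_lipschitz (n : nat) (l b : nat -> R -> R) (x y : R) : (0 < n)%nat -> profile n l b ->
  Rabs (b 0%nat x - b 0%nat y) <= Rabs (x - y) / 100.
Proof.
  intros Hn Hp.
  destruct (MVT_gen (b 0%nat) y x (b 1%nat)) as [c [_ E]].
  - intros u _. apply (profile_b_derive n l b Hp). exact Hn.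
  - intros u _. apply derivable_continuous_pt. exists (b 1%nat u).
    apply is_derive_Reals, (profile_b_derive n l b Hp). exact Hn.
  - rewrite E, Rabs_mult. pose proof (profile_b_slope n l b Hp c). pose proof (Rabs_pos (x - y)). nra.
Qed.

Lemma re12_sum_bound (z : C3) : Rabs (re12 z) <= (sq1 z + sq2 z) / 2.
Proof.
  apply Rle_trans with (1 := re12_bound z).
  pose proof (Cnorm_sq (c1 z)) as S1. pose proof (Cnorm_sq (c2 z)) as S2.
  fold (sq1 z) in S1. fold (sq2 z) in S2. rewrite <- S1, <- S2.
  pose proof (pow2_ge_0 (Cnorm (c1 z) - Cnorm (c2 z))). nra.
Qed.

Lemma sumsq_nonneg (x y : R) : 0 <= x ^ 2 + y ^ 2.
Proof. nra. Qed.

Lemma sq1_nonneg (z : C3) : 0 <= sq1 z.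
Proof. unfold sq1. nra. Qed.
Lemma sq2_nonneg (z : C3) : 0 <= sq2 z.
Proof. unfold sq2. nra. Qed.

Lemma profile_l_nonneg (n : nat) (l b : nat -> R -> R) (x : R) : profile n l b -> 0 <= x ->
  0 <= l 0%nat x.
Proof.
  intros Hp Hx. rewrite <- (profile_l_zero n l b Hp) at 1. apply (profile_l_mono n l b Hp). lra.
Qed.

(** Every nonnegative homogeneous term shrinks at least by [c^4]. Compared with [c^4] times the
    original inequality, the constant [-1/4] leaves a slack of [(1 - c^4) / 4], which pays for the
    terms without scaling: [l], at most [1/100], and the variation of [b], at most [(1 - c^4) / 25]
    after multiplication by [re12]. *)
Lemma contraction_defn (m n : nat) (l b : nat -> R -> R) (z : C3) (c : R) :
  (4 <= m)%nat -> (0 < n)%nat -> profile n l b -> defn m (l 0%nat) (b 0%nat) z < 0 -> 0 <= c <= 1 ->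
  defn m (l 0%nat) (b 0%nat) (contraction z c) < 0.
Proof.
  intros Hm Hn Hp Hz Hc.
  destruct (defn_region m n l b z Hm Hp ltac:(lra)) as [Ht [Hq _]].
  assert (E1 : sq1 (contraction z c) = c ^ 4 * sq1 z) by (unfold sq1; simpl; ring).
  assert (E2 : sq2 (contraction z c) = c ^ 6 * sq2 z) by (unfold sq2; simpl; ring).
  assert (E3 : cusp_re (contraction z c) = c ^ 6 * cusp_re z) by (unfold cusp_re; simpl; ring).
  assert (E4 : cusp_im (contraction z c) = c ^ 6 * cusp_im z) by (unfold cusp_im; simpl; ring).
  assert (E5 : re12 (contraction z c) = c ^ 5 * re12 z) by (unfold re12; simpl; ring).
  unfold defn in *. rewrite E1, E2, E3, E4, E5.
  change (fst (c3 (contraction z c))) with (- (1 / 2) + c ^ 2 * (fst (c3 z) + 1 / 2)).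
  change (snd (c3 (contraction z c))) with (c ^ 2 * snd (c3 z)).
  pose proof (sq1_nonneg z) as Ht0. pose proof (sq2_nonneg z) as Hq0.
  pose proof (re12_sum_bound z) as HY.
  set (t := sq1 z) in *. set (q := sq2 z) in *. set (y := re12 z) in *.
  set (X := (fst (c3 z) + 1 / 2) ^ 2 + snd (c3 z) ^ 2) in *.
  set (F := cusp_re z ^ 2 + cusp_im z ^ 2) in *.
  assert (HX : 0 <= X) by apply sumsq_nonneg. assert (HF : 0 <= F) by apply sumsq_nonneg.
  assert (C4 : 0 <= c ^ 4) by (apply pow_le; lra).
  assert (C41 : c ^ 4 <= 1) by (apply (pow_antitone c 0); [lra|lia]).
  assert (C54 : c ^ 5 <= c ^ 4) by (apply pow_antitone; [lra|lia]).
  assert (C5 : 0 <= c ^ 5) by (apply pow_le; lra).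
  assert (C6 : 0 <= c ^ 6 <= 1) by (split; [apply pow_le; lra|apply (pow_antitone c 0); [lra|lia]]).
  assert (C12 : 0 <= c ^ 12 <= c ^ 4) by (split; [apply pow_le; lra|apply pow_antitone; [lra|lia]]).
  assert (T1 : (c ^ 4 * t) ^ m <= c ^ 4 * t ^ m).
  { rewrite Rpow_mult_distr. apply Rmult_le_compat_r; [apply pow_le, Ht0|].
    rewrite <- pow_mult. apply pow_antitone; [lra|lia]. }
  assert (T2 : ((c ^ 6 * cusp_re z) ^ 2 + (c ^ 6 * cusp_im z) ^ 2) * (1 + c ^ 4 * t + c ^ 6 * q)
    <= c ^ 4 * (F * (1 + t + q))).
  { replace (((c ^ 6 * cusp_re z) ^ 2 + (c ^ 6 * cusp_im z) ^ 2)) with (c ^ 12 * F) by (unfold F; ring).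
    rewrite <- Rmult_assoc. apply Rmult_le_compat; try nra. }
  assert (T3 : l 0%nat (c ^ 4 * t) <= l 0%nat t) by (apply (profile_l_mono n l b Hp); nra).
  assert (T4 : l 0%nat t <= 1 / 100) by (apply (profile_l_small n l b Hp); lra).
  assert (T5 : 0 <= l 0%nat t) by (apply (profile_l_nonneg n l b t Hp Ht0)).
  set (d := c ^ 5 * b 0%nat (c ^ 4 * t) - c ^ 4 * b 0%nat t).
  assert (T6 : Rabs d <= (1 - c ^ 4) / 50).
  { replace d with (c ^ 5 * (b 0%nat (c ^ 4 * t) - b 0%nat t) + (c ^ 5 - c ^ 4) * b 0%nat t) by (unfold d; ring).
    eapply Rle_trans; [apply Rabs_triang|]. rewrite !Rabs_mult.
    rewrite (Rabs_right (c ^ 5)) by lra. rewrite (Rabs_left1 (c ^ 5 - c ^ 4)) by lra.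
    pose proof (profile_b_lipschitz n l b (c ^ 4 * t) t Hn Hp) as L.
    pose proof (profile_b_small n l b Hp t) as S.
    rewrite (Rabs_left1 (c ^ 4 * t - t)) in L by nra.
    pose proof (Rabs_pos (b 0%nat (c ^ 4 * t) - b 0%nat t)). pose proof (Rabs_pos (b 0%nat t)).
    assert (L' : Rabs (b 0%nat (c ^ 4 * t) - b 0%nat t) <= (1 - c ^ 4) / 100) by nra.
    assert (K1 : c ^ 5 * Rabs (b 0%nat (c ^ 4 * t) - b 0%nat t) <= 1 * ((1 - c ^ 4) / 100))
      by (apply Rmult_le_compat; lra).
    assert (C45 : c ^ 4 - c ^ 5 <= 1 - c ^ 4).
    { replace (c ^ 5) with (c ^ 4 * c) by ring. replace (c ^ 4) with (c * c ^ 3) at 3 by ring.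
      assert (0 <= c ^ 3 <= 1) by (split; [apply pow_le; lra|apply (pow_antitone c 0); [lra|lia]]). nra. }
    assert (K2 : - (c ^ 5 - c ^ 4) * Rabs (b 0%nat t) <= (1 - c ^ 4) * (1 / 100))
      by (apply Rmult_le_compat; lra).
    lra. }
  assert (T7 : - (y * d) <= (1 - c ^ 4) / 25).
  { apply Rle_trans with (Rabs (y * d)); [rewrite <- Rabs_Ropp; apply Rle_abs|].
    rewrite Rabs_mult. replace ((1 - c ^ 4) / 25) with (2 * ((1 - c ^ 4) / 50)) by field.
    apply Rmult_le_compat; try apply Rabs_pos; lra. }
  set (N := X + t ^ m + F * (1 + t + q)) in *.
  assert (HN : N - 1 / 4 + l 0%nat t - y * b 0%nat t < 0) by (unfold N; lra).
  assert (Goal' : c ^ 4 * (N - 1 / 4 + l 0%nat t - y * b 0%nat t) - (1 - c ^ 4) / 10 < 0).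
  { destruct (Req_dec (c ^ 4) 0) as [Z|Z]; [rewrite Z; lra|]. assert (0 < c ^ 4) by lra. nra. }
  assert (EX : (- (1 / 2) + c ^ 2 * (fst (c3 z) + 1 / 2) + 1 / 2) ^ 2 + (c ^ 2 * snd (c3 z)) ^ 2 = c ^ 4 * X)
    by (unfold X; ring).
  assert (K : c ^ 5 * y * b 0%nat (c ^ 4 * t) = y * d + c ^ 4 * (y * b 0%nat t)) by (unfold d; ring).
  rewrite EX, K. unfold N in Goal'.
  assert ((1 - c ^ 4) * l 0%nat t <= (1 - c ^ 4) * (1 / 100)) by (apply Rmult_le_compat_l; lra).
  lra.
Qed.

(** * Nonvanishing gradient on the boundary *)

(* [F] is homogeneous for the weights [2, 3]. *)
Definition euler (z : C3) : C3 := V3 (Crscal 2 (c1 z)) (Crscal 3 (c2 z)) C0.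

Lemma ddefn_euler (m : nat) (l1 b b1 : R -> R) (z : C3) : (1 <= m)%nat ->
  ddefn m l1 b b1 z (euler z) =
  4 * INR m * sq1 z ^ m + 12 * (cusp_re z ^ 2 + cusp_im z ^ 2) * (1 + sq1 z + sq2 z) +
  (cusp_re z ^ 2 + cusp_im z ^ 2) * (4 * sq1 z + 6 * sq2 z) + 4 * sq1 z * l1 (sq1 z) -
  5 * re12 z * b (sq1 z) - 4 * re12 z * sq1 z * b1 (sq1 z).
Proof.
  intros Hm.
  assert (E1 : dsq1 z (euler z) = 4 * sq1 z) by (unfold dsq1, sq1; simpl; ring).
  assert (E2 : dsq2 z (euler z) = 6 * sq2 z) by (unfold dsq2, sq2; simpl; ring).
  assert (E3 : dcusp_re z (euler z) = 6 * cusp_re z) by (unfold dcusp_re, cusp_re; simpl; ring).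
  assert (E4 : dcusp_im z (euler z) = 6 * cusp_im z) by (unfold dcusp_im, cusp_im; simpl; ring).
  assert (E5 : dre12 z (euler z) = 5 * re12 z) by (unfold dre12, re12; simpl; ring).
  unfold ddefn. rewrite E1, E2, E3, E4, E5.
  replace (sq1 z ^ m) with (sq1 z * sq1 z ^ pred m) by (destruct m; [lia|reflexivity]).
  simpl (fst (c3 (euler z))). simpl (snd (c3 (euler z))). ring.
Qed.

(** Transfers the vanishing of the six partial derivatives to the Euler direction. *)
Lemma ddefn_linear (m : nat) (l1 b b1 : R -> R) (z v : C3) :
  ddefn m l1 b b1 z v =
  fst (c1 v) * ddefn m l1 b b1 z (V3 C1 C0 C0) + snd (c1 v) * ddefn m l1 b b1 z (V3 Ci C0 C0) +
  fst (c2 v) * ddefn m l1 b b1 z (V3 C0 C1 C0) + snd (c2 v) * ddefn m l1 b b1 z (V3 C0 Ci C0) +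
  fst (c3 v) * ddefn m l1 b b1 z (V3 C0 C0 C1) + snd (c3 v) * ddefn m l1 b b1 z (V3 C0 C0 Ci).
Proof.
  unfold ddefn, dsq1, dsq2, dcusp_re, dcusp_im, dre12.
  unfold V3, C0, C1, Ci, c1 at 2 4 6, c2 at 2 4 6.
  destruct v as [[[v1 w1] [v2 w2]] [v3 w3]]. unfold c1, c2, c3; cbn [fst snd]. ring.
Qed.

(** At a critical zero the [w]-derivatives force [w = -1/2], so [t^m + |F|^2 (1 + t + q)] is close
    to [1/4]. The derivative along [euler z] is at least four times this sum up to small errors from
    [l] and [b], hence positive, a contradiction. *)
Lemma defn_gradient (m n : nat) (l b : nat -> R -> R) (z : C3) :
  (4 <= m)%nat -> (1 < n)%nat -> profile n l b -> defn m (l 0%nat) (b 0%nat) z = 0 ->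
  exists e L, In e basis6 /\
    derivable_pt_lim (fun t => defn m (l 0%nat) (b 0%nat) (V3add z (V3rscal t e))) 0 L /\ L <> 0.
Proof.
  intros Hm Hn Hp Hz. apply NNPP. intros HN.
  assert (H0 : forall e, In e basis6 -> ddefn m (l 1%nat) (b 0%nat) (b 1%nat) z e = 0).
  { intros e He. apply NNPP. intros Hne. apply HN. exists e. eexists. split; [exact He|].
    split; [|exact Hne]. apply is_derive_Reals.
    pose proof (defn_line m (l 0%nat) (l 1%nat) (b 0%nat) (b 1%nat)) as D.
    specialize (fun H1 H2 => D H1 H2 z e 0). rewrite line_zero in D. apply D.
    - intros x. apply (profile_l_derive n l b Hp). lia.
    - intros x. apply (profile_b_derive n l b Hp). lia. }
  unfold basis6 in H0.
  pose proof (H0 (V3 C1 C0 C0) ltac:(simpl; tauto)) as D1.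
  pose proof (H0 (V3 Ci C0 C0) ltac:(simpl; tauto)) as D2.
  pose proof (H0 (V3 C0 C1 C0) ltac:(simpl; tauto)) as D3.
  pose proof (H0 (V3 C0 Ci C0) ltac:(simpl; tauto)) as D4.
  pose proof (H0 (V3 C0 C0 C1) ltac:(simpl; tauto)) as D5.
  pose proof (H0 (V3 C0 C0 Ci) ltac:(simpl; tauto)) as D6.
  pose proof (ddefn_linear m (l 1%nat) (b 0%nat) (b 1%nat) z (euler z)) as EL.
  rewrite D1, D2, D3, D4, D5, D6, (ddefn_euler m _ _ _ z ltac:(lia)) in EL.
  assert (X5 : fst (c3 z) + 1 / 2 = 0).
  { revert D5. unfold ddefn, dsq1, dsq2, dcusp_re, dcusp_im, dre12. simpl. lra. }
  assert (X6 : snd (c3 z) = 0).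
  { revert D6. unfold ddefn, dsq1, dsq2, dcusp_re, dcusp_im, dre12. simpl. lra. }
  destruct (defn_region m n l b z Hm Hp ltac:(lra)) as [Ht [Hq _]].
  unfold defn in Hz. rewrite X5, X6 in Hz.
  pose proof (sq1_nonneg z) as Ht0. pose proof (sq2_nonneg z) as Hq0.
  pose proof (re12_sum_bound z) as HY.
  set (t := sq1 z) in *. set (q := sq2 z) in *. set (y := re12 z) in *.
  set (F := cusp_re z ^ 2 + cusp_im z ^ 2) in *.
  assert (HF : 0 <= F) by apply sumsq_nonneg.
  pose proof (profile_l_small n l b Hp t ltac:(lra)) as L0.
  pose proof (profile_l_slope n l b Hp t Ht0) as L1.
  pose proof (profile_b_small n l b Hp t) as B0. pose proof (profile_b_slope n l b Hp t) as B1.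
  assert (Htm : 0 <= t ^ m) by (apply pow_le, Ht0).
  assert (Hm1 : 1 <= INR m) by (apply (le_INR 1); lia).
  assert (K1 : y * b 0%nat t <= 2 * (1 / 100)).
  { apply Rle_trans with (1 := Rle_abs _). rewrite Rabs_mult. apply Rmult_le_compat; try apply Rabs_pos; lra. }
  assert (K2 : y * b 1%nat t <= 2 * (1 / 100)).
  { apply Rle_trans with (1 := Rle_abs _). rewrite Rabs_mult. apply Rmult_le_compat; try apply Rabs_pos; lra. }
  assert (K3 : 4 * y * t * b 1%nat t <= 4 * (2 * (1 / 100))).
  { replace (4 * y * t * b 1%nat t) with (4 * (t * (y * b 1%nat t))) by ring.
    apply Rmult_le_compat_l; [lra|]. nra. }
  assert (K4 : 0 <= t * l 1%nat t) by nra.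
  assert (K5 : 4 * t ^ m <= 4 * INR m * t ^ m) by nra.
  assert (K6 : 0 <= F * (1 + t + q)) by nra.
  assert (K7 : 0 <= F * (4 * t + 6 * q)) by nra.
  lra.
Qed.

Lemma C3_ext (z w : C3) : fst (c1 z) = fst (c1 w) -> snd (c1 z) = snd (c1 w) ->
  fst (c2 z) = fst (c2 w) -> snd (c2 z) = snd (c2 w) ->
  fst (c3 z) = fst (c3 w) -> snd (c3 z) = snd (c3 w) -> z = w.
Proof.
  destruct z as [[[x1 y1] [x2 y2]] [x3 y3]], w as [[[a1 b1] [a2 b2]] [a3 b3]].
  cbn. intros; subst; reflexivity.
Qed.

(** * Pseudoconvexity, boundedness and the domain property *)

Lemma sublevel_pseudoconvex (m n : nat) (l b : nat -> R -> R) :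
  (4 <= m)%nat -> (2 < n)%nat -> profile n l b ->
  cont3 (defn m (l 0%nat) (b 0%nat)) ->
  is_bounded V3dist V3zero (fun z => defn m (l 0%nat) (b 0%nat) z < 0) ->
  pseudoconvex (fun z => defn m (l 0%nat) (b 0%nat) z < 0).
Proof.
  intros Hm Hn Hp Hcont Hbd. set (r := defn m (l 0%nat) (b 0%nat)) in *.
  assert (Hu : cont_on V3dist (fun z => r z < 0) (fun z => - / r z)).
  { intros x Hx e He.
    assert (Hd : is_derive (fun t => - / t) (r x) (/ r x ^ 2)).
    { auto_derive; [lra|]. field. lra. }
    destruct (is_derive_cont _ _ _ Hd e He) as [d [Hd0 H]].
    destruct (Hcont x I d Hd0) as [d' [Hd' H']].
    exists d'. split; [exact Hd'|]. intros y _ Hy. apply H, H'; auto. }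
  exists (fun z => - / r z). split; [split; [exact Hu|]|].
  - intros z w.
    apply (subharmonic_neg_inv (fun la => r (V3add z (V3cscal la w)) < 0) (fun la => r (V3add z (V3cscal la w)))).
    + auto.
    + intros la Hla e He. destruct (Hu _ Hla e He) as [d [Hd H]].
      pose proof (V3norm_nonneg w) as Hw.
      exists (d / (V3norm w + 1)). split; [apply Rdiv_lt_0_compat; lra|].
      intros la' Hla' Hlt. apply H; [exact Hla'|]. rewrite V3dist_line.
      pose proof (Cnorm_nonneg (Cadd la (Copp la'))) as Q. fold (Cdist la la') in Q.
      apply (Rmult_lt_compat_r (V3norm w + 1)) in Hlt; [|lra].
      replace (d / (V3norm w + 1) * (V3norm w + 1)) with d in Hlt by (field; lra). nra.
    + intros la Hla. set (Z := V3add z (V3cscal la w)) in *.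
      (* On a complex line the two real directions of the parameter are [w] and [i w], so the
         Laplacian is the sum treated in [laplace_nonneg]. *)
      assert (EX : forall s, V3add z (V3cscal (Cadd la (Crscal s C1)) w) = line Z w s).
      { intros s. unfold Z, line. apply C3_ext; simpl; ring. }
      assert (EY : forall s, V3add z (V3cscal (Cadd la (Crscal s Ci)) w) = line Z (V3cscal Ci w) s).
      { intros s. unfold Z, line. apply C3_ext; simpl; ring. }
      destruct (defn_region m n l b Z Hm Hp) as [Ht [Hq _]]; [fold r; lra|].
      assert (Hl0 : forall x, is_derive (l 0%nat) x (l 1%nat x)) by (intros; apply (profile_l_derive n l b Hp); lia).
      assert (Hl1 : forall x, is_derive (l 1%nat) x (l 2%nat x)) by (intros; apply (profile_l_derive n l b Hp); lia).
      assert (Hb0 : forall x, is_derive (b 0%nat) x (b 1%nat x)) by (intros; apply (profile_b_derive n l b Hp); lia).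
      assert (Hb1 : forall x, is_derive (b 1%nat) x (b 2%nat x)) by (intros; apply (profile_b_derive n l b Hp); lia).
      set (D1 := ddefn m (l 1%nat) (b 0%nat) (b 1%nat)).
      set (D2 := dddefn m (l 1%nat) (l 2%nat) (b 0%nat) (b 1%nat) (b 2%nat)).
      exists (fun s => D1 (line Z w s) w), (fun s => D1 (line Z (V3cscal Ci w) s) (V3cscal Ci w)),
        (D2 Z w), (D2 Z (V3cscal Ci w)).
      split; [|split; [|split; [|split]]].
      * intros s. eapply is_derive_ext; [intros t; rewrite EX; reflexivity|].
        apply defn_line; assumption.
      * eapply is_derive_eq; [apply ddefn_line; eassumption|]. rewrite line_zero. reflexivity.
      * intros s. eapply is_derive_ext; [intros t; rewrite EY; reflexivity|].
        apply defn_line; assumption.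
      * eapply is_derive_eq; [apply ddefn_line; eassumption|]. rewrite line_zero. reflexivity.
      * apply (laplace_nonneg m n l b Z w Hp Ht Hq).
  - intros c. exists (fun z => r z < 0 /\ - / r z <= c). split; [split|split].
    (* For [c <= 0] the set is empty, as [-1/r] is positive. For [c > 0] it is [r <= -1/c], closed
       in the whole space. *)
    + intros x Hx. destruct (Rle_dec c 0) as [Hc|Hc].
      { exfalso. destruct (Hx 1 Rlt_0_1) as [y [[Y1 Y2] _]].
        assert (/ r y < 0) by (apply Rinv_lt_0_compat, Y1). lra. }
      assert (Hic : 0 < / c) by (apply Rinv_0_lt_compat; lra).
      assert (Key : forall t, t < 0 -> - / t <= c -> t <= - / c).
      { intros t Ht H. assert (0 < / - t) by (apply Rinv_0_lt_compat; lra).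
        rewrite <- Rinv_opp in H.
        assert (/ c <= / / - t) by (apply Rinv_le_contravar; lra). rewrite Rinv_inv in H1. lra. }
      assert (Hrx : r x <= - / c).
      { apply Rnot_lt_le. intros L. destruct (cont3_pos_open r x (- / c) Hcont L) as [d [Hd H]].
        destruct (Hx d Hd) as [y [[Y1 Y2] Y3]]. specialize (H y Y3). specialize (Key _ Y1 Y2). lra. }
      split; [lra|]. rewrite <- Rinv_opp. rewrite <- (Rinv_inv c). apply Rinv_le_contravar; lra.
    + destruct Hbd as [M HM]. exists M. intros x [Hx _]. apply HM, Hx.
    + intros z [Hz _]. exact Hz.
    + intros z Hz Hc. split; [exact Hz|lra].
Qed.

Lemma sublevel_bounded (m n : nat) (l b : nat -> R -> R) :
  (4 <= m)%nat -> profile n l b ->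
  is_bounded V3dist V3zero (fun z => defn m (l 0%nat) (b 0%nat) z < 0).
Proof.
  intros Hm Hp. exists (3 * 2). intros z Hz.
  destruct (defn_region m n l b z Hm Hp ltac:(lra)) as [Ht [Hq [H3 H4]]].
  unfold sq1, sq2 in *.
  apply V3dist_le; [lra|]. intros i Hi.
  do 6 (destruct i as [|i];
    [cbn [nth coords]; simpl (fst _) at 2 || simpl (snd _) at 2; apply Rabs_le; simpl; nra|]). lia.
Qed.

Lemma sublevel_domain (m n : nat) (l b : nat -> R -> R) :
  (4 <= m)%nat -> (0 < n)%nat -> profile n l b -> cont3 (defn m (l 0%nat) (b 0%nat)) ->
  is_domain V3dist (fun z => defn m (l 0%nat) (b 0%nat) z < 0).
Proof.
  intros Hm Hn Hp Hcont.
  assert (Hb : defn m (l 0%nat) (b 0%nat) base_point < 0).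
  { unfold defn, base_point, sq1, sq2, cusp_re, cusp_im, re12. simpl.
    rewrite !Rmult_0_l, !Rplus_0_l, pow_i, (profile_l_zero n l b Hp) by lia. lra. }
  split; [|split].
  - intros x Hx. apply cont3_neg_open; assumption.
  - apply (connected_of_paths _ base_point Hb). intros z Hz. exists (contraction z).
    split; [|split; [|split]].
    + apply C3_ext; simpl; ring.
    + apply C3_ext; simpl; ring.
    + intros c Hc. apply (contraction_defn m n l b z c); assumption.
    + intros c e He. apply contraction_continuous, He.
  - exists base_point. exact Hb.
Qed.

(** * The boundary point, the discs and the Kobayashi metric *)

Definition normal : C3 := V3 C0 C0 C1.

Lemma defn_zero (m n : nat) (l b : nat -> R -> R) (x : R) : (0 < m)%nat -> profile n l b ->
  defn m (l 0%nat) (b 0%nat) (V3 C0 C0 (x, 0)) = x + x ^ 2.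
Proof.
  intros Hm Hp. unfold defn, sq1, sq2, cusp_re, cusp_im, re12. simpl.
  rewrite !Rmult_0_l, !Rplus_0_l, pow_i, (profile_l_zero n l b Hp) by lia. field.
Qed.

Lemma origin_boundary (m n : nat) (l b : nat -> R -> R) : (0 < m)%nat -> profile n l b ->
  bdry V3dist (fun z => defn m (l 0%nat) (b 0%nat) z < 0) V3zero.
Proof.
  intros Hm Hp. split.
  - intros e He. set (d := Rmin (1 / 2) (e / 2)).
    assert (Hd : 0 < d <= 1 / 2 /\ d <= e / 2).
    { unfold d. repeat split; [apply Rmin_pos; lra|apply Rmin_l|apply Rmin_r]. }
    exists (V3 C0 C0 (- d, 0)). split.
    + rewrite (defn_zero m n l b) by assumption. nra.
    + apply Rle_lt_trans with d; [|lra].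
      apply le_of_sq_le; [lra|]. rewrite V3dist_sq. simpl. nra.
  - intros [r [Hr H]].
    assert (V3dist V3zero V3zero <= 0).
    { apply le_of_sq_le; [lra|]. rewrite V3dist_sq. simpl. lra. }
    assert (L : defn m (l 0%nat) (b 0%nat) V3zero < 0) by (apply H; lra).
    pose proof (defn_zero m n l b 0 Hm Hp) as Z.
    change (V3 C0 C0 (0, 0)) with V3zero in Z. rewrite Z in L. lra.
Qed.

Lemma V3norm_le (z : C3) : V3norm z <= Cnorm (c1 z) + Cnorm (c2 z) + Cnorm (c3 z).
Proof.
  pose proof (Cnorm_nonneg (c1 z)). pose proof (Cnorm_nonneg (c2 z)). pose proof (Cnorm_nonneg (c3 z)).
  apply le_of_sq_le; [lra|]. rewrite V3norm_sq.
  assert (E : V3dot z z = Cnorm (c1 z) ^ 2 + Cnorm (c2 z) ^ 2 + Cnorm (c3 z) ^ 2).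
  { rewrite !Cnorm_sq. unfold V3dot, Cdot. ring. }
  rewrite E. nra.
Qed.

Definition disc (rho d A : R) (la : C) : C3 :=
  V3 (Crscal (rho ^ 2) (Cmul la la)) (Crscal (rho ^ 3) (Cmul la (Cmul la la)))
     (- d + A * fst la, A * snd la).

Definition disc' (rho A : R) (la : C) : C3 :=
  V3 (Crscal (2 * rho ^ 2) la) (Crscal (3 * rho ^ 3) (Cmul la la)) (A, 0).

Lemma disc_derivative (rho d A : R) (la : C) : 0 < rho <= 1 -> unit_disc la ->
  Cderiv3 (disc rho d A) la (disc' rho A la).
Proof.
  intros Hr Hla e He. unfold unit_disc in Hla.
  (* The remainder is at most [|h|^2] from the square and [4 |h|^2] from the cube, since [|la| < 1]
     and [|h| < 1]. *)
  exists (Rmin 1 (e / 5)). split; [apply Rmin_pos; lra|]. intros h [Hh0 Hh] _.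
  pose proof (Rmin_l 1 (e / 5)). pose proof (Rmin_r 1 (e / 5)).
  assert (E : V3sub (V3sub (disc rho d A (Cadd la h)) (disc rho d A la)) (V3cscal h (disc' rho A la)) =
    V3 (Crscal (rho ^ 2) (Cmul h h)) (Crscal (rho ^ 3) (Cadd (Cmul (3, 0) (Cmul la (Cmul h h))) (Cmul h (Cmul h h)))) C0).
  { apply C3_ext; simpl; ring. }
  rewrite E. eapply Rle_trans; [apply V3norm_le|].
  assert (R1 : forall t w, Cnorm (Crscal t w) = Rabs t * Cnorm w).
  { intros t w. replace (Crscal t w) with (Cmul (t, 0) w) by (apply C_ext; simpl; ring).
    rewrite Cnorm_mul, (Cnorm_rscal 1 t (t, 0)) by (simpl; lra). ring. }
  unfold c1, c2, c3, V3; cbn [fst snd]. rewrite !R1, !Cnorm_mul.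
  rewrite !Rabs_right by (apply Rle_ge, pow_le; lra).
  assert (Z0 : Cnorm C0 = 0).
  { pose proof (Cnorm_sq C0) as S. simpl in S. pose proof (Cnorm_nonneg C0). nra. }
  pose proof (Cnorm_triang (Cmul (3, 0) (Cmul la (Cmul h h))) (Cmul h (Cmul h h))) as T.
  rewrite !Cnorm_mul, (Cnorm_rscal 3 1 (3, 0)), Rabs_R1 in T by (simpl; lra).
  rewrite Z0.
  set (u := Cnorm h) in *. set (L := Cnorm la) in *.
  assert (L0 : 0 <= L) by apply Cnorm_nonneg.
  assert (R2 : 0 <= rho ^ 2 <= 1) by (split; [apply pow_le; lra|apply (pow_antitone rho 0); [lra|lia]]).
  assert (R3 : 0 <= rho ^ 3 <= 1) by (split; [apply pow_le; lra|apply (pow_antitone rho 0); [lra|lia]]).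
  assert (Q : 0 <= u * u) by nra.
  assert (T2 : 3 * 1 * (L * (u * u)) + u * (u * u) <= 4 * (u * u)) by nra.
  set (W := Cnorm (Cadd (Cmul (3, 0) (Cmul la (Cmul h h))) (Cmul h (Cmul h h)))) in *.
  assert (W0 : 0 <= W) by apply Cnorm_nonneg.
  assert (rho ^ 2 * (u * u) <= 1 * (u * u)) by (apply Rmult_le_compat_r; lra).
  assert (rho ^ 3 * W <= 1 * W) by (apply Rmult_le_compat_r; lra).
  assert (u * u <= e / 5 * u) by (apply Rmult_le_compat_r; lra).
  lra.
Qed.

(** On the disc [F] vanishes and [re12 = s^4 Re mu] with [mu = rho la], so the linear part of [Re w]
    and the term with [b] combine to [(rho^m - t b(t)) Re mu], where [t = s^4]. *)
Lemma disc_inside (m n : nat) (l b : nat -> R -> R) (rho : R) (la : C) :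
  (4 <= m)%nat -> profile n l b -> 0 < rho <= 1 / 2 ->
  (forall s, 0 <= s <= rho ->
    - rho ^ (m + 2) + Rabs (rho ^ m - s ^ 4 * b 0%nat (s ^ 4)) * s +
      4 * rho ^ (2 * m + 2) + (s ^ 4) ^ m + l 0%nat (s ^ 4) < 0) ->
  unit_disc la -> defn m (l 0%nat) (b 0%nat) (disc rho (rho ^ (m + 2)) (rho ^ (m + 1)) la) < 0.
Proof.
  intros Hm Hp Hr Hest Hla. unfold unit_disc in Hla.
  pose proof (Cnorm_nonneg la) as Hn0. pose proof (Cnorm_sq la) as Hsq.
  set (s := rho * Cnorm la).
  assert (Hs : 0 <= s <= rho) by (unfold s; nra).
  specialize (Hest s Hs).
  set (z := disc rho (rho ^ (m + 2)) (rho ^ (m + 1)) la).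
  assert (Hs2 : s ^ 2 = rho ^ 2 * (fst la ^ 2 + snd la ^ 2)) by (unfold s; rewrite Rpow_mult_distr, Hsq; ring).
  assert (E1 : sq1 z = s ^ 4).
  { replace (s ^ 4) with ((s ^ 2) ^ 2) by ring. rewrite Hs2. unfold sq1, z. simpl. ring. }
  assert (E3 : cusp_re z = 0) by (unfold cusp_re, z; simpl; ring).
  assert (E4 : cusp_im z = 0) by (unfold cusp_im, z; simpl; ring).
  assert (E5 : re12 z = s ^ 4 * (rho * fst la)).
  { replace (s ^ 4) with ((s ^ 2) ^ 2) by ring. rewrite Hs2. unfold re12, z. simpl. ring. }
  unfold defn. rewrite E1, E3, E4, E5.
  change (fst (c3 z)) with (- rho ^ (m + 2) + rho ^ (m + 1) * fst la).
  change (snd (c3 z)) with (rho ^ (m + 1) * snd la).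
  assert (HA : rho ^ (m + 1) = rho ^ m * rho) by (rewrite pow_add; ring).
  set (d := rho ^ (m + 2)) in *. set (A := rho ^ (m + 1)) in *.
  set (p := rho * fst la).
  assert (Hp' : Rabs p <= s).
  { apply le_of_sq_le; [lra|]. rewrite pow2_abs, Hs2. unfold p. pose proof (pow2_ge_0 (snd la)).
    pose proof (pow2_ge_0 rho). nra. }
  (* This is [|w|^2 <= 2 d^2 + 2 A^2 |la|^2 <= 4 A^2]. *)
  assert (HQ : (- d + A * fst la) ^ 2 + (A * snd la) ^ 2 <= 4 * rho ^ (2 * m + 2)).
  { replace (2 * m + 2)%nat with ((m + 1) * 2)%nat by lia. rewrite pow_mult. fold A.
    assert (HdA : 0 <= d <= A).
    { split; [apply pow_le; lra|apply pow_antitone; [lra|lia]]. }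
    assert (Hf : fst la ^ 2 + snd la ^ 2 <= 1) by (rewrite <- Hsq; nra).
    pose proof (pow2_ge_0 (d + A * fst la)). pose proof (pow2_ge_0 (A * snd la)).
    assert (A ^ 2 * (fst la ^ 2 + snd la ^ 2) <= A ^ 2 * 1) by (apply Rmult_le_compat_l; [nra|exact Hf]).
    assert (d ^ 2 <= A ^ 2) by (apply pow_incr; lra).
    assert ((A * snd la) ^ 2 = A ^ 2 * snd la ^ 2) by ring.
    assert ((- d + A * fst la) ^ 2 + (d + A * fst la) ^ 2 = 2 * d ^ 2 + 2 * (A ^ 2 * fst la ^ 2)) by ring.
    nra. }
  assert (HB : (rho ^ m - s ^ 4 * b 0%nat (s ^ 4)) * p <= Rabs (rho ^ m - s ^ 4 * b 0%nat (s ^ 4)) * s).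
  { apply Rle_trans with (1 := Rle_abs _). rewrite Rabs_mult. apply Rmult_le_compat_l; [apply Rabs_pos|exact Hp']. }
  assert (HAp : A * fst la = rho ^ m * p) by (rewrite HA; unfold p; ring).
  replace (0 ^ 2 + 0 ^ 2) with 0 by ring. nra.
Qed.

Lemma infimum_exists (E : R -> Prop) (a : R) : (forall x, E x -> 0 <= x) -> E a ->
  exists m, is_inf E m /\ m <= a.
Proof.
  intros H0 Ha.
  destruct (completeness (fun y => E (- y))) as [s [S1 S2]].
  - exists 0. intros y Hy. specialize (H0 _ Hy). lra.
  - exists (- a). rewrite Ropp_involutive. exact Ha.
  - assert (L : forall x, E x -> - s <= x).
    { intros x Hx. assert (- x <= s); [|lra]. apply S1. rewrite Ropp_involutive. exact Hx. }
    exists (- s). split; [split|apply L, Ha]; [exact L|].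
    intros m' Hm'. assert (s <= - m'); [|lra]. apply S2. intros y Hy. specialize (Hm' _ Hy). lra.
Qed.

Lemma pow_strict (x y : R) (n : nat) : 0 < x < y -> x ^ S n < y ^ S n.
Proof.
  intros H. induction n as [|n IH]; [lra|].
  change (x * x ^ S n < y * y ^ S n).
  assert (0 < x ^ S n) by (apply pow_lt; lra). nra.
Qed.

Theorem theorem3 : forall k : nat, (0 < k)%nat ->
  exists (D : C3 -> Prop) (P : C3) (eps : R) (delta : nat -> R) (n : C3),
    is_domain V3dist D /\ is_bounded V3dist V3zero D /\ pseudoconvex D /\
    Ck_boundary k D /\
    bdry V3dist D P /\ outward_unit_normal D P n /\
    eps > 0 /\
    (forall nu, 0 < delta nu) /\
    (forall nu, delta (S nu) < delta nu) /\
    Un_cv delta 0 /\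
    (forall nu, D (V3sub P (V3rscal (delta nu) n))) /\
    (forall nu, exists m,
       kobayashi D (V3sub P (V3rscal (delta nu) n)) n m /\
       m <= / Rpower (delta nu) (1 - eps)).
Proof.
  intros k Hk.
  (* The order exceeds [k], for a boundary of class [C^k], and 2, for the Levi form. *)
  destruct (profile_exists (k + 3)) as [m [l [b [r [Hm [Hp [Hr1 [Hr2 [Hr3 Hest]]]]]]]]].
  set (f := defn m (l 0%nat) (b 0%nat)).
  assert (Hcont : cont3 f) by (apply (smooth3_cont 0), (smooth3_defn 0 (k + 3) m l b); [lia|exact Hp]).
  (* Needed twice: [j = k] for the boundary and [j = 1] for the normal, where [0 < k] enters. *)
  assert (Hdef : forall j, (j <= k)%nat -> defining_function j (fun z => f z < 0) (fun _ => True) f).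
  { intros j Hj. split; [|split; [|split; [|split]]].
    - intros x _. exists 1. split; [lra|auto].
    - auto.
    - apply (smooth3_defn j (k + 3) m l b); [lia|exact Hp].
    - intros z _. reflexivity.
    - intros z Hz. apply (defn_gradient m (k + 3) l b z); [exact Hm|lia|exact Hp|].
      apply bdry_sublevel; assumption. }
  assert (Hpoint : forall d, V3sub V3zero (V3rscal d normal) = V3 C0 C0 (- d, 0)).
  { intros d. apply C3_ext; simpl; ring. }
  assert (Hdisc0 : forall rh d A, disc rh d A C0 = V3 C0 C0 (- d, 0)).
  { intros. apply C3_ext; simpl; ring. }
  assert (Hin : forall nu la, unit_disc la -> f (disc (r nu) (r nu ^ (m + 2)) (r nu ^ (m + 1)) la) < 0).
  { intros nu la Hla. apply (disc_inside m (k + 3) l b); auto. }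
  assert (U0 : unit_disc C0).
  { unfold unit_disc. pose proof (Cnorm_sq C0) as S. simpl in S. pose proof (Cnorm_nonneg C0). nra. }
  (* With [delta = r^(m+2)] the disc has derivative [r^(m+1)] times the normal, and
     [r^(m+1) = delta^(1 - eps)] exactly for [eps = 1 / (m + 2)]. *)
  exists (fun z => f z < 0), V3zero, (/ INR (m + 2)), (fun nu => r nu ^ (m + 2)), normal.
  assert (HI : 0 < INR (m + 2)) by (apply lt_0_INR; lia).
  split; [apply (sublevel_domain m (k + 3)); [exact Hm|lia|exact Hp|exact Hcont]|].
  assert (Hbd : is_bounded V3dist V3zero (fun z => f z < 0)) by (apply (sublevel_bounded m (k + 3)); assumption).
  split; [exact Hbd|].
  split; [apply (sublevel_pseudoconvex m (k + 3)); [exact Hm|lia|exact Hp|exact Hcont|exact Hbd]|].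
  split; [exists (fun _ => True), f; apply Hdef; lia|].
  split; [apply (origin_boundary m (k + 3)); [lia|exact Hp]|].
  split.
  { exists (fun _ => True), f. split; [apply Hdef; lia|]. split; [exact I|]. split.
    - assert (E : V3norm normal ^ 2 = 1) by (rewrite V3norm_sq; unfold V3dot, Cdot; simpl; ring).
      pose proof (V3norm_nonneg normal). nra.
    - exists 1. split; [lra|]. intros v. apply is_derive_Reals.
      pose proof (defn_line m (l 0%nat) (l 1%nat) (b 0%nat) (b 1%nat)) as D.
      specialize (fun H1 H2 => D H1 H2 V3zero v 0). rewrite line_zero in D.
      eapply is_derive_eq; [apply D|].
      + intros x. apply (profile_l_derive (k + 3) l b Hp). lia.
      + intros x. apply (profile_b_derive (k + 3) l b Hp). lia.
      + unfold ddefn, V3dot, Cdot, dsq1, dsq2, dcusp_re, dcusp_im, dre12, cusp_re, cusp_im, re12. simpl. field. }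
  split; [apply Rinv_0_lt_compat, HI|].
  split; [intros nu; apply pow_lt, Hr1|].
  split.
  { intros nu. replace (m + 2)%nat with (S (m + 1)) by lia. apply pow_strict.
    split; [apply Hr1|apply Hr2]. }
  split.
  { intros e He. destruct (Hr3 e He) as [N HN]. exists N. intros j Hj. specialize (HN j Hj).
    unfold Rdist in *. rewrite Rminus_0_r in *. destruct (Hr1 j).
    assert (0 < r j ^ (m + 2)) by (apply pow_lt; lra).
    assert (r j ^ (m + 2) <= r j ^ 1) by (apply pow_antitone; [lra|lia]).
    rewrite pow_1 in *. rewrite Rabs_right in * by lra. lra. }
  split; [intros nu; rewrite Hpoint, <- (Hdisc0 (r nu) _ (r nu ^ (m + 1))); apply Hin, U0|].
  intros nu. rewrite Hpoint. destruct (Hr1 nu) as [R1 R2].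
  assert (HA : 0 < r nu ^ (m + 1)) by (apply pow_lt, R1).
  apply infimum_exists; [intros x [Hx _]; lra|].
  replace (Rpower (r nu ^ (m + 2)) (1 - / INR (m + 2))) with (r nu ^ (m + 1)).
  2: { rewrite <- (Rpower_pow (m + 2)), Rpower_mult by exact R1.
       replace (INR (m + 2) * (1 - / INR (m + 2))) with (INR (m + 1)).
       - rewrite Rpower_pow by exact R1. reflexivity.
       - rewrite Rmult_minus_distr_l, Rinv_r by lra. rewrite !plus_INR. simpl. ring. }
  split; [apply Rinv_0_lt_compat, HA|].
  exists (disc (r nu) (r nu ^ (m + 2)) (r nu ^ (m + 1))), (disc' (r nu) (r nu ^ (m + 1)) C0).
  split; [split|split; [|split]].
  - intros la Hla. exists (disc' (r nu) (r nu ^ (m + 1)) la). apply disc_derivative; [lra|exact Hla].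
  - intros la Hla. apply Hin, Hla.
  - apply Hdisc0.
  - apply disc_derivative; [lra|exact U0].
  - apply C3_ext; simpl; field; lra.
Qed.
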